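(* Consider the model of $L$ independent parallel scalar complex fast fading channels described in the context. Let $\epsilon>0$ be fixed and let $\delta^*(n,\epsilon)$ be the supremum of the NLDs of $nL$ complex-dimensional infinite constellations (transmitted over $n$ uses of the parallel model) with average error probability at most $\epsilon$. Then, as $n\to\infty$, $$\delta^*(n,\epsilon)=\delta^*-\sqrt{\frac Vn}Q^{-1}(\epsilon)+O\!\left(\frac{\ln n}{n}\right),$$ where $\delta^*=E\{\ln\det(\frac{\mathbf H^\dagger\mathbf H}{\pi e\sigma^2})\}$ and $V=L+\mathrm{Var}(\ln\det(\mathbf H^\dagger\mathbf H))$, with $\mathbf H=\mathrm{diag}(H^{(1)},\dots,H^{(L)})$.
   Context: Model: $\mathbf y=\mathbf H\mathbf x+\mathbf z$ with $\mathbf x,\mathbf y,\mathbf z\in\mathbb C^L$, $\mathbf H=\mathrm{diag}(H^{(1)},\dots,H^{(L)})$ with $H^{(l)}$ i.i.d. circularly symmetric $CN(0,1)$, $\mathbf z\sim CN(0,\sigma^2I_L)$; channel uses are i.i.d. (fast fading) and the receiver knows $\mathbf H$ at each use. An IC of complex dimension $nL$ is a countable $S\subset\mathbb C^{nL}$ with density $\gamma=\limsup_a|S\cap\mathrm{Cb}(a)|/a^{2nL}$, $\mathrm{Cb}(a)=\{|\mathrm{Re}x_i|,|\mathrm{Im}x_i|<a/2\}$, and NLD $\frac1n\ln\gamma$. Average error probability: expectation over the fading of the limsup over $a$ of the average, over received points in the faded cube, of the ML (Voronoi-cell) error probability given the fading. $Q$ is the standard Gaussian complementary CDF. *)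

(* Defs.v *)
From HB Require Import structures.
From mathcomp Require Import all_boot all_order all_algebra.
From mathcomp Require Import all_classical all_reals all_analysis.
Set Implicit Arguments. Unset Strict Implicit. Unset Printing Implicit Defensive.
Import Order.TTheory GRing.Theory Num.Theory.
Local Open Scope classical_set_scope.
Local Open Scope ring_scope.

Section Channel.
Variable R : realType.

Definition cmul (u v : R * R) : R * R :=
  (u.1 * v.1 - u.2 * v.2, u.1 * v.2 + u.2 * v.1).
Definition cadd (u v : R * R) : R * R := (u.1 + v.1, u.2 + v.2).
Definition csub (u v : R * R) : R * R := (u.1 - v.1, u.2 - v.2).
Definition cabs2 (u : R * R) : R := u.1 ^+ 2 + u.2 ^+ 2.

Definition vnorm2 {T : finType} (x : T -> R * R) : R := \sum_(i : T) cabs2 (x i).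

(* Iterated expectation over a vector z : T -> C whose entries are i.i.d.
   circularly symmetric complex Gaussian CN(0, 2 s^2), i.e. real and
   imaginary parts i.i.d. N(0, s^2) (s = standard deviation of each part).
   The recursion runs over the list of indices [ks]; applied to [enum T]
   it is the integral against the product Gaussian measure. *)
Fixpoint gexp {T : eqType} (ks : seq T) (s : R)
    (f : (T -> R * R) -> \bar R) : \bar R :=
  match ks with
  | [::] => f (fun _ => (0, 0))
  | k :: ks' =>
    (\int[lebesgue_measure]_x ((normal_pdf 0 s x)%:E *
      \int[lebesgue_measure]_y ((normal_pdf 0 s y)%:E *
        gexp ks' s (fun g => f (fun j => if j == k then (x, y) else g j)))))%E
  end.

Definition CNexp (T : finType) (var : R) (f : (T -> R * R) -> \bar R) : \bar R :=
  gexp (enum T) (Num.sqrt (var / 2)) f.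

(* Index set for n channel uses of the L-branch parallel model:
   (time t, branch l); complex dimension n*L. *)
Definition idx (n L : nat) : finType := ('I_n * 'I_L)%type.

Definition cube {T : finType} (a : R) : set (T -> R * R) :=
  [set x | forall i, `|(x i).1| < a / 2 /\ `|(x i).2| < a / 2].

(* Error probability of the ML (nearest faded point = Voronoi cell of the
   faded constellation) decoder for transmitted point s of constellation S,
   given fading realization h, noise z ~ CN(0, sigma2 I). An error occurs
   when the received point h s + z is not strictly closer to h s than to
   every other faded point h s'. *)
Definition pe_point {T : finType} (sigma2 : R) (S : set (T -> R * R))
    (h s : T -> R * R) : \bar R :=
  @CNexp T sigma2 (fun z =>
    ((asbool (exists2 s', S s' & s' <> s /\
       vnorm2 (fun i => csub (cadd (cmul (h i) (s i)) (z i)) (cmul (h i) (s' i)))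
       <= vnorm2 z))%:R)%:E).

Definition cnt {T : finType} (S : set (T -> R * R)) (a : R) : \bar R :=
  (\esum_(x in S `&` cube a) 1)%E.

Definition pe_avg {T : finType} (sigma2 : R) (S : set (T -> R * R))
    (h : T -> R * R) (a : R) : \bar R :=
  if cnt S a == 0%E then 0%E
  else ((\esum_(x in S `&` cube a) pe_point sigma2 S h x) *
        ((fine (cnt S a))^-1)%:E)%E.

Definition limsup_pinfty (f : R -> \bar R) : \bar R :=
  ereal_inf [set ereal_sup [set f a | a in [set a | M < a]] | M in [set: R]].

Definition pe_IC {T : finType} (sigma2 : R) (S : set (T -> R * R)) : \bar R :=
  @CNexp T 1 (fun h => limsup_pinfty (pe_avg sigma2 S h)).

Definition density {T : finType} (S : set (T -> R * R)) : \bar R :=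
  limsup_pinfty (fun a => (cnt S a * ((a ^+ (2 * #|T|))^-1)%:E)%E).

Definition eln (x : \bar R) : \bar R :=
  match x with
  | (r%:E)%E => if r <= 0 then (-oo)%E else (ln r)%:E
  | (+oo)%E => (+oo)%E
  | (-oo)%E => (-oo)%E
  end.

Definition NLD (n L : nat) (S : set (idx n L -> R * R)) : \bar R :=
  (eln (density S) * (n%:R^-1)%:E)%E.

(* Infinite constellation: countable set; as implicit in the averages of the
   paper, every cube contains finitely many points. *)
Definition IC {T : finType} (S : set (T -> R * R)) : Prop :=
  countable S /\ forall a : R, finite_set (S `&` cube a).

Definition delta_opt (sigma2 : R) (L n : nat) (eps : R) : \bar R :=
  ereal_sup [set NLD S | S in [set S : set (idx n L -> R * R) |
                IC S /\ (pe_IC sigma2 S <= eps%:E)%E]].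

(* det(H^dagger H / c) for H = diag(h) *)
Definition detHH (L : nat) (c : R) (h : 'I_L -> R * R) : R :=
  \prod_(l < L) (cabs2 (h l) / c).

Definition delta_star (sigma2 : R) (L : nat) : R :=
  fine (@CNexp 'I_L 1 (fun h => (ln (detHH (pi * expR 1 * sigma2) h))%:E)).

Definition V_disp (L : nat) : R :=
  let m := fine (@CNexp 'I_L 1 (fun h => (ln (detHH 1 h))%:E)) in
  L%:R + fine (@CNexp 'I_L 1 (fun h => ((ln (detHH 1 h) - m) ^+ 2)%:E)).

Definition Qfun (x : R) : R := fine (normal_prob 0 1 `]x, +oo[).
Definition Qinv (e : R) : R := inf [set x | Qfun x <= e].

End Channel.

(* Main.v *)
(** The log-likelihood ratio governing both directions is the information density
    [infd]: when det(H^dagger H) <> 0, p(z) det(H^dagger H) = exp(n delta^* - infd),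
    where p is the density of the noise and infd is a sum of nL i.i.d. copies of
    |Z|^2/sigma^2 - 1 and of -ln|H|^2 - E(-ln|H|^2).

    Central limit rate.  A Berry-Esseen bound of order n^(-1/2) comes from Stein's
    method with Stein kernels: if E(S f(S)) = E(tau f'(S)), then the distance of S
    to a Gaussian is controlled by Var(tau), and Stein kernels add up over
    independent summands.  For a function w(|u|^2) of a complex Gaussian u a kernel
    is produced by integrating by parts along each of the two axes.

    Converse.  Given H, pull the Voronoi cells inside a cube back by H: they are
    disjoint, so their total volume is at most that of a slightly larger cube.
    Where p < t a cell has Gaussian mass at most t times its volume, so on
    average the error probability is at least P(p < t) up to O(1/n).

    Achievability.  For two code points at difference u, the probability that they
    are confused while p(z) det(H^dagger H) >= kap integrates over u to at most
    1/kap.  Choosing points one by one in a cube keeps the average pairwise error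
    O(1/n), and the code is repeated over a lattice of well separated cubes. *)
Require Import Defs.
From HB Require Import structures.
From mathcomp Require Import all_boot all_order all_algebra finmap.
From mathcomp Require Import all_classical all_reals all_analysis.
From mathcomp Require Import measurable_realfun zify ring lra.
Set Implicit Arguments. Unset Strict Implicit. Unset Printing Implicit Defensive.
Import Order.TTheory GRing.Theory Num.Theory.
Import numFieldNormedType.Exports.
Local Open Scope classical_set_scope.
Local Open Scope ring_scope.

(** * Iterated Gaussian expectations as integrals over product measures *)

(** The error probability of a constellation is an iterated integral of a limsup whose measurability
    in the fading is not established. Both directions compare it with measurable functions of the
    fading, using only that integrals of nonnegative functions are monotone; the measurable bounds
    alone are turned into integrals over a product measure.

    Both directions give away an error probability of order 1/n, which moves ln(density) by ln n +
    O(1): this is the origin of the ln n / n term. The Berry-Esseen error of order n^(-1/2) moves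
    the quantile by O(n^(-1/2)), hence ln(density) by O(1) only, since the standard deviation of
    [infd] is of order sqrt n.

    The event that p(z) det(H^dagger H) is small has to be charged with coefficient exactly one,
    while all other error terms may lose constant factors. This decides how errors are split.

    Stein kernels also supply the moments: the variance of the logarithmic term is the mean of its
    kernel, so the analytic input reduces to the integrability of powers of ln|u|^2 under a Gaussian
    law. *)

Section Sprod.
Context d1 d2 (T1 : measurableType d1) (T2 : measurableType d2) (R : realType).
Variable m1 : {sigma_finite_measure set T1 -> \bar R}.
Variable m2 : {sigma_finite_measure set T2 -> \bar R}.

(* An alias: the canonical sigma-finite structure of [m1 \x m2] in the library
   only applies to products of subprobabilities. *)
Definition sprod : set (T1 * T2) -> \bar R := (m1 \x m2)%E.

HB.instance Definition _ := Measure.copy sprod (m1 \x m2)%E.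

Let sprod_sigma_finite : sigma_finite setT sprod.
Proof.
have /sigma_finiteP[F [TF ndF Foo]] := sigma_finiteT m1.
have /sigma_finiteP[G [TG ndG Goo]] := sigma_finiteT m2.
exists (fun n => F n `*` G n).
  rewrite -setXTT TF TG predeqE => -[x y]; split.
    move=> [/= [n _ Fnx] [k _ Gky]]; exists (maxn n k) => //; split.
    - by move: x Fnx; exact/subsetPset/ndF/leq_maxl.
    - by move: y Gky; exact/subsetPset/ndG/leq_maxr.
  by move=> [n _ []/= ? ?]; split; exists n.
move=> k; have [? ?] := Foo k; have [? ?] := Goo k.
split; first exact: measurableX.
by rewrite /sprod product_measure1E// lte_mul_pinfty// ge0_fin_numE.
Qed.

HB.instance Definition _ := Measure_isSigmaFinite.Build _ _ _ sprod
  sprod_sigma_finite.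
End Sprod.

Section SprodTheory.
Context d1 d2 (T1 : measurableType d1) (T2 : measurableType d2) (R : realType).
Variable m1 : {sigma_finite_measure set T1 -> \bar R}.
Variable m2 : {sigma_finite_measure set T2 -> \bar R}.
Variable f : T1 * T2 -> \bar R.
Hypothesis mf : measurable_fun setT f.
Hypothesis f0 : forall z, (0 <= f z)%E.

Lemma sprod_tonelli1 :
  (\int[sprod m1 m2]_z f z = \int[m1]_x \int[m2]_y f (x, y))%E.
Proof. exact: fubini_tonelli1. Qed.

Lemma sprod_tonelli2 :
  (\int[sprod m1 m2]_z f z = \int[m2]_y \int[m1]_x f (x, y))%E.
Proof. exact: fubini_tonelli2. Qed.

Lemma measurable_int2 : measurable_fun setT (fun x => \int[m2]_y f (x, y))%E.
Proof. exact: (measurable_fun_fubini_tonelli_F _ mf f0). Qed.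

Lemma measurable_int1 : measurable_fun setT (fun y => \int[m1]_x f (x, y))%E.
Proof. exact: (measurable_fun_fubini_tonelli_G _ mf f0). Qed.

End SprodTheory.

Section Density.
Context d (T : measurableType d) (R : realType).
Variables (nu : {finite_measure set T -> \bar R}).
Variables (mu : {sigma_finite_measure set T -> \bar R}).
Variable p : T -> R.
Hypothesis p0 : forall x, 0 <= p x.
Hypothesis mp : measurable_fun setT p.
Hypothesis nup : forall A, measurable A -> nu A = (\int[mu]_(x in A) (p x)%:E)%E.

(** A measure with density [p] is dominated by [mu], and its Radon-Nikodym derivative agrees with
    [p] almost everywhere; the rest is the change of variables for that derivative. *)
Lemma ge0_integral_density (f : T -> \bar R) : measurable_fun setT f ->
  (forall x, 0 <= f x)%E ->
  (\int[nu]_x f x = \int[mu]_x ((p x)%:E * f x))%E.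
Proof.
move=> mf f0.
have mpe : measurable_fun setT (EFin \o p) by exact/measurable_EFinP.
have dom : nu `<< mu.
  apply/null_content_dominatesP => A mA muA0; rewrite nup//.
  by apply: null_set_integral => //; exact: measurable_funTS.
rewrite -(Radon_Nikodym_SigmaFinite.change_of_variables dom)//.
have iRN := Radon_Nikodym_SigmaFinite.f_integrable dom.
apply: ge0_ae_eq_integral => //.
- by apply: emeasurable_funM => //; exact: measurable_int iRN.
- exact: emeasurable_funM.
- by move=> x _; rewrite mule_ge0// Radon_Nikodym_SigmaFinite.f_ge0.
- by move=> x _; rewrite mule_ge0// lee_fin.
have : ae_eq mu setT (Radon_Nikodym_SigmaFinite.f nu mu) (EFin \o p).
  apply: integral_ae_eq => // A _ mA.
  by rewrite -Radon_Nikodym_SigmaFinite.f_integral// nup.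
by apply: filterS => x /(_ I) /= -> _; rewrite muleC.
Qed.

End Density.

Section LowerIntegral.
Context d (T : measurableType d) (R : realType) (mu : {measure set T -> \bar R}).

(** The integral of a nonnegative function is a supremum over the simple functions below it, so
    monotonicity holds for arbitrary functions. Through [gexp_le] this is what lets a limsup of
    error probabilities be compared with a measurable bound. *)
Lemma ge0_le_integralT (f g : T -> \bar R) : (forall x, 0 <= f x)%E ->
  (forall x, f x <= g x)%E -> (\int[mu]_x f x <= \int[mu]_x g x)%E.
Proof.
move=> f0 fg; have g0 x : (0 <= g x)%E := le_trans (f0 x) (fg x).
rewrite !ge0_integralTE//; apply: ereal_sup_le => _ [h /= hf <-].
by exists h => // x; exact: le_trans (hf x) (fg x).
Qed.

Lemma ge0_intZl (f : T -> \bar R) (k : R) : measurable_fun setT f ->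
  (forall x, 0 <= f x)%E -> 0 <= k ->
  (\int[mu]_x (k%:E * f x) = k%:E * \int[mu]_x f x)%E.
Proof. by move=> mf f0 k0; apply: ge0_integralZl. Qed.

End LowerIntegral.

Lemma gexp_le (R : realType) (T : eqType) (ks : seq T) (s : R)
    (f g : (T -> R * R) -> \bar R) : (forall x, 0 <= f x)%E ->
  (forall x, f x <= g x)%E -> (gexp ks s f <= gexp ks s g)%E.
Proof.
have ge0 l (k : (T -> R * R) -> \bar R) :
    (forall x, 0 <= k x)%E -> (0 <= gexp l s k)%E.
  elim: l k => [|k' l IH] k k0 /=; first exact: k0.
  apply: integral_ge0 => x _; apply: mule_ge0; first exact: normal_pdf_ge0.
  apply: integral_ge0 => y _; apply: mule_ge0; first exact: normal_pdf_ge0.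
  exact: IH.
elim: ks f g => [|k ks IH] f g f0 fg /=; first exact: fg.
apply: ge0_le_integralT => x.
  apply: mule_ge0; first exact: normal_pdf_ge0.
  apply: integral_ge0 => y _; apply: mule_ge0; first exact: normal_pdf_ge0.
  exact: ge0.
apply: lee_wpmul2l; first exact: normal_pdf_ge0.
apply: ge0_le_integralT => y.
  by apply: mule_ge0; [exact: normal_pdf_ge0|exact: ge0].
by apply: lee_wpmul2l; [exact: normal_pdf_ge0|exact: IH].
Qed.

Section Tower.
Variable R : realType.
Notation RR := (measurableTypeR R).
Notation C := (RR * RR)%type.
Variable T : eqType.
Implicit Types ks : seq T.

(* [tow ks] nests pairs along [ks] as the recursion of [gexp] does; [ev] reads such
   a point as a function on [T], with the junk value (0, 0) outside [ks]. *)
Fixpoint tow_ (ks : seq T) : {d : measure_display & measurableType d} :=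
  match ks with
  | [::] => existT _ _ (unit : measurableType _)
  | k :: ks' => existT _ _ ((C * projT2 (tow_ ks'))%type : measurableType _)
  end.
Definition tow ks : measurableType _ := projT2 (tow_ ks).

Fixpoint towm (m : {sigma_finite_measure set C -> \bar R}) (ks : seq T) {struct ks} :
    {sigma_finite_measure set (tow ks) -> \bar R} :=
  match ks as l return {sigma_finite_measure set (tow l) -> \bar R} with
  | [::] => (\d_ tt : {sigma_finite_measure set unit -> \bar R})
  | k :: ks' => (sprod m (towm m ks') : {sigma_finite_measure set (C * tow ks')%type -> \bar R})
  end.

Fixpoint ev ks : tow ks -> T -> R * R :=
  match ks with
  | [::] => fun _ _ => (0, 0)
  | k :: ks' => fun (x : (C * tow ks')%type) j => if j == k then x.1 else ev x.2 j
  end.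

Lemma measurable_ev ks j : measurable_fun setT (fun x : tow ks => ev x j : C).
Proof.
elim: ks => [|k ks IH] /=; first exact: measurable_cst.
case: (j == k); first exact: measurable_fst.
exact: measurableT_comp IH measurable_snd.
Qed.

Lemma ev_big (V : Type) (idx : V) (op : V -> V -> V) k ks (F : T -> R * R -> V)
    (u : C) (x : tow ks) : uniq (k :: ks) ->
  \big[op/idx]_(j <- k :: ks) F j (ev ((u, x) : tow (k :: ks)) j) =
  op (F k u) (\big[op/idx]_(j <- ks) F j (ev x j)).
Proof.
move=> /andP[kks _]; rewrite big_cons /= eqxx; congr op.
by apply: eq_big_seq => j jks; case: eqP => // jk; move: kks; rewrite -jk jks.
Qed.

Fixpoint tmap (phi : T -> C -> C) ks : tow ks -> tow ks :=
  match ks as l return tow l -> tow l with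
  | [::] => id
  | k :: ks' => fun x : (C * tow ks')%type => (phi k x.1, tmap phi x.2)
  end.

Lemma ev_tmap phi ks (x : tow ks) j : j \in ks ->
  ev (tmap phi x) j = phi j (ev x j).
Proof.
elim: ks x => // k ks IH [u x]; rewrite inE /=.
by case: eqP => [->|_] //= /IH.
Qed.

Lemma measurable_tmap phi ks : (forall k, measurable_fun setT (phi k)) ->
  measurable_fun setT (@tmap phi ks).
Proof.
move=> mphi; elim: ks => [|k ks IH] /=; first exact: measurable_id.
apply: measurable_fun_pair; first exact: measurableT_comp (mphi k) measurable_fst.
exact: measurableT_comp IH measurable_snd.
Qed.

(** Tonelli, one coordinate at a time. It serves as the change of variables for a diagonal matrix
    followed by a translation, with Jacobian the product of the [kappa k]. *)
Lemma integral_tmap (m : {sigma_finite_measure set C -> \bar R}) phi (kappa : T -> R) ks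
    (F : tow ks -> \bar R) :
  (forall k, 0 <= kappa k) ->
  (forall k, measurable_fun setT (phi k)) ->
  (forall k (f : C -> \bar R), measurable_fun setT f -> (forall u, 0 <= f u)%E ->
    (\int[m]_u f (phi k u) = (kappa k)%:E * \int[m]_u f u)%E) ->
  measurable_fun setT F -> (forall x, 0 <= F x)%E ->
  (\int[towm m ks]_x F (tmap phi x) =
   (\prod_(k <- ks) kappa k)%:E * \int[towm m ks]_x F x)%E.
Proof.
move=> k0 mphi hphi; elim: ks F => [|k ks IH] F mF F0.
  by rewrite big_nil mul1e.
have mt := @measurable_tmap phi (k :: ks) mphi.
rewrite [LHS](sprod_tonelli1 m (towm m ks)) //; last exact: measurableT_comp mF mt.
transitivity (\int[m]_u ((\prod_(j <- ks) kappa j)%:E *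
    (\int[towm m ks]_x F (phi k u, x))))%E.
  apply: eq_integral => u _; apply: (IH (fun x => F (phi k u, x))) => //.
  exact: measurable_fun_pair2 mF.
have mI : measurable_fun setT (fun u => \int[towm m ks]_x F (u, x))%E.
  exact: measurable_int2.
have I0 u : (0 <= \int[towm m ks]_x F (u, x))%E by exact: integral_ge0.
rewrite ge0_integralZl//; last 2 first.
- exact: measurableT_comp mI (mphi k).
- by rewrite lee_fin prodr_ge0.
rewrite (hphi k _ mI)// big_cons muleA [in RHS]EFinM [in RHS]muleC.
rewrite [in RHS](sprod_tonelli1 m (towm m ks))// [in LHS]muleC.
by rewrite [in RHS](muleC (kappa k)%:E).
Qed.

Lemma towm_density (m m' : {sigma_finite_measure set C -> \bar R}) (q : C -> R) ks
    (F : tow ks -> \bar R) : uniq ks ->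
  (forall u, 0 <= q u) -> measurable_fun setT q ->
  (forall (f : C -> \bar R), measurable_fun setT f -> (forall u, 0 <= f u)%E ->
    (\int[m]_u f u = \int[m']_u ((q u)%:E * f u))%E) ->
  measurable_fun setT F -> (forall x, 0 <= F x)%E ->
  (\int[towm m ks]_x F x =
   \int[towm m' ks]_x ((\prod_(k <- ks) q (ev x k))%:E * F x))%E.
Proof.
move=> + q0 mq hq; elim: ks F => [|k ks IH] F uks mF F0.
  by apply: eq_integral => x _; rewrite big_nil mul1e.
have uks' : uniq ks by case/andP: uks.
have mpr ks' : measurable_fun setT (fun x : tow ks' => \prod_(j <- ks') q (ev x j)).
  apply: measurable_prod => j _.
  exact: (measurableT_comp mq (@measurable_ev ks' j)).
have pr0 ks' (x : tow ks') : 0 <= \prod_(j <- ks') q (ev x j).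
  by rewrite prodr_ge0.
rewrite [LHS](sprod_tonelli1 m (towm m ks))//.
rewrite [RHS](sprod_tonelli1 m' (towm m' ks)); last 2 first.
- by apply: emeasurable_funM => //; apply/measurable_EFinP; exact: (mpr (k :: ks)).
- by move=> x; rewrite mule_ge0// lee_fin (pr0 (k :: ks)).
rewrite hq; last 2 first.
- exact: measurable_int2.
- by move=> u; exact: integral_ge0.
apply: eq_integral => u _; rewrite (IH (fun x => F (u, x)))//; last exact: measurable_fun_pair2 mF.
rewrite -ge0_integralZl//; last 3 first.
- apply: emeasurable_funM; last exact: measurable_fun_pair2 mF.
  exact/measurable_EFinP/mpr.
- by move=> x _; rewrite mule_ge0// lee_fin.
- by rewrite lee_fin.
apply: eq_integral => x _.
by rewrite (@ev_big _ _ _ k ks (fun _ => q) u x uks) EFinM muleA.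
Qed.

Lemma towm_null (m : {sigma_finite_measure set C -> \bar R}) ks j (A : set C) :
  j \in ks -> measurable A -> m A = 0%E -> towm m ks [set x | A (ev x j)] = 0%E.
Proof.
move=> + mA mA0; elim: ks => // k ks IH; rewrite inE.
case: (eqVneq j k) => [->|jk] /= jks.
  rewrite (_ : mkset _ = A `*` setT); last first.
    by apply/seteqP; split => -[u x] /=; rewrite eqxx //= => -[].
  by rewrite /sprod product_measure1E//= mA0 mul0e.
rewrite (_ : mkset _ = setT `*` [set x | A (ev x j)]); last first.
  by apply/seteqP; split => -[u x] /=; rewrite (negbTE jk) //= => -[].
rewrite /sprod product_measure1E//=; first by rewrite IH// mule0.
rewrite -[X in measurable X]setTI.
exact: (@measurable_ev ks j).
Qed.

End Tower.

(** * Gaussian and Lebesgue measures on the complex plane, and affine changes of variables *)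

Section GaussLebesgue.
Variable R : realType.
Notation RR := (measurableTypeR R).
Notation C := (RR * RR)%type.
Notation leb := (@lebesgue_measure R).

Definition gauss2 (s : R) : {sigma_finite_measure set C -> \bar R} :=
  sprod (normal_prob 0 s) (normal_prob 0 s).
Definition leb2 : {sigma_finite_measure set C -> \bar R} := sprod leb leb.
Definition pdf2 (s : R) (u : C) : R := normal_pdf 0 s u.1 * normal_pdf 0 s u.2.

Lemma normal_integral s (f : RR -> \bar R) : measurable_fun setT f ->
  (forall x, 0 <= f x)%E ->
  (\int[normal_prob 0 s]_x f x = \int[leb]_x ((normal_pdf 0 s x)%:E * f x))%E.
Proof.
move=> mf f0; apply: (@ge0_integral_density _ _ R (normal_prob 0 s) leb) => //.
- exact: normal_pdf_ge0.
- exact: measurable_normal_pdf.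
Qed.

Lemma pdf2_ge0 s u : 0 <= pdf2 s u.
Proof. by rewrite mulr_ge0 ?normal_pdf_ge0. Qed.

Lemma measurable_pdf2 s : measurable_fun setT (pdf2 s).
Proof.
apply: measurable_funM.
  exact: measurableT_comp (measurable_normal_pdf _ _) measurable_fst.
exact: measurableT_comp (measurable_normal_pdf _ _) measurable_snd.
Qed.

Lemma gauss2E s (f : C -> \bar R) : measurable_fun setT f ->
  (forall u, 0 <= f u)%E ->
  (\int[gauss2 s]_u f u = \int[leb]_x ((normal_pdf 0 s x)%:E *
      \int[leb]_y ((normal_pdf 0 s y)%:E * f (x, y))))%E.
Proof.
move=> mf f0; rewrite (sprod_tonelli1 _ _ mf f0) normal_integral; last 2 first.
- exact: measurable_int2.
- by move=> x; exact: integral_ge0.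
apply: eq_integral => x _; rewrite normal_integral//.
exact: measurable_fun_pair2 mf.
Qed.

Lemma gauss2_density s (f : C -> \bar R) : measurable_fun setT f ->
  (forall u, 0 <= f u)%E ->
  (\int[gauss2 s]_u f u = \int[leb2]_u ((pdf2 s u)%:E * f u))%E.
Proof.
move=> mf f0; rewrite gauss2E//.
have mpf : measurable_fun setT (fun u => (pdf2 s u)%:E * f u)%E.
  by apply: emeasurable_funM => //; apply/measurable_EFinP; exact: measurable_pdf2.
have pf0 u : (0 <= (pdf2 s u)%:E * f u)%E by rewrite mule_ge0 // lee_fin pdf2_ge0.
rewrite (sprod_tonelli1 _ _ mpf pf0); apply: eq_integral => x _.
rewrite -ge0_integralZl//; last 3 first.
- apply: emeasurable_funM; last exact: measurable_fun_pair2 mf.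
  by apply/measurable_EFinP; exact: measurable_normal_pdf.
- by move=> y _; rewrite mule_ge0// lee_fin normal_pdf_ge0.
- by rewrite lee_fin normal_pdf_ge0.
by apply: eq_integral => y _; rewrite /pdf2 /= EFinM muleA.
Qed.

Variable T : eqType.
Implicit Types ks : seq T.

Lemma gexpE ks s (f : (T -> R * R) -> \bar R) : (forall g, 0 <= f g)%E ->
  measurable_fun setT (fun x : tow R ks => f (ev x)) ->
  (gexp ks s f = \int[towm (gauss2 s) ks]_x f (ev x))%E.
Proof.
elim: ks f => [|k ks IH] f f0 mf.
  rewrite /= integral_dirac//.
  by rewrite diracT mul1e.
rewrite [RHS](sprod_tonelli1 (gauss2 s) (towm (gauss2 s) ks))//.
rewrite gauss2E; last 2 first.
- by apply: (measurable_int2 (towm (gauss2 s) ks) mf) => x; exact: f0.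
- by move=> u; exact: integral_ge0.
rewrite [LHS]/=; apply: eq_integral => x _; congr (_ * _)%E.
apply: eq_integral => y _; congr (_ * _)%E.
rewrite IH//.
exact: (@measurable_fun_pair2 _ _ _ _ _ _ (fun x : tow R (k :: ks) => f (ev x)) (x, y) mf).
Qed.

Lemma towm_gauss_density ks s (F : tow R ks -> \bar R) : uniq ks ->
  measurable_fun setT F -> (forall x, 0 <= F x)%E ->
  (\int[towm (gauss2 s) ks]_x F x =
   \int[towm leb2 ks]_x ((\prod_(k <- ks) pdf2 s (ev x k))%:E * F x))%E.
Proof.
move=> uks mF F0; apply: towm_density => //.
- exact: pdf2_ge0.
- exact: measurable_pdf2.
- exact: gauss2_density.
Qed.

Lemma gauss2T s : gauss2 s setT = 1%E.
Proof.
have pT : normal_prob 0 s setT = 1%E by exact: (@probability_setT _ _ _ (normal_prob 0 s)).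
rewrite -setXTT; apply: (etrans (product_measure1E _ _ measurableT measurableT)).
by apply: (etrans (f_equal2 *%E pT pT)); rewrite mule1.
Qed.

Lemma towmT (m : {sigma_finite_measure set C -> \bar R}) ks :
  m setT = 1%E -> towm m ks setT = 1%E.
Proof.
move=> m1; elim: ks => [|k ks IH]; first exact: diracT.
rewrite -setXTT; apply: (etrans (product_measure1E _ _ measurableT measurableT)).
by apply: (etrans (f_equal2 *%E m1 IH)); rewrite mule1.
Qed.

(** By uniqueness of Lebesgue measure: |a| times its image under x -> a x + b has the right value on
    intervals. A negative [a] exchanges the open and the closed end. *)
Lemma leb_affine (a b : R) (f : RR -> \bar R) : a != 0 ->
  measurable_fun setT f -> (forall x, 0 <= f x)%E ->
  (\int[leb]_x f ((a * x + b)%R : RR) = (`|a|^-1)%:E * \int[leb]_x f x)%E.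
Proof.
move=> a0 mf f0; have aa0 : 0 < `|a| by rewrite normr_gt0.
pose phi (x : RR) : RR := a * x + b.
have mphi : measurable_fun setT phi.
  by apply: measurable_funD => //; exact: measurable_funM.
pose an := NngNum (ltW aa0).
pose nu_ : {measure set RR -> \bar R} := mscale an (pushforward leb phi).
pose nu := nu_ mphi.
have E : (\int[leb]_x f x = \int[nu]_x f x)%E.
  apply: eq_measure_integral => A mA _.
  apply: lebesgue_measure_unique => // X [[u v] /= _ <-].
  have -> : nu `]u, v]%classic = (`|a|%:E * leb (phi @^-1` `]u, v]%classic))%E by [].
  have [uv|vu] := ltP u v; last first.
    rewrite (_ : `]u, v]%classic = set0); last by apply/set_itv_ge; rewrite bnd_simp -leNgt.
    by rewrite preimage_set0 !measure0 mule0.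
  have /orP[a1|a1] : (a < 0) || (0 < a) by rewrite -neq_lt.
  - rewrite (_ : _ @^-1` _ = `[(v - b) / a, (u - b) / a[%classic); last first.
      apply/seteqP; split => x /=; rewrite !in_itv /= /phi;
        rewrite ler_ndivrMr// ltr_ndivlMr// ltrBlDr lerBrDr mulrC;
        by rewrite andbC.
    rewrite !lebesgue_measure_itv /= !lte_fin uv ltr_nM2r ?invr_lt0// ltrD2r uv.
    rewrite (ltr0_norm a1) -!EFinD -EFinM; congr EFin.
    by field; rewrite lt_eqF.
  - rewrite (_ : _ @^-1` _ = `](u - b) / a, (v - b) / a]%classic); last first.
      apply/seteqP; split => x /=; rewrite !in_itv /= /phi;
        by rewrite ltr_pdivrMr// ler_pdivlMr// ltrBlDr lerBrDr mulrC.
    rewrite !lebesgue_measure_itv /= !lte_fin uv ltr_pM2r ?invr_gt0// ltrD2r uv.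
    rewrite (gtr0_norm a1) -!EFinD -EFinM; congr EFin.
    by field; rewrite gt_eqF.
rewrite E ge0_integral_mscale// ge0_integral_pushforward//=.
by rewrite muleA -EFinM mulVf ?gt_eqF// mul1e preimage_setT.
Qed.

(** Complex multiplication is decomposed into two one-dimensional affine substitutions: an exchange
    of the axes when [h1] is 0, a shear otherwise. *)
Lemma leb2_affine (h c : R * R) (f : C -> \bar R) : h != (0, 0) ->
  measurable_fun setT f -> (forall u, 0 <= f u)%E ->
  (\int[leb2]_u f (@Defs.cadd R (@cmul R h u) c) = ((cabs2 h)^-1)%:E * \int[leb2]_u f u)%E.
Proof.
case: h c => [h1 h2] [c1 c2] h0 mf f0.
have mlin (a b e : R) : measurable_fun setT (fun u : C => (a * u.1 + b * u.2 + e)%R : RR).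
  by apply: measurable_funD => //; apply: measurable_funD; apply: measurable_funM.
have maff (a b : R) : measurable_fun setT (fun x : RR => (a * x + b)%R : RR).
  by apply: measurable_funD => //; apply: measurable_funM.
have mcomp (p q : C -> RR) : measurable_fun setT p -> measurable_fun setT q ->
    measurable_fun setT (fun u => f (p u, q u)).
  by move=> mp mq; apply: (measurableT_comp mf); exact: measurable_fun_pair.
have mg : measurable_fun setT (fun u : C => f (@Defs.cadd R (@cmul R (h1, h2) u) (c1, c2))).
  apply: mcomp => /=.
    have := mlin h1 (- h2) c1; congr measurable_fun; apply/funext => u /=.
    by rewrite mulNr.
  have := mlin h2 h1 c2; congr measurable_fun; apply/funext => u /=.
  by congr (_ + _); rewrite addrC.
rewrite (sprod_tonelli1 leb leb mf f0).
have [h10|h10] := eqVneq h1 0.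
  have h20 : h2 != 0 by apply: contra h0 => /eqP ->; rewrite h10.
  rewrite (sprod_tonelli1 leb leb mg)//.
  have mI : measurable_fun setT (fun x => \int[leb]_y f (y, x))%E by exact: measurable_int1.
  transitivity (\int[leb]_x ((`|h2|^-1)%:E * \int[leb]_y f (y, (h2 * x + c2)%R)))%E.
    apply: eq_integral => x _.
    rewrite -normrN -(@leb_affine (- h2) c1 (fun y => f (y, (h2 * x + c2)%R)))%E ?oppr_eq0//; last first.
      exact: measurable_fun_pair1.
    apply: eq_integral => y _; congr f; rewrite /Defs.cadd /cmul /= h10.
    by congr pair; ring.
  have mI2 := measurableT_comp mI (maff h2 c2).
  rewrite (ge0_intZl _ mI2); last 2 first.
  - by move=> x; exact: integral_ge0.
  - by rewrite invr_ge0.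
  have I0 x : (0 <= \int[leb]_y f (y, x))%E by exact: integral_ge0.
  rewrite (@leb_affine h2 c2 (fun x => \int[leb]_y f (y, x))%E h20 mI I0).
  rewrite muleA -EFinM -invfM -normrM /cabs2 /= h10 expr0n add0r.
  have -> : `|h2 * h2| = h2 ^+ 2 by rewrite -expr2 ger0_norm ?sqr_ge0.
  congr (_ * _)%E.
  by apply: (etrans (esym (sprod_tonelli2 leb leb mf f0))); apply: (sprod_tonelli1 leb leb mf f0).
pose D := h1 ^+ 2 + h2 ^+ 2.
have D0 : 0 < D by rewrite ltr_wpDr ?sqr_ge0 // exprn_even_gt0.
(* Once the first image coordinate is taken as variable, the second one is affine in y with slope
   [al]; the Jacobian is |h1| |al| = |h|^2. *)
pose al := D / h1.
have al0 : al != 0 by rewrite mulf_neq0 ?invr_eq0 // gt_eqF.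
rewrite (sprod_tonelli2 leb leb mg)//.
transitivity (\int[leb]_y ((`|h1|^-1)%:E *
    \int[leb]_x f (x, (al * y + (h2 * (x - c1) / h1 + c2))%R)))%E.
  apply: eq_integral => y _.
  pose g x := f (x, al * y + (h2 * (x - c1) / h1 + c2)).
  have mg' : measurable_fun setT g.
    apply: (measurableT_comp mf); apply: measurable_fun_pair => //.
    apply: measurable_funD => //; apply: measurable_funD => //.
    apply: measurable_funM => //; apply: measurable_funM => //.
    exact: measurable_funB.
  rewrite -(@leb_affine h1 (c1 - h2 * y) g h10 mg' (fun x => f0 _)).
  apply: eq_integral => x _; rewrite /g; congr f; rewrite /Defs.cadd /cmul /=.
  by congr pair; rewrite /al /D; field.
have mk : measurable_fun setT (fun z : C => f (z.2, (al * z.1 + (h2 * (z.2 - c1) / h1 + c2))%R)).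
  apply: mcomp => //.
  have := mlin al (h2 / h1) (c2 - h2 * c1 / h1); congr measurable_fun.
  by apply/funext => z /=; field.
have mk0 z : (0 <= f (z.2, (al * z.1 + (h2 * (z.2 - c1) / h1 + c2))%R))%E by exact: f0.
rewrite (ge0_intZl _ (measurable_int2 leb mk mk0)); last 2 first.
- by move=> y; exact: integral_ge0.
- by rewrite invr_ge0.
rewrite -(sprod_tonelli1 leb leb mk mk0) (sprod_tonelli2 leb leb mk mk0).
transitivity ((`|h1|^-1)%:E * \int[leb]_x ((`|al|^-1)%:E * \int[leb]_y f (x, y)))%E.
  congr (_ * _)%E; apply: eq_integral => x _ /=.
  by rewrite (@leb_affine al _ (fun y => f (x, y)))//; exact: measurable_fun_pair2.
rewrite (ge0_intZl _ (measurable_int2 leb mf f0)); last 2 first.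
- by move=> x; exact: integral_ge0.
- by rewrite invr_ge0.
rewrite muleA -EFinM -invfM -normrM; congr ((_^-1)%:E * _)%E.
rewrite /cabs2 /= -/D /al mulrC divfK// ger0_norm// ltW//.
Qed.
End GaussLebesgue.

(** * Stein kernels *)

Lemma prob_cst d (T : measurableType d) (R : realType) (m : {measure set T -> \bar R}) (r : \bar R) :
  m setT = 1%E -> (\int[m]_x r = r)%E.
Proof.
move=> m1; apply: (etrans (integral_cst m measurableT r)).
by apply: (etrans (f_equal (fun z => r * z)%E m1)); rewrite mule1.
Qed.

Lemma Rprob_cst d (T : measurableType d) (R : realType) (m : {measure set T -> \bar R}) (r : R) :
  m setT = 1%E -> \int[m]_x r = r.
Proof. by move=> m1; rewrite /Rintegral prob_cst. Qed.

(** * Fubini for real-valued integrals, and integrability on product spaces *)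

Section RFubini.
Context d1 d2 (T1 : measurableType d1) (T2 : measurableType d2) (R : realType).
Variable m1 : {sigma_finite_measure set T1 -> \bar R}.
Variable m2 : {sigma_finite_measure set T2 -> \bar R}.

Lemma integrable_fine_eq d (T : measurableType d) (m : {measure set T -> \bar R})
    (g : T -> \bar R) : m.-integrable setT g ->
  (\int[m]_x g x = \int[m]_x (fine (g x))%:E)%E.
Proof.
move=> ig; apply: ae_eq_integral => //; first exact: measurable_int ig.
  by apply/measurable_EFinP; apply: measurableT_comp => //; exact: measurable_int ig.
have := integrable_ae measurableT ig; apply: filterS => x /(_ I) gx _.
by rewrite fineK.
Qed.

Lemma Rfubini12 (g : T1 * T2 -> R) :
  (sprod m1 m2).-integrable setT (EFin \o g) ->
  \int[sprod m1 m2]_z g z = \int[m1]_x (\int[m2]_y g (x, y)).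
Proof.
move=> ig; rewrite /Rintegral -(integral12_prod_meas1 ig); congr fine.
exact: integrable_fine_eq (integrable_fubini_F ig).
Qed.

Lemma Rfubini21 (g : T1 * T2 -> R) :
  (sprod m1 m2).-integrable setT (EFin \o g) ->
  \int[sprod m1 m2]_z g z = \int[m2]_y (\int[m1]_x g (x, y)).
Proof.
move=> ig; rewrite /Rintegral -(integral21_prod_meas1 ig); congr fine.
apply: integrable_fine_eq; apply/integrableP; split.
  exact: measurable_fubini_G ig.
have mg := measurable_int _ ig.
have /(integrable21ltyP m1 m2 mg) := ig; apply: le_lt_trans.
apply: ge0_le_integralT => y; first exact: abse_ge0.
by apply: le_abse_integral => //; exact: measurable_fun_pair1 mg.
Qed.

Lemma integrable_fst (f : T1 -> R) : m2 setT = 1%E ->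
  m1.-integrable setT (EFin \o f) ->
  (sprod m1 m2).-integrable setT (fun z => (f z.1)%:E).
Proof.
move=> m2T /integrableP[mf fi]; apply/(integrable12ltyP m1 m2).
  exact: measurableT_comp mf measurable_fst.
apply: le_lt_trans fi; rewrite le_eqVlt; apply/orP; left; apply/eqP.
by apply: eq_integral => x _ /=; rewrite prob_cst.
Qed.

Lemma integrable_snd (f : T2 -> R) : m1 setT = 1%E ->
  m2.-integrable setT (EFin \o f) ->
  (sprod m1 m2).-integrable setT (fun z => (f z.2)%:E).
Proof.
move=> m1T /integrableP[mf fi]; apply/(integrable21ltyP m1 m2).
  exact: measurableT_comp mf measurable_snd.
apply: le_lt_trans fi; rewrite le_eqVlt; apply/orP; left; apply/eqP.
by apply: eq_integral => x _ /=; rewrite prob_cst.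
Qed.

Lemma Rintegral_fst (f : T1 -> R) : m2 setT = 1%E ->
  m1.-integrable setT (EFin \o f) ->
  \int[sprod m1 m2]_z f z.1 = \int[m1]_x f x.
Proof.
move=> m2T fi; rewrite Rfubini12; last exact: integrable_fst.
apply: eq_Rintegral => x _ /=.
by rewrite Rprob_cst.
Qed.

Lemma Rintegral_snd (f : T2 -> R) : m1 setT = 1%E ->
  m2.-integrable setT (EFin \o f) ->
  \int[sprod m1 m2]_z f z.2 = \int[m2]_y f y.
Proof.
move=> m1T fi; rewrite Rfubini21; last exact: integrable_snd.
apply: eq_Rintegral => x _ /=.
by rewrite Rprob_cst.
Qed.

Lemma integrable_prodM (f : T1 -> R) (g : T2 -> R) :
  m1.-integrable setT (EFin \o f) -> m2.-integrable setT (EFin \o g) ->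
  (sprod m1 m2).-integrable setT (fun z => (f z.1 * g z.2)%:E).
Proof.
move=> /integrableP[mf fi] /integrableP[mg gi]; apply/(integrable12ltyP m1 m2).
  apply/measurable_EFinP; apply: measurable_funM.
    by apply: measurableT_comp measurable_fst; exact/measurable_EFinP.
  by apply: measurableT_comp measurable_snd; exact/measurable_EFinP.
have mag : measurable_fun setT (fun y => `|(g y)%:E|%E) by exact: measurableT_comp.
have maf : measurable_fun setT (fun y => `|(f y)%:E|%E) by exact: measurableT_comp.
rewrite [ltLHS](_ : _ = ((\int[m2]_y `|(g y)%:E|) * \int[m1]_x `|(f x)%:E|)%E).
  by rewrite lte_mul_pinfty ?integral_ge0// ge0_fin_numE ?integral_ge0.
transitivity (\int[m1]_x ((\int[m2]_y `|(g y)%:E|) * `|(f x)%:E|))%E; last first.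
  by apply: ge0_integralZl => //; exact: integral_ge0.
apply: eq_integral => x _; rewrite muleC.
transitivity (\int[m2]_y (`|(f x)%:E| * `|(g y)%:E|))%E.
  by apply: eq_integral => y _; rewrite EFinM abseM.
by apply: ge0_integralZl.
Qed.

End RFubini.

(* [stein mu S T]: the random variable [T] is a Stein kernel of [S], that is
   E[S f(c + S)] = E[T f'(c + S)] for every bounded C^1 function [f] with
   bounded derivative. *)
Section Stein.
Variable R : realType.

Definition stein_class (f f' : R -> R) := [/\ continuous f, continuous f',
  forall x : R, is_derive x 1 f (f' x) &
  exists K, forall x, `|f x| <= K /\ `|f' x| <= K].

Definition stein d (X : measurableType d) (mu : {measure set X -> \bar R})
    (S T : X -> R) (a v : R) :=
  [/\ mu.-integrable setT (EFin \o S),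
      mu.-integrable setT (EFin \o T) /\ \int[mu]_x T x = a,
      mu.-integrable setT (fun x => ((T x - a) ^+ 2)%:E) /\
        \int[mu]_x (T x - a) ^+ 2 = v &
      forall c f f', stein_class f f' ->
        \int[mu]_x (S x * f (c + S x)) = \int[mu]_x (T x * f' (c + S x))].

Lemma measurable_continuous d (X : measurableType d) (f : R -> R) (g : X -> R) :
  continuous f -> measurable_fun setT g -> measurable_fun setT (fun x => f (g x)).
Proof.
move=> cf mg; apply: (@measurableT_comp _ _ _ _ _ _ (f : measurableTypeR R -> measurableTypeR R)) => //.
exact: continuous_measurable_fun.
Qed.

Lemma integrable_Mbounded d (X : measurableType d) (mu : {measure set X -> \bar R})
    (S g : X -> R) K : mu.-integrable setT (EFin \o S) -> measurable_fun setT g ->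
  (forall x, `|g x| <= K) -> mu.-integrable setT (fun x => (S x * g x)%:E).
Proof.
move=> iS mg gK; have mS := measurable_int _ iS.
apply: (@le_integrable _ _ _ mu setT measurableT _ (fun x => K%:E * (S x)%:E)%E).
- by apply/measurable_EFinP; apply: measurable_funM => //; exact/measurable_EFinP.
- move=> x _ /=; rewrite lee_fin normrM mulrC normrM ler_wpM2r//.
  by rewrite (le_trans (gK x)) ?ler_norm.
- exact: integrableZl.
Qed.

Section prod.
Context d1 d2 (X : measurableType d1) (Y : measurableType d2).
Variable m1 : {sigma_finite_measure set X -> \bar R}.
Variable m2 : {sigma_finite_measure set Y -> \bar R}.
Hypotheses (m11 : m1 setT = 1%E) (m21 : m2 setT = 1%E).
Variables (S1 T1 : X -> R) (S2 T2 : Y -> R) (a1 a2 v1 v2 : R).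

Lemma integrable_sqr_int d (Z : measurableType d) (m : {measure set Z -> \bar R}) (g : Z -> R) :
  m setT = 1%E -> measurable_fun setT g ->
  m.-integrable setT (fun x => (g x ^+ 2)%:E) -> m.-integrable setT (EFin \o g).
Proof.
move=> mT mg ig.
have i1 : m.-integrable setT (fun x => 1%:E : \bar R).
  apply/integrableP; split => //.
  by rewrite (prob_cst `|1|%E mT) abse1 ltry.
apply: (@le_integrable _ _ _ m setT measurableT _ (fun x => 1%:E + (g x ^+ 2)%:E)%E).
- exact/measurable_EFinP.
- move=> x _ /=; rewrite lee_fin (ger0_norm (addr_ge0 ler01 (sqr_ge0 _))).
  rewrite -(real_normK (num_real (g x))); have := normr_ge0 (g x); nra.
- exact: integrableD.
Qed.

(** With one variable frozen, its summand is absorbed into the shift [c] of the test function, and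
    the kernel identity of the other variable applies; this is why the identity is required for all
    shifts. The variances add because the centred kernels are independent, so that their cross term
    integrates to 0. *)
Lemma stein_prod : stein m1 S1 T1 a1 v1 -> stein m2 S2 T2 a2 v2 ->
  stein (sprod m1 m2) (fun z => S1 z.1 + S2 z.2) (fun z => T1 z.1 + T2 z.2)
    (a1 + a2) (v1 + v2).
Proof.
move=> [iS1 [iT1 eT1] [iV1 eV1] st1] [iS2 [iT2 eT2] [iV2 eV2] st2].
have mS1 : measurable_fun setT S1 by apply/measurable_EFinP; exact: measurable_int iS1.
have mS2 : measurable_fun setT S2 by apply/measurable_EFinP; exact: measurable_int iS2.
have iS1' := integrable_fst m21 iS1.
have iS2' := integrable_snd m11 iS2.
have iT1' := integrable_fst m21 iT1.
have iT2' := integrable_snd m11 iT2.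
have mS1' : measurable_fun setT (fun z : X * Y => S1 z.1) by exact: measurableT_comp.
have mS2' : measurable_fun setT (fun z : X * Y => S2 z.2) by exact: measurableT_comp.
split.
- exact: (integrableD measurableT iS1' iS2').
- split; first exact: (integrableD measurableT iT1' iT2').
  by rewrite RintegralD// Rintegral_fst// Rintegral_snd// eT1 eT2.
- have iA : m1.-integrable setT (EFin \o (fun x => T1 x - a1)).
    apply: integrable_sqr_int => //; apply: measurable_funB => //.
    by apply/measurable_EFinP; exact: measurable_int iT1.
  have iB : m2.-integrable setT (EFin \o (fun x => T2 x - a2)).
    apply: integrable_sqr_int => //; apply: measurable_funB => //.
    by apply/measurable_EFinP; exact: measurable_int iT2.
  have iAB := integrable_prodM iA iB.
  have iAA := @integrable_fst _ _ _ _ _ m1 m2 (fun x => (T1 x - a1) ^+ 2) m21 iV1.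
  have iBB := @integrable_snd _ _ _ _ _ m1 m2 (fun x => (T2 x - a2) ^+ 2) m11 iV2.
  have iAB2 : (sprod m1 m2).-integrable setT
      (EFin \o (fun z => 2 * ((T1 z.1 - a1) * (T2 z.2 - a2)))).
    exact: (integrableZl measurableT 2 iAB).
  have iS : (sprod m1 m2).-integrable setT
      (EFin \o (fun z => (T1 z.1 - a1) ^+ 2 + 2 * ((T1 z.1 - a1) * (T2 z.2 - a2)))).
    exact: (integrableD measurableT iAA iAB2).
  have E z : (T1 z.1 + T2 z.2 - (a1 + a2)) ^+ 2 =
    (T1 z.1 - a1) ^+ 2 + 2 * ((T1 z.1 - a1) * (T2 z.2 - a2)) + (T2 z.2 - a2) ^+ 2 by ring.
  split.
    under eq_fun do rewrite E.
    exact: (integrableD measurableT iS iBB).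
  under eq_Rintegral do rewrite E.
  rewrite (RintegralD measurableT iS iBB) (RintegralD measurableT iAA iAB2).
  rewrite (RintegralZl _ measurableT iAB) (Rfubini12 iAB) /=.
  rewrite (@Rintegral_fst _ _ _ _ _ m1 m2 (fun x => (T1 x - a1) ^+ 2) m21 iV1).
  rewrite (@Rintegral_snd _ _ _ _ _ m1 m2 (fun x => (T2 x - a2) ^+ 2) m11 iV2) eV1 eV2.
  suff -> : \int[m1]_x (\int[m2]_y ((T1 x - a1) * (T2 y - a2))) = 0 by ring.
  under eq_Rintegral => x _.
    rewrite (RintegralZl _ measurableT iB) RintegralB//; last first.
      by apply: integrable_sqr_int => //; apply/integrableP; split => //;
         rewrite (prob_cst _ m21) ltry.
    rewrite Rprob_cst// eT2 subrr mulr0.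
    over.
  by rewrite Rprob_cst.
- move=> c f f' ff'; have [cf cf' df [K fK]] := ff'.
  have mf (g : R -> R) : continuous g ->
      measurable_fun setT (fun z : X * Y => g (c + (S1 z.1 + S2 z.2))).
    by move=> cg; apply: measurable_continuous => //; do 2 apply: measurable_funD => //.
  have i1 (A : X -> R) g : m1.-integrable setT (EFin \o A) -> continuous g ->
      (forall x, `|g x| <= K) ->
      (sprod m1 m2).-integrable setT (fun z => (A z.1 * g (c + (S1 z.1 + S2 z.2)))%:E).
    by move=> iA cg gK; apply: integrable_Mbounded (integrable_fst m21 iA) (mf _ cg) _ => z.
  have i2 (A : Y -> R) g : m2.-integrable setT (EFin \o A) -> continuous g ->
      (forall x, `|g x| <= K) ->
      (sprod m1 m2).-integrable setT (fun z => (A z.2 * g (c + (S1 z.1 + S2 z.2)))%:E).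
    by move=> iA cg gK; apply: integrable_Mbounded (integrable_snd m11 iA) (mf _ cg) _ => z.
  have fK1 x : `|f x| <= K by case: (fK x).
  have fK2 x : `|f' x| <= K by case: (fK x).
  under eq_Rintegral do rewrite mulrDl.
  under [RHS]eq_Rintegral do rewrite mulrDl.
  rewrite (RintegralD measurableT (i1 _ _ iS1 cf fK1) (i2 _ _ iS2 cf fK1)).
  rewrite (RintegralD measurableT (i1 _ _ iT1 cf' fK2) (i2 _ _ iT2 cf' fK2)).
  rewrite (Rfubini21 (i1 _ _ iS1 cf fK1)) (Rfubini21 (i1 _ _ iT1 cf' fK2)).
  rewrite (Rfubini12 (i2 _ _ iS2 cf fK1)) (Rfubini12 (i2 _ _ iT2 cf' fK2)).
  apply: (f_equal2 +%R).
    apply: eq_Rintegral => y _ /=.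
    transitivity (\int[m1]_x (S1 x * f ((c + S2 y) + S1 x))).
      by apply: eq_Rintegral => x _; congr (_ * f _); ring.
    rewrite (st1 _ _ _ ff'); apply: eq_Rintegral => x _.
    by congr (_ * f' _); ring.
  apply: eq_Rintegral => x _ /=.
  transitivity (\int[m2]_y (S2 y * f ((c + S1 x) + S2 y))).
    by apply: eq_Rintegral => y _; congr (_ * f _); ring.
  rewrite (st2 _ _ _ ff'); apply: eq_Rintegral => y _.
  by congr (_ * f' _); ring.
Qed.
End prod.

Notation RR := (measurableTypeR R).
Notation C := (RR * RR)%type.

Lemma stein_tow (T : eqType) (m : {sigma_finite_measure set C -> \bar R})
    (w tau : C -> R) (a v : R) (ks : seq T) : uniq ks -> m setT = 1%E ->
  stein m w tau a v ->
  stein (towm m ks) (fun x => \sum_(j <- ks) w (ev x j))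
    (fun x => \sum_(j <- ks) tau (ev x j)) ((size ks)%:R * a) ((size ks)%:R * v).
Proof.
move=> + mT st; elim: ks => [_|k ks IH uks].
  have i0 : (towm m ([::] : seq T)).-integrable setT (fun => 0%E) by exact: integrable0.
  have t1 : towm m ([::] : seq T) setT = 1%E := @towmT _ T m [::] mT.
  have e (g : C -> R) : (fun x : tow R ([::] : seq T) => \sum_(j <- ([::] : seq T)) g (ev x j)) = (fun=> 0).
    by apply/funext => x; rewrite big_nil.
  rewrite !mul0r !e; split => //.
  - by rewrite Rprob_cst.
  - by rewrite subr0 expr0n Rprob_cst.
  - move=> c f f' _; under eq_Rintegral do rewrite mul0r.
    by under [RHS]eq_Rintegral do rewrite mul0r.
have uks' : uniq ks by case/andP: uks.
have := stein_prod mT (@towmT _ T m ks mT) st (IH uks').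
rewrite -{1}(mul1r a) -{1}(mul1r v) -!mulrDl -(natrD _ 1) add1n.
congr (stein _ _ _ _ _); apply/funext => -[u x].
  by rewrite (ev_big _ _ (fun _ => w) u x uks).
by rewrite (ev_big _ _ (fun _ => tau) u x uks).
Qed.

End Stein.

(** * The standard normal distribution *)

Section RealDerivatives.
Variable R : realType.
Implicit Types (f g : R -> R) (x a b c : R).

Lemma is_derive1M f g x a b : is_derive x 1 f a -> is_derive x 1 g b ->
  is_derive x 1 (fun y => f y * g y) (a * g x + f x * b).
Proof.
move=> df dg; apply: (is_derive_eq (is_deriveM df dg)).
by rewrite /GRing.scale /= addrC [g x * a]mulrC.
Qed.

Lemma is_derive1D f g x a b : is_derive x 1 f a -> is_derive x 1 g b ->
  is_derive x 1 (fun y => f y + g y) (a + b).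
Proof. by move=> df dg; exact: is_deriveD. Qed.

Lemma is_derive1N f x a : is_derive x 1 f a -> is_derive x 1 (fun y => - f y) (- a).
Proof. by move=> df; exact: is_deriveN. Qed.

Lemma is_derive1Z c f x a : is_derive x 1 f a -> is_derive x 1 (fun y => c * f y) (c * a).
Proof. by move=> df; exact: is_deriveZ. Qed.

Lemma is_derive1_c f g x a b : is_derive (g x) 1 f a -> is_derive x 1 g b ->
  is_derive x 1 (fun y => f (g y)) (a * b).
Proof. exact: is_derive1_comp. Qed.

Lemma is_derive1_cst c x : is_derive x 1 (fun=> c) (0 : R).
Proof. exact: is_derive_cst. Qed.

Lemma is_derive1_id x : is_derive x 1 (fun y : R => y) (1 : R).
Proof. exact: is_derive_id. Qed.

Lemma is_derive1_sqr x : is_derive x 1 (fun y : R => y ^+ 2) (2 * x).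
Proof.
have -> : (fun y : R => y ^+ 2) = (fun y => y * y) by apply/funext => y; rewrite expr2.
by apply: (is_derive_eq (is_derive1M (is_derive1_id x) (is_derive1_id x))); ring.
Qed.

Lemma is_derive1_continuous f x a : is_derive x 1 f a -> {for x, continuous f}.
Proof.
by move=> df; apply: differentiable_continuous; apply/derivable1_diffP; exact: ex_derive.
Qed.

Lemma is_derive1_derivable f x a : is_derive x 1 f a -> derivable f x 1.
Proof. by move=> df; exact: ex_derive. Qed.

Lemma is_derive1_val f x a : is_derive x 1 f a -> (f^`())%classic x = a.
Proof. by move=> df; rewrite derive1E; exact: derive_val. Qed.

Lemma continuous_fcomp f g : continuous f -> continuous g -> continuous (fun x => f (g x)).
Proof. by move=> cf cg x; apply: continuous_comp; [exact: cg|exact: cf]. Qed.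

End RealDerivatives.

Section NormalDensity.
Variable R : realType.
Notation RR := (measurableTypeR R).
Notation leb := (@lebesgue_measure R).
Notation phi := (@normal_pdf R 0 1).
Notation c1 := (@normal_peak R 1).

Lemma peak1_gt0 : 0 < c1.
Proof. exact: normal_peak_gt0. Qed.

Lemma peak1_le1 : c1 <= 1.
Proof.
rewrite /normal_peak invf_le1 ?sqrtr_gt0; last first.
  by rewrite expr1n mul1r pmulrn_lgt0// pi_gt0.
rewrite -{1}(@sqrtr1 R) ler_wsqrtr// expr1n mul1r mulr2n.
by have := @pi_ge2 R; lra.
Qed.

Lemma phiE x : phi x = c1 * expR (- (x ^+ 2 / 2)).
Proof.
by rewrite normal_pdfE ?oner_eq0//= /normal_fun subr0 expr1n mulNr mulr2n.
Qed.

Lemma phi_gt0 x : 0 < phi x.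
Proof. by rewrite phiE mulr_gt0 ?expR_gt0 ?peak1_gt0. Qed.

Lemma phi_le1 x : phi x <= 1.
Proof.
rewrite phiE mulr_ile1 ?(ltW peak1_gt0) ?expR_ge0 ?peak1_le1//.
by rewrite -expR0 ler_expR oppr_le0 divr_ge0 ?sqr_ge0.
Qed.

Lemma continuous_phi : continuous phi.
Proof. by apply: continuous_normal_pdf; rewrite oner_eq0. Qed.

Lemma is_derive_sqr_half (x : R) : is_derive x 1 (fun y : R => y ^+ 2 / 2) x.
Proof.
have -> : (fun y : R => y ^+ 2 / 2) = (fun y => 2^-1 * y ^+ 2).
  by apply/funext => y; rewrite mulrC.
by apply: (is_derive_eq (is_derive1Z _ (is_derive1_sqr x))); field.
Qed.

Lemma is_derive_phi (x : R) : is_derive x 1 phi (- x * phi x).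
Proof.
have -> : phi = (fun y => c1 * expR (- (y ^+ 2 / 2))) by apply/funext => y; rewrite phiE.
have d1 := is_derive1_c (is_derive_expR _) (is_derive1N (is_derive_sqr_half x)).
by apply: (is_derive_eq (is_derive1Z c1 d1)); ring.
Qed.

Lemma phi_cvg0 : phi x @[x --> +oo%R] --> (0 : R).
Proof.
apply: (@squeeze_cvgr _ _ _ _ (fun=> 0) (fun x : R => expR (- x))).
- near=> x; rewrite (ltW (phi_gt0 _)) /= phiE.
  rewrite -[leRHS]mul1r ler_pM ?(ltW peak1_gt0) ?expR_ge0 ?peak1_le1//.
  rewrite ler_expR lerN2.
  have : 2 <= x by near: x; apply: nbhs_pinfty_ge; rewrite num_real.
  by nra.
- exact: cvg_cst.
- exact: cvgr_expR.
Unshelve. all: by end_near. Qed.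

Lemma integrable_phi (A : set RR) : measurable A -> leb.-integrable A (EFin \o phi).
Proof. by move=> mA; apply: (integrableS measurableT) => //; exact: integrable_normal_pdf. Qed.

Lemma phi_sym x : phi (- x) = phi x.
Proof. by rewrite !phiE sqrrN. Qed.

(** On the tail, x phi(u) is at most u phi(u), which is the derivative of -phi. *)
Lemma mills_r (x : R) : 0 < x -> \int[leb]_(u in `[x, +oo[) phi u <= phi x / x.
Proof.
move=> x0.
have iue : (\int[leb]_(u in `[x, +oo[) (u * phi u)%:E = (phi x)%:E)%E.
  rewrite (@ge0_continuous_FTC2y _ _ (fun u => - phi u) _ 0).
  - by rewrite -EFinB opprK add0r.
  - by move=> u xu; rewrite mulr_ge0 ?(ltW (phi_gt0 _))// (le_trans (ltW x0)).
  - apply: continuous_subspaceT => u; apply: cvgM; first exact: cvg_id.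
    exact: continuous_phi.
  - by have := cvgN phi_cvg0; rewrite oppr0; exact.
  - by move=> u _; exact: is_derive1_derivable (is_derive1N (is_derive_phi u)).
  - by apply: cvgN; apply: cvg_at_right_filter; exact: continuous_phi.
  - by move=> u _; rewrite (is_derive1_val (is_derive1N (is_derive_phi u))); ring.
have iu : \int[leb]_(u in `[x, +oo[) (u * phi u) = phi x by rewrite /Rintegral iue.
rewrite ler_pdivlMr// mulrC -RintegralZl//; last exact: integrable_phi.
rewrite -[leRHS]iu.
have ifu : leb.-integrable `[x, +oo[ (fun u => (u * phi u)%:E).
  apply/integrableP; split.
    apply/measurable_EFinP; apply: measurable_funM => //.
    by apply: measurable_funTS; exact: measurable_normal_pdf.
  rewrite [ltLHS](_ : _ = (phi x)%:E) ?ltry//.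
  rewrite -iue.
  apply: eq_integral => u; rewrite inE /= in_itv /= andbT => xu.
  by rewrite ger0_norm// mulr_ge0 ?(ltW (phi_gt0 _))// (le_trans (ltW x0)).
apply: le_Rintegral => //.
- by apply: (@integrableZl _ _ _ leb `[x, +oo[%classic _ x (EFin \o phi)) => //; exact: integrable_phi.
- move=> u; rewrite /= in_itv /= andbT => xu.
  by rewrite ler_wpM2r// ltW// phi_gt0.
Qed.

Lemma mills_l (x : R) : x < 0 -> \int[leb]_(u in `]-oo, x]) phi u <= phi x / - x.
Proof.
move=> x0; have x0' : 0 < - x by rewrite oppr_gt0.
have := mills_r x0'; rewrite phi_sym; apply: le_trans.
rewrite le_eqVlt; apply/orP; left; apply/eqP; rewrite /Rintegral; congr fine.
rewrite -{1}(opprK x) ge0_integration_by_substitutionNy.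
- by apply: eq_integral => u _ /=; rewrite phi_sym.
- by apply: continuous_subspaceT => u; exact: continuous_phi.
- by move=> u _; exact: ltW (phi_gt0 _).
Qed.

Lemma Rintegral_phi : \int[leb]_u phi u = 1.
Proof. by rewrite /Rintegral integral_normal_pdf. Qed.

Lemma Qfun_phi x : Qfun x = \int[leb]_(u in `]x, +oo[) phi u.
Proof. by []. Qed.

Lemma Qfun_sub (x y : R) : x <= y ->
  Qfun x - Qfun y = \int[leb]_(u in `]x, y]) phi u.
Proof.
move=> xy; rewrite !Qfun_phi.
have -> : `]x, +oo[%classic = `]x, y] `|` `]y, +oo[ :> set R.
  rewrite -itv_bndbnd_setU //.
rewrite Rintegral_setU//.
- by rewrite addrK.
- exact: integrable_phi (measurableU _ _ _ _).
- apply/disj_set2P; rewrite -subset0 => u [] /=; rewrite !in_itv /= andbT => /andP[_ h].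
  by rewrite ltNge h.
Qed.

Lemma Qfun_lipschitz (x y : R) : x <= y -> Qfun x <= Qfun y + (y - x).
Proof.
move=> xy; rewrite -lerBlDl Qfun_sub//.
apply: le_trans (_ : \int[leb]_(u in `]x, y]) (cst 1 u : R) <= _).
  apply: le_Rintegral => //; first exact: integrable_phi.
    apply/integrableP; split; first exact/measurable_EFinP/measurable_cst.
    rewrite (eq_integral (cst 1%E)) => [|u _ /=]; last by rewrite normr1.
    rewrite integral_cst//= mul1e lebesgue_measure_itv /=.
    by case: ifP => _; rewrite -?EFinB ltry.
  by move=> u _; exact: phi_le1.
rewrite Rintegral_cst//= lebesgue_measure_itv /= lte_fin.
by case: ltP => //= h; rewrite mul1r // subr_ge0.
Qed.

Lemma Qfun_decr (x y : R) : x <= y -> Qfun y <= Qfun x.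
Proof.
by move=> xy; rewrite -subr_ge0 Qfun_sub//; apply: Rintegral_ge0 => u _; exact: ltW (phi_gt0 _).
Qed.

End NormalDensity.

(** * Stein's equation *)

Section SteinEquation.
Variable R : realType.
Notation RR := (measurableTypeR R).
Notation leb := (@lebesgue_measure R).
Notation phi := (@normal_pdf R 0 1).
Notation c1 := (@normal_peak R 1).
Variable h : R -> R.
Hypotheses (ch : continuous h) (h01 : forall x, 0 <= h x <= 1).

Let iphi A : measurable A -> leb.-integrable A (EFin \o phi).
Proof. exact: integrable_phi. Qed.

Let mh : measurable_fun setT h.
Proof. exact: continuous_measurable_fun. Qed.

Let ihphi A : measurable A -> leb.-integrable A (fun x => (phi x * h x)%:E).
Proof.
move=> mA; apply: (@integrableS _ RR R leb setT) => //.
apply: (@integrable_Mbounded R _ RR leb phi h 1) => //; first exact: iphi.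
by move=> x; have /andP[h0 h1] := h01 x; rewrite ger0_norm.
Qed.

Let N := \int[leb]_x (phi x * h x).

Let N01 : 0 <= N <= 1.
Proof.
apply/andP; split.
  by apply: Rintegral_ge0 => x _; have /andP[h0 _] := h01 x; exact: mulr_ge0 (ltW (phi_gt0 _)) h0.
apply: (@le_trans _ _ (\int[leb]_u phi u)); last by rewrite Rintegral_phi.
apply: le_Rintegral => //; [exact: ihphi|exact: iphi|].
by move=> x _; have /andP[h0 h1] := h01 x; rewrite ler_piMr// ltW// phi_gt0.
Qed.

Let k x := h x - N.

Let k1 x : `|k x| <= 1.
Proof. by have /andP[h0 h1] := h01 x; have /andP[n0 n1] := N01; rewrite /k ler_norml; apply/andP; split; lra. Qed.

Let ikphi A : measurable A -> leb.-integrable A (EFin \o (fun x => phi x * k x)).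
Proof.
move=> mA; apply: (@integrableS _ RR R leb setT) => //.
apply: (@integrable_Mbounded R _ RR leb phi k 1) => //; first exact: iphi.
by apply: measurable_funB.
Qed.

(** Stein's equation f' - x f = h - N is solved by f = F / phi; [psi] below is 1 / phi. *)
Let F x := \int[leb]_(u in `]-oo, x]) (phi u * k u).

Let ck : continuous k.
Proof. by move=> x; apply: cvgB; [exact: ch|exact: cvg_cst]. Qed.

Let dF (x : R) : is_derive x 1 F (phi x * k x).
Proof.
have xx1 : x < x + 1 by rewrite ltrDl.
have [] := @continuous_FTC1 R (fun u => phi u * k u) -oo%O x (x + 1) xx1 _ _ _.
- exact: ikphi.
- exact: ltNyr.
- by apply: cvgM; [exact: continuous_phi|exact: ck].
- move=> d <-; rewrite derive1E; exact: derivableP.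
Qed.

Let FT : \int[leb]_u (phi u * k u) = 0.
Proof.
under eq_Rintegral do rewrite mulrBr.
rewrite RintegralB//; last 2 first.
- exact: ihphi.
- by apply: (@integrable_Mbounded R _ RR leb phi (fun=> N) `|N|) => //; exact: iphi.
rewrite -/N; under [X in _ - X]eq_Rintegral do rewrite mulrC.
by rewrite RintegralZl//; [rewrite Rintegral_phi mulr1 subrr|exact: iphi].
Qed.

Let abs_le A : measurable A -> `|\int[leb]_(u in A) (phi u * k u)| <= \int[leb]_(u in A) phi u.
Proof.
move=> mA; apply: le_trans (le_normr_Rintegral mA (ikphi mA)) _.
apply: le_Rintegral => //; [|exact: iphi|].
  exact: integrable_norm (ikphi mA).
move=> x _; rewrite normrM (ger0_norm (ltW (phi_gt0 x))) ler_piMr//.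
by rewrite ltW// phi_gt0.
Qed.

(** [N] is the Gaussian mean of [h], so phi k has total integral 0. This gives the decay of [F] at
    +oo, the definition that at -oo; the next bound uses on each side the tail that is small
    there. *)
Let FN x : F x = - \int[leb]_(u in `]x, +oo[) (phi u * k u).
Proof.
apply/eqP; rewrite -addr_eq0; apply/eqP; apply: etrans FT.
have -> : [set: R] = `]-oo, x] `|` `]x, +oo[ :> set R.
  by rewrite -itv_bndbnd_setU// set_itvE.
rewrite (@Rintegral_setU _ RR R leb `]-oo, x]%classic `]x, +oo[%classic) //.
- exact: ikphi (measurableU _ _ _ _).
- apply/disj_set2P; rewrite -subset0 => u [] /=; rewrite !in_itv /= andbT => h1 h2.
  by move: h1; rewrite leNgt h2.
Qed.

Let xF x : `|x * F x| <= phi x.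
Proof.
have [x0|x0|->] := ltgtP x 0; last by rewrite mul0r normr0 ltW// phi_gt0.
- rewrite normrM (ltr0_norm x0) mulrC -ler_pdivlMr ?oppr_gt0//.
  exact: le_trans (abs_le _) (mills_l x0).
- rewrite normrM (gtr0_norm x0) mulrC -ler_pdivlMr// FN normrN.
  apply: le_trans (abs_le _) _ => //.
  rewrite Rintegral_itv_obnd_cbnd//; last exact: iphi.
  exact: mills_r.
Qed.

Let psi x := c1^-1 * expR (x ^+ 2 / 2).

Let psiphi x : psi x * phi x = 1.
Proof.
rewrite /psi phiE mulrACA mulVf ?gt_eqF ?peak1_gt0// mul1r -expRD subrr.
exact: expR0.
Qed.

Let psi_gt0 x : 0 < psi x.
Proof. by apply: mulr_gt0; rewrite ?expR_gt0// invr_gt0; exact: peak1_gt0. Qed.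

Let dpsi (x : R) : is_derive x 1 psi (x * psi x).
Proof.
have d1 := is_derive1_c (is_derive_expR _) (is_derive_sqr_half x).
by apply: (is_derive_eq (is_derive1Z c1^-1 d1)); rewrite /psi; ring.
Qed.

Let f x := psi x * F x.
Let f' x := k x + x * f x.

Let df (x : R) : is_derive x 1 f (f' x).
Proof.
apply: (is_derive_eq (is_derive1M (dpsi x) (dF x))).
by rewrite [psi x * (_ * _)]mulrA psiphi mul1r addrC -mulrA.
Qed.

Let xf x : `|x * f x| <= 1.
Proof.
rewrite /f mulrCA normrM (gtr0_norm (psi_gt0 x)) -(psiphi x).
by rewrite ler_wpM2l ?(ltW (psi_gt0 x)).
Qed.

Let F1 x : `|F x| <= 1.
Proof.
apply: le_trans (abs_le _) _ => //.
have mle : (`]-oo, x]%classic : set R) `<=` setT by [].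
apply: (@le_trans _ _ (\int[leb]_u phi u)); last by rewrite Rintegral_phi.
rewrite /Rintegral; apply: fine_le.
- by apply: integrable_fin_num => //; exact: iphi.
- by apply: integrable_fin_num => //; exact: iphi.
- apply: ge0_subset_integral => //; first by case/integrableP: (iphi measurableT).
  by move=> u _; rewrite lee_fin ltW// phi_gt0.
Qed.

(** Away from 0 this follows from |x f(x)| <= 1. For |x| < 1 it follows from |F| <= 1 and the
    monotonicity of [psi] in |x|. *)
Let fb : exists K, forall x, `|f x| <= K.
Proof.
exists (Num.max 1 (psi 1)) => x.
have [x1|x1] := leP 1 `|x|.
  rewrite le_max; apply/orP; left; apply: le_trans (xf x).
  by rewrite [leRHS]normrM ler_peMl.
rewrite le_max; apply/orP; right; rewrite /f normrM (gtr0_norm (psi_gt0 x)).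
rewrite -[leRHS]mulr1 ler_pM ?F1 ?(ltW (psi_gt0 x))//.
rewrite /psi ler_wpM2l ?invr_ge0 ?(ltW (peak1_gt0 R))// ler_expR ler_wpM2r ?invr_ge0//.
by rewrite -real_normK ?num_real// ler_sqr ?nnegrE ?normr_ge0// ltW.
Qed.

(** The bound 2 is |h - N| <= 1 plus |x f(x)| <= 1. It does not depend on how steep [h] is, so the
    width of the ramps used below does not enter the Stein bound. *)
Lemma stein_equation : exists f f' : R -> R, stein_class f f' /\
  forall x, f' x = h x - \int[leb]_x (phi x * h x) + x * f x /\ `|f' x| <= 2.
Proof.
have f'2 x : `|f' x| <= 2.
  by rewrite (le_trans (ler_normD _ _))//; have := k1 x; have := xf x; lra.
exists f, f'; split; last by move=> x; split => //; exact: f'2.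
have cf : continuous f by move=> x; exact: is_derive1_continuous (df x).
split => //.
- move=> x; apply: cvgD; first exact: ck.
  by apply: cvgM; [exact: cvg_id|exact: cf].
- have [K Kf] := fb; exists (Num.max K 2) => x.
  by rewrite !le_max Kf f'2 orbT.
Qed.

End SteinEquation.

(** * The Berry-Esseen bound *)

Section BerryEsseen.
Context d (X : measurableType d) (R : realType) (mu : {measure set X -> \bar R}).
Hypothesis mu1 : mu setT = 1%E.
Notation RR := (measurableTypeR R).
Notation leb := (@lebesgue_measure R).
Notation phi := (@normal_pdf R 0 1).

Lemma integrable_prob_bounded (g : X -> R) K : measurable_fun setT g ->
  (forall x, `|g x| <= K) -> mu.-integrable setT (EFin \o g).
Proof.
move=> mg gK; have i1 : mu.-integrable setT (fun _ : X => 1%:E : \bar R).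
  by apply/integrableP; split => //; rewrite (prob_cst `|1%:E|%E mu1) abse1 ltry.
have := @integrable_Mbounded R _ X mu (fun=> 1) g K i1 mg gK.
by under eq_fun do rewrite mul1r.
Qed.

Variables (S T : X -> R) (a v : R).
Hypotheses (st : stein mu S T a v) (a0 : 0 < a).

Let sa0 : 0 < Num.sqrt a. Proof. by rewrite sqrtr_gt0. Qed.

Let U x := S x / Num.sqrt a.

Let mS : measurable_fun setT S.
Proof. by have [iS _ _ _] := st; apply/measurable_EFinP; exact: measurable_int iS. Qed.

Let mU : measurable_fun setT U.
Proof. exact: measurable_funM. Qed.

(** Evaluating Stein's equation at U = S / sqrt a and replacing S f(U) through the kernel gives E
    h(U) - N = E(f'(U) (1 - T / a)); only |f'| <= 2 and the variance of [T] enter. *)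
Lemma stein_smooth_bound (h : R -> R) (e : R) : continuous h ->
  (forall x, 0 <= h x <= 1) -> 0 < e ->
  `|\int[mu]_x h (S x / Num.sqrt a) - \int[leb]_x (phi x * h x)| <= e + v / (a ^+ 2 * e).
Proof.
move=> ch h01 e0; have [iS [iT eT] [iV eV] hst] := st.
have [f [f' [[cf cf' df [K fK]] ff']]] := stein_equation ch h01.
set N := \int[leb]_x _ in ff' *.
pose sa := (Num.sqrt a)^-1.
have sa1 : 0 < sa by rewrite invr_gt0.
have cl : continuous (fun x : R => x * sa).
  by move=> x; apply: cvgM; [exact: cvg_id|exact: cvg_cst].
have cg : stein_class (fun x => f (x * sa)) (fun x => f' (x * sa) * sa).
  split.
  - exact: continuous_fcomp cf cl.
  - move=> x; apply: cvgM; last exact: cvg_cst.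
    exact: (continuous_fcomp cf' cl).
  - move=> x.
    have dl : is_derive x 1 (fun y : R => y * sa) sa.
      apply: (is_derive_eq (is_derive1M (is_derive1_id x) (is_derive1_cst sa x))).
      by rewrite mul1r mulr0 addr0.
    exact: is_derive1_c (df _) dl.
  - exists (Num.max K (K * sa)) => x; have [f1 f2] := fK (x * sa).
    rewrite !le_max f1; split => //; apply/orP; right.
    by rewrite normrM (gtr0_norm sa1) ler_wpM2r// ltW.
have E0 := hst 0 _ _ cg.
have mfU (g : R -> R) : continuous g -> measurable_fun setT (fun x => g (U x)).
  by move=> cg'; exact: measurable_continuous.
have fK1 x : `|f x| <= K by case: (fK x).
have fK2 x : `|f' x| <= K by case: (fK x).
have if' : mu.-integrable setT (EFin \o (fun x => f' (U x))).
  by apply: (@integrable_prob_bounded _ K) => //; exact: mfU.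
have iSf : mu.-integrable setT (EFin \o (fun x => S x * f (U x))).
  by apply: (integrable_Mbounded iS (K := K)) => //; exact: mfU.
have iTf : mu.-integrable setT (EFin \o (fun x => T x * f' (U x))).
  by apply: (integrable_Mbounded iT (K := K)) => //; exact: mfU.
have iUf : mu.-integrable setT (EFin \o (fun x => sa * (S x * f (U x)))).
  exact: (@integrableZl _ _ _ _ _ measurableT sa _ iSf).
have ih : mu.-integrable setT (EFin \o (fun x => h (U x))).
  apply: (@integrable_prob_bounded _ 1) => [|x]; first exact: mfU.
  by have /andP[h0 h1] := h01 (U x); rewrite ger0_norm.
have iN : mu.-integrable setT (EFin \o (fun x : X => N)).
  by apply: (@integrable_prob_bounded _ `|N|).
have iaT : mu.-integrable setT (EFin \o (fun x => a^-1 * (T x * f' (U x)))).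
  exact: (@integrableZl _ _ _ _ _ measurableT a^-1 _ iTf).
have E1 : \int[mu]_x h (U x) - N = \int[mu]_x (f' (U x) - a^-1 * (T x * f' (U x))).
  rewrite -{1}(@Rprob_cst _ _ _ mu N mu1) -RintegralB//.
  transitivity (\int[mu]_x (f' (U x) - sa * (S x * f (U x)))).
    apply: eq_Rintegral => x _; have [-> _] := ff' (U x).
    by rewrite /U -/sa; ring.
  rewrite (RintegralB measurableT if' iUf) (RintegralB measurableT if' iaT).
  congr (_ - _); rewrite (RintegralZl _ measurableT iSf) (RintegralZl _ measurableT iTf).
  transitivity (sa * \int[mu]_x (S x * f ((0 + S x) * sa))).
    by congr (_ * _); apply: eq_Rintegral => x _; rewrite add0r.
  rewrite E0.
  transitivity (sa * \int[mu]_x (sa * (T x * f' (U x)))).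
    by congr (_ * _); apply: eq_Rintegral => x _; rewrite add0r /U -/sa; ring.
  rewrite (RintegralZl _ measurableT iTf) mulrA; congr (_ * _).
  by rewrite /sa -invfM -expr2 sqr_sqrtr// ltW.
rewrite -/(U _) -[X in `|X|]/(\int[mu]_x h (U x) - N) E1.
have iD : mu.-integrable setT (EFin \o (fun x => f' (U x) - a^-1 * (T x * f' (U x)))).
  exact: (integrableB measurableT if' iaT).
apply: le_trans (le_normr_Rintegral measurableT iD) _.
(* Pointwise 2 y <= e + y^2 / e with y = |T - a| / a, in place of the Cauchy-Schwarz inequality; [e]
   is chosen later. *)
pose w x := e + (a ^+ 2 * e)^-1 * (T x - a) ^+ 2.
have ie : mu.-integrable setT (EFin \o (fun x : X => e)).
  by apply: (@integrable_prob_bounded _ `|e|).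
have iw2 : mu.-integrable setT (EFin \o (fun x => (a ^+ 2 * e)^-1 * (T x - a) ^+ 2)).
  exact: (@integrableZl _ _ _ _ _ measurableT (a ^+ 2 * e)^-1 _ iV).
have iw : mu.-integrable setT (EFin \o w) by exact: (integrableD measurableT ie iw2).
apply: (@le_trans _ _ (\int[mu]_x w x)).
  apply: le_Rintegral => //; first exact: integrable_norm.
  move=> x _; rewrite /w; have [_ f2] := ff' (U x).
  have -> : f' (U x) - a^-1 * (T x * f' (U x)) = - (T x - a) / a * f' (U x).
    by field; rewrite gt_eqF.
  rewrite normrM; apply: (@le_trans _ _ (`|- (T x - a) / a| * 2)).
    by rewrite ler_wpM2l.
  set y := `|_|.
  have -> : (a ^+ 2 * e)^-1 * (T x - a) ^+ 2 = e^-1 * y ^+ 2.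
    by rewrite /y real_normK ?num_real//; field; rewrite !gt_eqF.
  rewrite -subr_ge0 (mulrC y).
  have -> : e + e^-1 * y ^+ 2 - 2 * y = e^-1 * (y - e) ^+ 2 by field; rewrite gt_eqF.
  by rewrite mulr_ge0 ?sqr_ge0// invr_ge0 ltW.
by rewrite (RintegralD measurableT ie iw2) Rprob_cst// (RintegralZl _ measurableT iV) eV mulrC.
Qed.

(** This is (x - t) / e clamped to [0, 1], in a form whose continuity is immediate. *)
Let ramp (t e x : R) := (1 + `|(x - t) / e| - `|(x - t) / e - 1|) / 2.

Let ramp_cont t e : continuous (ramp t e).
Proof.
have c1 : continuous (fun x => (x - t) / e).
  move=> x; apply: cvgM; last exact: cvg_cst.
  by apply: cvgB; [exact: cvg_id|exact: cvg_cst].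
move=> x; apply: cvgM; last exact: cvg_cst.
apply: cvgB; first apply: cvgD; first exact: cvg_cst.
  by apply: cvg_norm; exact: c1.
by apply: cvg_norm; apply: cvgB; [exact: c1|exact: cvg_cst].
Qed.

Let ramp01 t e x : 0 <= ramp t e x <= 1.
Proof.
rewrite /ramp; set y := (x - t) / e.
have h1 : `|y| <= `|y - 1| + 1 by have := ler_normD (y - 1) 1; rewrite subrK normr1.
have h2 : `|y - 1| <= `|y| + 1 by have := ler_normB y 1; rewrite normr1.
by apply/andP; split; lra.
Qed.

Let ramp0 t e x : 0 < e -> x <= t -> ramp t e x = 0.
Proof.
move=> e0 xt; rewrite /ramp; have : (x - t) / e <= 0 by rewrite pmulr_lle0 ?invr_gt0// subr_le0.
by move=> y0; rewrite ler0_norm// ler0_norm; lra.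
Qed.

Let ramp1 t e x : 0 < e -> t + e <= x -> ramp t e x = 1.
Proof.
move=> e0 xt; rewrite /ramp; have : 1 <= (x - t) / e by rewrite ler_pdivlMr// mul1r; lra.
by move=> y0; rewrite ger0_norm ?ger0_norm; lra.
Qed.

Let iphi (h : R -> R) : continuous h -> (forall x, 0 <= h x <= 1) ->
  leb.-integrable setT (EFin \o (fun x => phi x * h x)).
Proof.
move=> ch h01; apply: (@integrable_Mbounded R _ RR leb phi h 1).
- exact: integrable_phi.
- exact: continuous_measurable_fun.
- by move=> x; have /andP[h0 h1] := h01 x; rewrite ger0_norm.
Qed.

(** The indicator of ]t, +oo[ lies between the ramps that start at t and at t - e. One [e] comes
    from [stein_smooth_bound], the other from moving [Qfun] by [e], as it is 1-Lipschitz. *)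
Lemma stein_berry_esseen (e t : R) : 0 < e ->
  `|fine (mu [set x | t < S x / Num.sqrt a]) - Qfun t| <= 2 * e + v / (a ^+ 2 * e).
Proof.
move=> e0; set A := [set x | _].
have mA : measurable A.
  rewrite (_ : A = U @^-1` `]t, +oo[); last first.
    by apply/seteqP; split => x /=; rewrite in_itv /= andbT.
  by rewrite -[X in measurable X]setTI; apply: mU.
have iA : mu.-integrable setT (EFin \o (\1_A : X -> R)).
  apply: (@integrable_prob_bounded _ 1) => [|x]; first exact: measurable_indic.
  by rewrite indicE; case: (x \in A); rewrite ?normr1// normr0.
have PA : fine (mu A) = \int[mu]_x \1_A x.
  by rewrite /Rintegral integral_indic// setIT.
have ir t' : mu.-integrable setT (EFin \o (fun x => ramp t' e (U x))).
  apply: (@integrable_prob_bounded _ 1) => [|x].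
    by apply: measurable_continuous => //; exact: ramp_cont.
  by have /andP[h0 h1] := ramp01 t' e (U x); rewrite ger0_norm.
have B1 := stein_smooth_bound (@ramp_cont t e) (@ramp01 t e) e0.
have B2 := stein_smooth_bound (@ramp_cont (t - e) e) (@ramp01 (t - e) e) e0.
have iphiT D : measurable D -> leb.-integrable D (EFin \o phi) by exact: integrable_phi.
have QE s : Qfun s = \int[leb]_x (phi \_ `]s, +oo[) x.
  by rewrite Qfun_phi Rintegral_mkcond.
have iQ s : leb.-integrable setT (EFin \o (phi \_ (`]s, +oo[%classic : set RR))).
  rewrite -restrict_EFin.
  have ms := measurable_itv `]s, +oo[ : measurable (`]s, +oo[%classic : set RR).
  exact: (proj1 (@integrable_mkcond _ RR R leb `]s, +oo[%classic (EFin \o phi) ms) (iphiT _ ms)).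
have N1 : Qfun (t + e) <= \int[leb]_x (phi x * ramp t e x).
  rewrite QE; apply: le_Rintegral => //; first exact: iphi (@ramp_cont t e) (@ramp01 t e).
  move=> x _; rewrite patchE; case: ifPn => [|_].
    by rewrite inE /= in_itv /= andbT => /ltW h; rewrite ramp1// mulr1.
  by have /andP[h0 _] := ramp01 t e x; rewrite mulr_ge0// ltW// phi_gt0.
have N2 : \int[leb]_x (phi x * ramp (t - e) e x) <= Qfun (t - e).
  rewrite QE; apply: le_Rintegral => //; first exact: iphi (@ramp_cont (t - e) e) (@ramp01 (t - e) e).
  move=> x _; rewrite patchE; case: ifPn => [_|].
    by have /andP[_ h1] := ramp01 (t - e) e x; rewrite ler_piMr// ltW// phi_gt0.
  by rewrite notin_setE /= in_itv /= andbT => /negP; rewrite -leNgt => h; rewrite ramp0// mulr0.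
have P1 : \int[mu]_x ramp t e (S x / Num.sqrt a) <= fine (mu A).
  rewrite PA; apply: (le_Rintegral measurableT (ir t) iA).
  move=> x _; rewrite indicE; case: (boolP (x \in A)) => xA.
    by have /andP[] := ramp01 t e (U x).
  rewrite ramp0//; move: xA; rewrite notin_setE /A /= => /negP.
  by rewrite -leNgt.
have P2 : fine (mu A) <= \int[mu]_x ramp (t - e) e (S x / Num.sqrt a).
  rewrite PA; apply: (le_Rintegral measurableT iA (ir (t - e))).
  move=> x _; rewrite indicE; case: (boolP (x \in A)) => xA.
    rewrite ramp1//; move: xA; rewrite inE /A /= => /ltW; rewrite /U; lra.
  by have /andP[] := ramp01 (t - e) e (U x).
have Q1 : Qfun t <= Qfun (t + e) + e.
  by have := @Qfun_lipschitz R t (t + e); rewrite lerDl ltW// (addrC t) addrK; exact.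
have Q2 : Qfun (t - e) <= Qfun t + e.
  have := @Qfun_lipschitz R (t - e) t; rewrite lerBlDr lerDl ltW//.
  by rewrite opprB (addrCA t) subrr addr0; exact.
rewrite ler_norml; move: B1 B2; rewrite !ler_norml => /andP[B1 _] /andP[_ B2].
by apply/andP; split; lra.
Qed.

End BerryEsseen.

(** * Stein kernels of radial functions of a complex Gaussian *)

Section LogMoments.
Variable R : realType.
Notation RR := (measurableTypeR R).
Notation leb := (@lebesgue_measure R).

Lemma FTC2 (f F : R -> R) (a b : R) : a < b ->
  (forall x, a <= x <= b -> is_derive x 1 F (f x)) ->
  (forall x, a <= x <= b -> {for x, continuous f}) ->
  (\int[leb]_(x in `[a, b]) (f x)%:E = (F b)%:E - (F a)%:E)%E.
Proof.
move=> ab dF cf; have cF x : a <= x <= b -> {for x, continuous F}.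
  by move=> xab; exact: is_derive1_continuous (dF x xab).
apply: continuous_FTC2 => //.
- apply: continuous_in_subspaceT => x; rewrite inE /= in_itv /=; exact: cf.
- split.
  + move=> x; rewrite in_itv /= => /andP[ax xb].
    by apply: is_derive1_derivable (dF x _); rewrite !ltW.
  + by apply: cvg_at_right_filter; apply: cF; rewrite lexx ltW.
  + by apply: cvg_at_left_filter; apply: cF; rewrite lexx andbT ltW.
- move=> x; rewrite in_itv /= => /andP[ax xb].
  by apply: is_derive1_val (dF x _); rewrite !ltW.
Qed.

Lemma exp_dominates_pow (a : R) (k : nat) : 0 < a ->
  exists2 K, 0 <= K & forall y, 0 <= y -> (1 + y) ^+ k <= K * expR (a * y).
Proof.
(* The k-th power of exp(b y) stays below exp(a y); dividing by k + 1 also covers k = 0. *)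
move=> a0; pose b := a / k.+1%:R; have b0 : 0 < b by rewrite divr_gt0.
exists ((1 + b^-1) ^+ k).
  by rewrite exprn_ge0// addr_ge0// invr_ge0 ltW.
move=> y y0.
have h : 1 + y <= (1 + b^-1) * expR (b * y).
  have e1 : 1 <= expR (b * y) by rewrite -expR0 ler_expR mulr_ge0// ltW.
  have e2 : y <= b^-1 * expR (b * y).
    rewrite mulrC ler_pdivlMr// mulrC; have := expR_ge1Dx (b * y); lra.
  by rewrite mulrDl mul1r lerD.
apply: (@le_trans _ _ (((1 + b^-1) * expR (b * y)) ^+ k)).
  by apply: lerXn2r => //; rewrite nnegrE ?addr_ge0// (le_trans _ h)// addr_ge0.
rewrite exprMn ler_wpM2l ?exprn_ge0 ?addr_ge0 ?invr_ge0 ?(ltW b0)//.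
rewrite -expRM_natl ler_expR mulrA ler_wpM2r//.
rewrite /b mulrCA ger_pMr// ler_pdivrMr// mul1r ler_nat//.
Qed.

Lemma ln_le_sub1 (x : R) : 0 < x -> ln x <= x - 1.
Proof.
move=> x0; have := expR_ge1Dx (ln x); rewrite lnK ?posrE//; lra.
Qed.

(* An integrable singularity: [expR (- ln x / 2)] is [x^(-1/2)]. *)
Lemma integral_inv_sqrt_le2 :
  (\int[leb]_(x in `]0%R, 1%R]) (expR (- ln x / 2))%:E <= 2%:E)%E.
Proof.
pose F (n : nat) : set RR := `[n.+2%:R^-1, 1]%classic.
have -> : `]0%R, 1%R]%classic = \bigcup_n F n.
  apply/seteqP; split => x /=.
    rewrite in_itv /= => /andP[x0 x1].
    have [n] := ltr_add_invr x0.
    rewrite add0r => nx; exists n => //; rewrite /F /= in_itv /= x1 andbT.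
    by apply: le_trans (ltW nx); rewrite lef_pV2 ?posrE// ler_nat.
  move=> [n _]; rewrite /F /= !in_itv /= => /andP[nx ->]; rewrite andbT.
  by apply: lt_le_trans nx; rewrite invr_gt0.
have ndF : nondecreasing_seq F.
  move=> n m nm; apply/subsetPset => x; rewrite /F /= !in_itv /= => /andP[nx ->].
  by rewrite andbT (le_trans _ nx)// lef_pV2 ?posrE// ler_nat !ltnS.
have mg : measurable_fun setT (fun x : RR => (expR (- ln x / 2))%:E).
  apply/measurable_EFinP; apply: measurableT_comp => //.
  by apply: measurable_funM => //; apply: measurableT_comp.
have mF i : measurable (F i) by exact: measurable_itv.
have := @ge0_nondecreasing_set_cvg_integral _ _ R F (fun x => (expR (- ln x / 2))%:E) leb
  ndF mF (fun i => measurable_funTS mg).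
move=> /(_ (fun _ _ _ => expR_ge0 _)) => h.
rewrite -(cvg_lim _ h)//; apply: lime_le; first by apply/cvg_ex; eexists; exact: h.
apply: nearW => n; rewrite /F.
have n1 : (n.+2%:R : R)^-1 < 1 by rewrite invf_lt1// ltr1n.
have pos x : (n.+2%:R : R)^-1 <= x <= 1 -> 0 < x.
  by move=> /andP[nx _]; apply: lt_le_trans nx; rewrite invr_gt0.
have dF (x : R) : (n.+2%:R : R)^-1 <= x <= 1 ->
    is_derive x 1 (fun y => 2 * expR (ln y / 2)) (expR (- ln x / 2)).
  move=> /pos x0; have dl : is_derive x 1 (fun y : R => ln y / 2) (x^-1 / 2).
    apply: (is_derive_eq (is_derive1M (is_derive1_ln x0) (is_derive1_cst 2^-1 x))).
    by rewrite mulr0 addr0.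
  apply: (is_derive_eq (is_derive1Z 2 (is_derive1_c (is_derive_expR _) dl))).
  have -> : - ln x / 2 = ln x / 2 - ln x by field.
  by rewrite expRD expRN lnK ?posrE//; field; rewrite gt_eqF.
have cf (x : R) : (n.+2%:R : R)^-1 <= x <= 1 -> {for x, continuous (fun y => expR (- ln y / 2))}.
  move=> /pos x0.
  apply: (@continuous_comp _ _ _ (fun y : R => - ln y / 2) expR); last exact: continuous_expR.
  apply: cvgM; last exact: cvg_cst.
  by apply: cvgN; exact: continuous_ln.
rewrite (FTC2 n1 dF cf) -EFinB lee_fin ln1 mul0r expR0 mulr1 lerBlDr lerDl.
by rewrite mulr_ge0// expR_ge0.
Qed.

(** A one-dimensional weight all of whose powers are Gaussian integrable. The square is doubled so
    that the sum over the two coordinates dominates [logB] of |u|^2, where |ln e| itself costs a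
    further e. *)
Definition logw (x : R) : R := 1 + x ^+ 2 *+ 2 + `|ln (x ^+ 2)|.

Lemma measurable_logw : measurable_fun setT (logw : RR -> RR).
Proof.
apply: measurable_funD.
  apply: measurable_funD => //; under eq_fun do rewrite mulr2n.
  by apply: measurable_funD; exact: measurable_funX.
by apply: measurableT_comp => //; apply: measurableT_comp.
Qed.

Lemma logw_ge1 x : 1 <= logw x.
Proof. by rewrite /logw -addrA lerDl addr_ge0// mulrn_wge0// sqr_ge0. Qed.

Lemma normal_pdf0E (s x : R) : s != 0 ->
  normal_pdf 0 s x = normal_peak s * expR (- (x ^+ 2 / (2 * s ^+ 2))).
Proof.
move=> s0; rewrite normal_pdfE//= /normal_fun subr0 mulNr; congr (_ * expR (- (_ / _))).
by rewrite mulr_natl.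
Qed.

Definition isqrt01 (x : R) : R := expR (- ln x / 2) * \1_(`]0, 1]%classic : set R) x.

Lemma isqrt01_ge0 x : 0 <= isqrt01 x.
Proof. by rewrite mulr_ge0// expR_ge0. Qed.

Lemma measurable_isqrt01 : measurable_fun setT (isqrt01 : RR -> RR).
Proof.
apply: measurable_funM; last exact: measurable_indic.
apply: measurableT_comp => //; apply: measurable_funM => //.
exact: measurableT_comp.
Qed.

Lemma integral_isqrt01 : (\int[leb]_x (isqrt01 x)%:E <= 2%:E)%E.
Proof.
apply: le_trans integral_inv_sqrt_le2; rewrite [leRHS]integral_mkcond.
rewrite le_eqVlt; apply/orP; left; apply/eqP; apply: eq_integral => x _.
by rewrite /isqrt01 patchE indicE; case: (x \in _); rewrite ?mulr1// mulr0.
Qed.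

(** Near 0 a power of the logarithm is absorbed by |x|^(-1/2). For |x| > 1 the growth is polynomial
    and is absorbed by doubling the standard deviation. *)
Lemma logw_bound (s : R) (k : nat) : 0 < s -> exists2 K, 0 <= K &
  forall x, x != 0 -> logw x ^+ k * normal_pdf 0 s x <=
    K * normal_pdf 0 (2 * s) x + K * (isqrt01 x + isqrt01 (- x)).
Proof.
move=> s0.
have s20 : 2 * s != 0 by rewrite mulf_neq0// gt_eqF.
(* With y = - ln(x^2), exp(y / 4) is |x|^(-1/2). *)
have [K1 K10 h1] := @exp_dominates_pow 4^-1 k ltac:(by rewrite invr_gt0).
(* The gap 1/(2 s^2) - 1/(8 s^2) between the exponents for standard deviations s and 2 s. *)
have a0 : 0 < 3 / (8 * s ^+ 2) by rewrite divr_gt0// mulr_gt0// exprn_gt0.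
have [K2 K20 h2] := exp_dominates_pow k a0.
have ps0 := @normal_peak_gt0 R s (lt0r_neq0 s0).
have p2s0 := normal_peak_gt0 s20.
pose Ka := 3 ^+ k * K1 * normal_peak s.
pose Kb := 3 ^+ k * K2 * normal_peak s / normal_peak (2 * s).
have Ka0 : 0 <= Ka by rewrite !mulr_ge0 ?exprn_ge0// ltW.
have Kb0 : 0 <= Kb by rewrite !mulr_ge0 ?exprn_ge0 ?invr_ge0// ltW.
have lw0 x : 0 <= logw x by rewrite (le_trans ler01)// logw_ge1.
exists (Ka + Kb); first by rewrite addr_ge0.
move=> x x0.
have x20 : 0 < x ^+ 2 by rewrite exprn_even_gt0.
have lnx2 : ln (x ^+ 2) = 2 * ln `|x|.
  by rewrite -real_normK ?num_real// lnXn ?normr_gt0// mulr_natl.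
have pdf0 t := @normal_pdf_ge0 R 0 t x.
have [x1|x1] := leP `|x| 1.
  have hr : expR (- ln `|x| / 2) <= isqrt01 x + isqrt01 (- x).
    move: x0; rewrite neq_lt => /orP[x0|x0].
      rewrite -[leLHS]add0r lerD ?isqrt01_ge0// /isqrt01 ltr0_norm// indicE mem_set ?mulr1//.
      by rewrite /= in_itv /= oppr_gt0 x0 -(ltr0_norm x0).
    rewrite -[leLHS]addr0 lerD ?isqrt01_ge0// /isqrt01 gtr0_norm// indicE mem_set ?mulr1//.
    by rewrite /= in_itv /= x0 -(gtr0_norm x0).
  apply: (@le_trans _ _ ((Ka + Kb) * expR (- ln `|x| / 2))); last first.
    rewrite -[leLHS]add0r lerD//; first by rewrite mulr_ge0// addr_ge0.
    by rewrite ler_wpM2l// addr_ge0.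
  pose y := - (2 * ln `|x|).
  have y0 : 0 <= y by rewrite oppr_ge0 mulr_ge0_le0// ln_le0.
  have e1 : logw x <= 3 * (1 + y).
    rewrite /logw lnx2 ler0_norm -?oppr_ge0// -/y.
    have : x ^+ 2 <= 1 by rewrite -real_normK ?num_real// expr_le1.
    by rewrite mulr2n; lra.
  have e2 : logw x ^+ k <= 3 ^+ k * (K1 * expR (4^-1 * y)).
    apply: (@le_trans _ _ ((3 * (1 + y)) ^+ k)).
      by apply: lerXn2r => //; rewrite nnegrE// mulr_ge0// addr_ge0.
    by rewrite exprMn ler_wpM2l ?exprn_ge0// h1.
  apply: (@le_trans _ _ (3 ^+ k * (K1 * expR (4^-1 * y)) * normal_peak s)).
    by rewrite ler_pM ?exprn_ge0// normal_pdf_ub// gt_eqF.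
  have -> : 4^-1 * y = - ln `|x| / 2 by rewrite /y; field.
  rewrite [leLHS](_ : _ = Ka * expR (- ln `|x| / 2)); last by rewrite /Ka; ring.
  by rewrite ler_wpM2r ?expR_ge0// lerDl.
rewrite -[leLHS]addr0 lerD//; last first.
  by rewrite mulr_ge0 ?addr_ge0// isqrt01_ge0.
have e1 : logw x <= 3 * (1 + x ^+ 2).
  rewrite /logw ger0_norm; last first.
    by rewrite lnx2 mulr_ge0// ln_ge0// ltW.
  by have := ln_le_sub1 x20; rewrite mulr2n; have := ltW x20; lra.
have e2 : logw x ^+ k <= 3 ^+ k * (K2 * expR (3 / (8 * s ^+ 2) * x ^+ 2)).
  apply: (@le_trans _ _ ((3 * (1 + x ^+ 2)) ^+ k)).
    by apply: lerXn2r => //; rewrite nnegrE// mulr_ge0// addr_ge0// ltW.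
  by rewrite exprMn ler_wpM2l ?exprn_ge0// h2// ltW.
apply: (@le_trans _ _ (3 ^+ k * (K2 * expR (3 / (8 * s ^+ 2) * x ^+ 2)) * normal_pdf 0 s x)).
  by rewrite ler_wpM2r.
rewrite !normal_pdf0E ?gt_eqF ?mulr_gt0//.
rewrite [leLHS](_ : _ = Kb * (normal_peak (2 * s) * expR (- (x ^+ 2 / (2 * (2 * s) ^+ 2))))).
  by rewrite ler_wpM2r ?lerDr// mulr_ge0 ?expR_ge0// ltW.
have -> : - (x ^+ 2 / (2 * (2 * s) ^+ 2)) = 3 / (8 * s ^+ 2) * x ^+ 2 - x ^+ 2 / (2 * s ^+ 2).
  by field; rewrite gt_eqF.
by rewrite /Kb expRD; field; rewrite gt_eqF.
Qed.

Lemma logw_integrable (s : R) (k : nat) : 0 < s ->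
  (normal_prob 0 s).-integrable setT (EFin \o (fun x : RR => logw x ^+ k)).
Proof.
move=> s0; have [K K0 hK] := logw_bound k s0.
have mlw : measurable_fun setT (fun x : RR => logw x ^+ k).
  exact: measurable_funX measurable_logw.
have lw0 x : 0 <= logw x by rewrite (le_trans ler01)// logw_ge1.
apply/integrableP; split; first exact/measurable_EFinP.
have -> : (\int[normal_prob 0 s]_x `|(logw x ^+ k)%:E| =
    \int[leb]_x (logw x ^+ k * normal_pdf 0 s x)%:E)%E.
  rewrite normal_integral.
  - apply: eq_integral => x _; rewrite /= -EFinM ger0_norm ?exprn_ge0//.
    by rewrite mulrC.
  - by apply: measurableT_comp => //; exact/measurable_EFinP.
  - by move=> x; exact: abse_ge0.
have ma : measurable_fun setT (fun x : RR => (isqrt01 x)%:E).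
  by apply/measurable_EFinP; exact: measurable_isqrt01.
have a0 x : (0 <= (isqrt01 x)%:E)%E by rewrite lee_fin isqrt01_ge0.
have mb : measurable_fun setT (fun x : RR => (isqrt01 (- x)%R)%:E).
  by apply: (measurableT_comp ma); exact: oppr_measurable.
have ib : (\int[leb]_x (isqrt01 (- x)%R)%:E = \int[leb]_x (isqrt01 x)%:E)%E.
  have n10 : (-1 : R) != 0 by rewrite oppr_eq0 oner_neq0.
  have := @leb_affine R (-1) 0 (fun x => (isqrt01 x)%:E) n10 ma a0.
  rewrite normrN1 invr1 mul1e => <-.
  by apply: eq_integral => x _; rewrite mulN1r addr0.
pose r (x : RR) : R := isqrt01 x + isqrt01 (- x).
have mr : measurable_fun setT (fun x => (r x)%:E) by exact: (emeasurable_funD ma mb).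
have r0 x : (0 <= (r x)%:E)%E by rewrite lee_fin addr_ge0// isqrt01_ge0.
have ir : (\int[leb]_x (r x)%:E < +oo)%E.
  have -> : (\int[leb]_x (r x)%:E = \int[leb]_x (isqrt01 x)%:E + \int[leb]_x (isqrt01 (- x)%R)%:E)%E.
    exact: (@ge0_integralD _ RR R leb setT measurableT _ _ (fun x _ => a0 x) ma (fun x _ => a0 (- x)) mb).
  by rewrite ib lte_add_pinfty//; apply: le_lt_trans integral_isqrt01 _; exact: ltry.
have mp2 : measurable_fun setT (fun x : RR => (normal_pdf 0 (2 * s) x)%:E).
  by apply/measurable_EFinP; exact: measurable_normal_pdf.
have p20 x : (0 <= (normal_pdf 0 (2 * s) x)%:E)%E by rewrite lee_fin normal_pdf_ge0.
apply: (@le_lt_trans _ _ (\int[leb]_x (K%:E * (normal_pdf 0 (2 * s) x)%:E + K%:E * (r x)%:E)))%E.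
  apply: ae_ge0_le_integral => //.
  - by move=> x _; rewrite lee_fin mulr_ge0 ?exprn_ge0 ?normal_pdf_ge0.
  - by apply/measurable_EFinP; apply: measurable_funM => //; exact: measurable_normal_pdf.
  - by move=> x _; rewrite adde_ge0// mule_ge0.
  - by apply: emeasurable_funD; apply: emeasurable_funM.
  - exists [set 0 : RR]; split; first exact: measurable_set1.
      exact: lebesgue_measure_set1.
    move=> x /= H; apply: contrapT => x0; apply: H => _.
    by rewrite -!EFinM -EFinD lee_fin hK//; apply/eqP.
rewrite ge0_integralD//; last 4 first.
- by move=> x _; rewrite mule_ge0.
- exact: emeasurable_funM.
- by move=> x _; rewrite mule_ge0.
- exact: emeasurable_funM.
rewrite (ge0_intZl _ mp2) // (ge0_intZl _ mr) //.
rewrite integral_normal_pdf mule1 lte_add_pinfty ?ltry//.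
by rewrite lte_mul_pinfty// lee_fin.
Qed.

End LogMoments.

Section IntegralDensity.
Context d (T : measurableType d) (R : realType).
Variables (nu : {finite_measure set T -> \bar R}).
Variables (mu : {sigma_finite_measure set T -> \bar R}).
Variable p : T -> R.
Hypothesis p0 : forall x, 0 <= p x.
Hypothesis mp : measurable_fun setT p.
Hypothesis nup : forall A, measurable A -> nu A = (\int[mu]_(x in A) (p x)%:E)%E.

Lemma integral_density (f : T -> \bar R) : measurable_fun setT f ->
  (\int[nu]_x f x = \int[mu]_x ((p x)%:E * f x))%E.
Proof.
move=> mf; rewrite integralE [RHS]integralE.
have pos (g : T -> \bar R) x : ((p x)%:E * (g^\+ x) = (fun x => (p x)%:E * g x)^\+ x)%E.
  by rewrite !funeposE maxe_pMr ?lee_fin// mule0.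
have neg x : ((p x)%:E * (f^\- x) = (fun x => (p x)%:E * f x)^\- x)%E.
  by rewrite !funenegE maxe_pMr ?lee_fin// mule0 muleN.
rewrite (ge0_integral_density p0 mp nup (measurable_funepos mf)) //.
rewrite (ge0_integral_density p0 mp nup (measurable_funeneg mf)) //.
congr (_ - _)%E; apply: eq_integral => x _; first exact: pos.
exact: neg.
Qed.

Lemma integrable_density (f : T -> \bar R) : nu.-integrable setT f ->
  mu.-integrable setT (fun x => (p x)%:E * f x)%E.
Proof.
move=> /integrableP[mf fi]; apply/integrableP; split.
  by apply: emeasurable_funM => //; exact/measurable_EFinP.
apply: le_lt_trans fi; rewrite (ge0_integral_density p0 mp nup)//.
- rewrite le_eqVlt; apply/orP; left; apply/eqP; apply: eq_integral => x _.
  by rewrite abseM gee0_abs// lee_fin.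
- exact: measurableT_comp.
Qed.

End IntegralDensity.

(** * Gaussian integration by parts in one variable *)

Section GaussIBP.
Variable R : realType.
Notation RR := (measurableTypeR R).
Notation leb := (@lebesgue_measure R).

Lemma integral_derive_eq0 (G G' : R -> R) : (forall x : R, is_derive x 1 G (G' x)) ->
  continuous G' -> leb.-integrable setT (EFin \o G') ->
  G n.+1%:R @[n --> \oo] --> (0 : R) -> G (- n.+1%:R) @[n --> \oo] --> (0 : R) ->
  \int[leb]_x G' x = 0.
Proof.
move=> dG cG' iG' G1 G2.
pose F (n : nat) : set RR := `[- n.+1%:R, n.+1%:R]%classic.
have mF n : measurable (F n) by exact: measurable_itv.
have mG' : measurable_fun setT (EFin \o G') by exact: measurable_int iG'.
have [|||||_ _] := @dominated_convergence _ RR R leb setT measurableT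
   (fun n => (EFin \o G') \_ (F n)) (EFin \o G') (fun x => `|(G' x)%:E|%E).
- by move=> n; apply/(measurable_restrictT _ (mF n)); exact: measurable_funTS.
- exact: mG'.
- apply: aeW => x _; apply: cvg_near_cst; near=> n.
  rewrite patchE mem_set// /F /= in_itv /= -ler_norml.
  have : `|x| <= n%:R by near: n; exact: nbhs_infty_ger.
  by move=> /le_trans; apply; rewrite ler_nat.
- exact: integrable_abse iG'.
- apply: aeW => x n _; rewrite patchE; case: ifP => _ //.
  by rewrite abse0.
have -> : (fun n => \int[leb]_x ((EFin \o G') \_ (F n)) x)%E =
    (fun n => (G n.+1%:R - G (- n.+1%:R))%:E).
  apply/funext => n; rewrite -integral_mkcond EFinB.
  by apply: FTC2 => // [|x _]; [rewrite -subr_gt0 opprK addr_gt0|exact: cG'].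
move=> h1.
have h2 : (G n.+1%:R - G (- n.+1%:R))%:E @[n --> \oo] --> (0 - 0 : R)%:E.
  by apply: cvg_EFin; [exact: nearW|exact: cvgB].
by rewrite /Rintegral (cvg_unique _ h1 h2) //= subr0.
Unshelve. all: by end_near. Qed.

Variable s : R.
Hypothesis s0 : 0 < s.
Let s1 : s != 0. Proof. by rewrite gt_eqF. Qed.

Lemma is_derive_normal_pdf (x : R) :
  is_derive x 1 (normal_pdf 0 s) (- (x / s ^+ 2) * normal_pdf 0 s x).
Proof.
have -> : normal_pdf 0 s = (fun y => normal_peak s * expR (- ((2 * s ^+ 2)^-1 * y ^+ 2))).
  by apply/funext => y; rewrite normal_pdf0E// (mulrC (2 * s ^+ 2)^-1).
have d1 := is_derive1_c (is_derive_expR _) (is_derive1N (is_derive1Z (2 * s ^+ 2)^-1 (is_derive1_sqr x))).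
by apply: (is_derive_eq (is_derive1Z _ d1)); field.
Qed.

Lemma sqr1_le_logw (x : R) : 1 + x ^+ 2 <= logw x.
Proof.
rewrite /logw mulr2n; have := normr_ge0 (ln (x ^+ 2)); have := sqr_ge0 x; lra.
Qed.

Lemma integrable_poly (g : R -> R) (K : R) (k : nat) : measurable_fun setT (g : RR -> RR) ->
  (forall x, `|g x| <= K * (1 + x ^+ 2) ^+ k) ->
  (normal_prob 0 s).-integrable setT (EFin \o g).
Proof.
move=> mg gK.
have K0 : 0 <= K.
  by have := le_trans (normr_ge0 _) (gK 0); rewrite expr0n addr0 expr1n mulr1.
have iK := @integrableZl _ _ _ (normal_prob 0 s) _ measurableT K _ (logw_integrable k s0).
apply: (le_integrable measurableT _ _ iK); first exact/measurable_EFinP.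
move=> x _ /=; rewrite lee_fin (le_trans (gK x))// ger0_norm; last first.
  by rewrite mulr_ge0 ?exprn_ge0// (le_trans ler01 (logw_ge1 _)).
rewrite ler_wpM2l//; apply: lerXn2r; rewrite ?nnegrE ?addr_ge0 ?sqr_ge0 ?sqr1_le_logw//.
Qed.

(** Against Lebesgue measure the integrand is the derivative of [g] times the density, and this
    product vanishes at both ends because the density beats any polynomial. *)
Lemma gauss_ibp (g g' : R -> R) (K : R) (k : nat) :
  (forall x : R, is_derive x 1 g (g' x)) -> continuous g' ->
  (forall x, `|g x| <= K * (1 + x ^+ 2) ^+ k) ->
  (forall x, `|g' x| <= K * (1 + x ^+ 2) ^+ k) ->
  \int[normal_prob 0 s]_x (g' x - x / s ^+ 2 * g x) = 0.
Proof.
move=> dg cg' gK g'K.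
have K0 : 0 <= K.
  by have := le_trans (normr_ge0 _) (gK 0); rewrite expr0n addr0 expr1n mulr1.
have cg : continuous g by move=> x; exact: is_derive1_continuous (dg x).
pose D x := g' x - x / s ^+ 2 * g x.
have cD : continuous D.
  move=> x; apply: cvgB; first exact: cg'.
  by apply: cvgM; [apply: cvgM; [exact: cvg_id|exact: cvg_cst]|exact: cg].
have mD : measurable_fun setT (D : RR -> RR) by exact: continuous_measurable_fun.
have iD : (normal_prob 0 s).-integrable setT (EFin \o D).
  apply: (@integrable_poly D (K + K / s ^+ 2) k.+1) => // x.
  have q1 : 1 <= 1 + x ^+ 2 by rewrite lerDl sqr_ge0.
  have q0 := le_trans ler01 q1.
  have qx : `|x| <= 1 + x ^+ 2.
    by rewrite -(real_normK (num_real x)); have := normr_ge0 x; nra.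
  rewrite /D (le_trans (ler_normB _ _))// mulrDl lerD//.
    by rewrite (le_trans (g'K x))// ler_wpM2l// [leRHS]exprS ler_peMl// exprn_ge0.
  rewrite !normrM normfV (ger0_norm (sqr_ge0 s)) (exprS (1 + x ^+ 2)).
  apply: (@le_trans _ _ ((1 + x ^+ 2) / s ^+ 2 * (K * (1 + x ^+ 2) ^+ k))).
    by rewrite ler_pM ?divr_ge0 ?sqr_ge0// ler_wpM2r ?invr_ge0 ?sqr_ge0.
  by rewrite le_eqVlt; apply/orP; left; apply/eqP; field.
have pdf0 x : 0 <= normal_pdf 0 s x := normal_pdf_ge0 0 s x.
have mpdf := measurable_normal_pdf 0 s.
have nuE A : measurable A ->
  normal_prob 0 s A = (\int[leb]_(x in A) (normal_pdf 0 s x)%:E)%E by [].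
have E := @integral_density _ RR R (normal_prob 0 s) leb _ pdf0 mpdf nuE _ (measurable_int _ iD).
have I := @integrable_density _ RR R (normal_prob 0 s) leb _ pdf0 mpdf nuE _ iD.
rewrite -/(D _) /Rintegral E.
pose G x := g x * normal_pdf 0 s x.
have dG (x : R) : is_derive x 1 G (normal_pdf 0 s x * D x).
  by apply: (is_derive_eq (is_derive1M (dg x) (is_derive_normal_pdf x))); rewrite /D; ring.
have a0 : 0 < (2 * s ^+ 2)^-1 by rewrite invr_gt0 mulr_gt0// exprn_gt0.
have [K2 K20 hK2] := exp_dominates_pow k.+1 a0.
have Gb x : `|G x| <= K * K2 * normal_peak s / (1 + x ^+ 2).
  have q0 : 0 < 1 + x ^+ 2 by rewrite ltr_pwDl// sqr_ge0.
  rewrite /G normrM (ger0_norm (pdf0 x)) normal_pdf0E//.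
  apply: (@le_trans _ _ (K * (1 + x ^+ 2) ^+ k * (normal_peak s * expR (- (x ^+ 2 / (2 * s ^+ 2)))))).
    by rewrite ler_wpM2r// mulr_ge0 ?expR_ge0// normal_peak_ge0.
  rewrite ler_pdivlMr//.
  have := hK2 (x ^+ 2) (sqr_ge0 x); rewrite (exprS (1 + x ^+ 2)) => h.
  set E0 := expR (- _); set E1 := expR _ in h.
  have EE : E0 * E1 = 1 by rewrite /E0 /E1 -expRD (mulrC (2 * s ^+ 2)^-1) addNr expR0.
  have P0 : 0 <= K * normal_peak s * E0 by rewrite !mulr_ge0 ?expR_ge0// normal_peak_ge0.
  rewrite [leLHS](_ : _ = (K * normal_peak s * E0) * ((1 + x ^+ 2) * (1 + x ^+ 2) ^+ k)); last by ring.
  apply: (le_trans (ler_wpM2l P0 h)).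
  rewrite [leLHS](_ : _ = K * K2 * normal_peak s * (E0 * E1)); last by ring.
  by rewrite EE mulr1.
have cvg0 : K * K2 * normal_peak s / (1 + n.+1%:R ^+ 2) @[n --> \oo] --> (0 : R).
  rewrite -[X in _ --> X](mulr0 (K * K2 * normal_peak s)); apply: cvgM; first exact: cvg_cst.
  apply: (@squeeze_cvgr _ _ _ _ (fun=> 0) (fun n => n.+1%:R^-1)).
  - apply: nearW => n; rewrite invr_ge0 addr_ge0 ?sqr_ge0//=.
    rewrite lef_pV2 ?posrE// ?ltr_pwDl ?sqr_ge0//.
    have : 1 <= n.+1%:R :> R by rewrite ler1n.
    by nra.
  - exact: cvg_cst.
  - exact: cvg_harmonic.
have main := @integral_derive_eq0 G (fun x => normal_pdf 0 s x * D x) dG.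
rewrite -/(Rintegral leb setT (fun x => normal_pdf 0 s x * D x)) main//.
- move=> x; apply: cvgM; last exact: cD.
  exact: continuous_normal_pdf.
- apply: (@squeeze_cvgr _ _ _ _ (fun n => - (K * K2 * normal_peak s / (1 + n.+1%:R ^+ 2))) (fun n => K * K2 * normal_peak s / (1 + n.+1%:R ^+ 2))) => //.
  + by apply: nearW => n; rewrite -ler_norml.
  + by rewrite -oppr0; exact: cvgN.
- apply: (@squeeze_cvgr _ _ _ _ (fun n => - (K * K2 * normal_peak s / (1 + n.+1%:R ^+ 2))) (fun n => K * K2 * normal_peak s / (1 + n.+1%:R ^+ 2))) => //.
  + by apply: nearW => n; rewrite -ler_norml -(sqrrN n.+1%:R).
  + by rewrite -oppr0; exact: cvgN.
Qed.

End GaussIBP.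

Section Gauss2.
Variable R : realType.
Notation RR := (measurableTypeR R).
Notation C := (RR * RR)%type.
Notation leb := (@lebesgue_measure R).
Variable s : R.
Hypothesis s0 : 0 < s.

(** The scale on which functions of |u|^2 are allowed to grow, both at 0 and at infinity; all its
    powers are integrable by [logB_integrable]. *)
Definition logB (e : R) : R := 1 + e + `|ln e|.

Lemma measurable_cabs2 : measurable_fun setT (fun u : C => (@cabs2 R u : RR)).
Proof. by apply: measurable_funD; apply: measurable_funX. Qed.

Lemma measurable_logB : measurable_fun setT (logB : RR -> RR).
Proof.
apply: measurable_funD; first by apply: measurable_funD.
by apply: measurableT_comp => //; exact: measurable_ln.
Qed.

Lemma logB_ge1 e : 0 <= e -> 1 <= logB e.
Proof. by move=> e0; rewrite /logB -addrA lerDl addr_ge0. Qed.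

Lemma abs_ln_le (a e : R) : 0 < a -> a <= e -> `|ln e| <= e + `|ln a|.
Proof.
move=> a0 ae; have e0 := lt_le_trans a0 ae.
have [e1|e1] := leP 1 e.
  rewrite ger0_norm ?ln_ge0// (le_trans (ln_le_sub1 e0))//.
  by have := normr_ge0 (ln a); lra.
have lae : ln a <= ln e by rewrite ler_ln ?posrE.
have l1 : ln e <= 0 by rewrite ln_le0// ltW.
by rewrite !ler0_norm ?(le_trans lae)//; lra.
Qed.

Lemma logB_le_logw (u : C) : logB (@cabs2 R u) <= logw u.1 + logw u.2.
Proof.
case: u => x y; rewrite /logB /logw /cabs2 /= !mulr2n.
have x2 := sqr_ge0 x; have y2 := sqr_ge0 y.
have nx := normr_ge0 (ln (x ^+ 2)); have ny := normr_ge0 (ln (y ^+ 2)).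
have [x0|x0] := eqVneq x 0.
  have [y0|y0] := eqVneq y 0.
    by rewrite x0 y0 expr0n /= add0r ln0// normr0; lra.
  have y20 : 0 < y ^+ 2 by rewrite exprn_even_gt0.
  by have := @abs_ln_le (y ^+ 2) (x ^+ 2 + y ^+ 2) y20; rewrite lerDr => /(_ x2); lra.
have x20 : 0 < x ^+ 2 by rewrite exprn_even_gt0.
by have := @abs_ln_le (x ^+ 2) (x ^+ 2 + y ^+ 2) x20; rewrite lerDl => /(_ y2); lra.
Qed.

Lemma exprD_le2 (a b : R) k : 0 <= a -> 0 <= b -> (a + b) ^+ k <= 2 ^+ k * (a ^+ k + b ^+ k).
Proof.
move=> a0 b0; wlog ab : a b a0 b0 / a <= b.
  move=> H; have [/H|/ltW/H] := leP a b; first exact.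
  by rewrite addrC [a ^+ k + _]addrC; apply.
apply: (@le_trans _ _ ((2 * b) ^+ k)).
  by apply: lerXn2r; rewrite ?nnegrE ?addr_ge0 ?mulr_ge0//; lra.
by rewrite exprMn ler_wpM2l ?exprn_ge0// lerDr exprn_ge0.
Qed.

Lemma logB_integrable k :
  (gauss2 s).-integrable setT (EFin \o (fun u : C => logB (@cabs2 R u) ^+ k)).
Proof.
have pT : normal_prob 0 s setT = 1%E by exact: (@probability_setT _ _ _ (normal_prob 0 s)).
have i1 := @integrable_fst _ _ _ _ _ (normal_prob 0 s) (normal_prob 0 s) _ pT (logw_integrable k s0).
have i2 := @integrable_snd _ _ _ _ _ (normal_prob 0 s) (normal_prob 0 s) _ pT (logw_integrable k s0).
have i3 := integrableZl measurableT (2 ^+ k) (integrableD measurableT i1 i2).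
apply: (le_integrable measurableT _ _ i3).
  apply/measurable_EFinP; apply: measurable_funX.
  exact: (measurableT_comp measurable_logB measurable_cabs2).
have lw0 (x : R) : 0 <= logw x := le_trans ler01 (logw_ge1 x).
move=> u _ /=; have u0 : 0 <= cabs2 u by rewrite addr_ge0 ?sqr_ge0.
have B0 := le_trans ler01 (logB_ge1 u0).
rewrite lee_fin !ger0_norm ?mulr_ge0 ?addr_ge0 ?exprn_ge0//.
apply: le_trans (exprD_le2 k (lw0 u.1) (lw0 u.2)).
by apply: lerXn2r; [exact: B0|rewrite nnegrE; exact: addr_ge0|exact: logB_le_logw].
Qed.

Lemma integrable_logB (g : C -> R) (K : R) k : measurable_fun setT g ->
  (forall u, `|g u| <= K * logB (@cabs2 R u) ^+ k) ->
  (gauss2 s).-integrable setT (EFin \o g).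
Proof.
move=> mg gK.
have K0 : 0 <= K.
  have := le_trans (normr_ge0 _) (gK (0, 0)).
  by rewrite /logB /cabs2 /= expr0n /= addr0 ln0// normr0 !addr0 expr1n mulr1.
have iK := integrableZl measurableT K (logB_integrable k).
apply: (le_integrable measurableT _ _ iK); first exact/measurable_EFinP.
move=> u _ /=; rewrite lee_fin (le_trans (gK u))// ger0_norm//.
by rewrite mulr_ge0// exprn_ge0// (le_trans ler01)// logB_ge1// addr_ge0 ?sqr_ge0.
Qed.

Lemma normal_prob_set1 (x : R) : normal_prob 0 s [set x] = 0%E.
Proof.
have := @normal_prob_dominates R 0 s; move=> /null_content_dominatesP; apply.
  exact: measurable_set1.
exact: lebesgue_measure_set1.
Qed.

Lemma gauss2_axes (F G : C -> R) : measurable_fun setT F -> measurable_fun setT G ->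
  (forall u, u.1 != 0 -> u.2 != 0 -> F u = G u) ->
  \int[gauss2 s]_u F u = \int[gauss2 s]_u G u.
Proof.
move=> mF mG FG; rewrite /Rintegral; congr fine.
apply: ae_eq_integral => //; [exact/measurable_EFinP|exact/measurable_EFinP|].
have m1 : measurable (([set 0 : RR] `*` setT) : set C).
  by apply: measurableX => //; exact: measurable_set1.
have m2 : measurable ((setT `*` [set 0 : RR]) : set C).
  by apply: measurableX => //; exact: measurable_set1.
exists (([set 0 : RR] `*` setT) `|` (setT `*` [set 0 : RR])); split.
- exact: measurableU.
- have z1 : gauss2 s ([set 0 : RR] `*` setT) = 0%E.
    apply: (etrans (@product_measure1E _ _ RR RR R (normal_prob 0 s) (normal_prob 0 s) [set 0] setT (measurable_set1 (0 : R)) measurableT)).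
    by apply: (etrans (f_equal (fun z => z * _)%E (normal_prob_set1 0))); rewrite mul0e.
  have z2 : gauss2 s (setT `*` [set 0 : RR]) = 0%E.
    apply: (etrans (@product_measure1E _ _ RR RR R (normal_prob 0 s) (normal_prob 0 s) setT [set 0] measurableT (measurable_set1 (0 : R)))).
    by apply: (etrans (f_equal (fun z => _ * z)%E (normal_prob_set1 0))); rewrite mule0.
  exact: (etrans (@measureU0 _ _ _ (gauss2 s) _ _ m1 m2 z2) z1).
- move=> u /= H; have [u1|u1] := eqVneq u.1 0; first by left.
  have [u2|u2] := eqVneq u.2 0; first by right.
  by exfalso; apply: H => _; rewrite FG.
Qed.

Lemma gauss2_swap (F : C -> R) : (gauss2 s).-integrable setT (EFin \o F) ->
  \int[gauss2 s]_u F (u.2, u.1) = \int[gauss2 s]_u F u.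
Proof.
move=> iF; have mF : measurable_fun setT (EFin \o F) := measurable_int _ iF.
have iF' : (gauss2 s).-integrable setT (EFin \o (fun u : C => F (u.2, u.1))).
  have ms : measurable_fun setT (fun u : C => (EFin \o F) (u.2, u.1)).
    by apply: (measurableT_comp mF); exact: measurable_fun_pair.
  apply/(integrable12ltyP (normal_prob 0 s) (normal_prob 0 s) ms).
  by have /(integrable21ltyP (normal_prob 0 s) (normal_prob 0 s) mF) := iF.
by rewrite (Rfubini12 iF') (Rfubini21 iF).
Qed.

End Gauss2.

(** * Stein kernels from radial vector fields *)

Section RadialStein.
Variable R : realType.
Notation RR := (measurableTypeR R).
Notation C := (RR * RR)%type.
Variables (s kappa K : R) (rho rho1 w w1 : R -> R).
Hypotheses (s0 : 0 < s) (kappa0 : kappa != 0).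
Hypotheses (mrho : measurable_fun setT (rho : RR -> RR))
  (mrho1 : measurable_fun setT (rho1 : RR -> RR))
  (mw : measurable_fun setT (w : RR -> RR)) (mw1 : measurable_fun setT (w1 : RR -> RR)).
Hypotheses (drho : forall e : R, 0 < e -> is_derive e 1 rho (rho1 e))
  (dw : forall e : R, 0 < e -> is_derive e 1 w (w1 e))
  (crho1 : forall e : R, 0 < e -> {for e, continuous rho1})
  (cw1 : forall e : R, 0 < e -> {for e, continuous w1}).
Hypotheses (brho : forall e, 0 <= e -> `|rho e| <= K * logB e)
  (brho1 : forall e, 0 <= e -> `|e * rho1 e| <= K * logB e)
  (bw : forall e, 0 <= e -> `|w e| <= K * logB e)
  (bw1 : forall e, 0 <= e -> `|e * w1 e| <= K * logB e).
(** The left side is the Gaussian divergence <u / s^2, X> - div X of the field X(u) = rho(|u|^2) u,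
    written in e = |u|^2. Thus kappa w is a divergence, and integrating by parts against f(c + w)
    leaves <X, grad f(c + w)> = 2 e rho w1 f'. *)
Hypothesis kw : forall e, 0 < e ->
  (e / s ^+ 2 - 2) * rho e - 2 * e * rho1 e = kappa * w e.

Let K0 : 0 <= K.
Proof.
have := le_trans (normr_ge0 _) (brho (lexx 0)).
by rewrite /logB ln0// normr0 !addr0 mulr1.
Qed.

Section ibp.
Variables (c A : R) (f f' : R -> R).
Hypotheses (df : forall x : R, is_derive x 1 f (f' x)) (cf' : continuous f').
Hypotheses (bf : forall x, `|f x| <= A * (1 + `|x|)) (bf' : forall x, `|f' x| <= A).

Let A0 : 0 <= A. Proof. exact: le_trans (normr_ge0 _) (bf' 0). Qed.

Let fe e := f (c + w e).
Let f'e e := f' (c + w e).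
Let A1 := A * (1 + `|c| + K).

Let A10 : 0 <= A1. Proof. by rewrite mulr_ge0// !addr_ge0. Qed.

Let bfe e : 0 <= e -> `|fe e| <= A1 * logB e.
Proof.
move=> e0; rewrite (le_trans (bf _))// /A1 -mulrA ler_wpM2l// !mulrDl mul1r.
have B1 := logB_ge1 e0.
have := ler_normD c (w e); have := bw e0.
have : `|c| <= `|c| * logB e by rewrite ler_peMr.
lra.
Qed.

Let dcomp (e : R) : 0 < e -> is_derive e 1 fe (f'e e * w1 e).
Proof.
move=> e0; apply: (is_derive1_c (df _)).
by apply: (is_derive_eq (is_derive1D (is_derive1_cst c e) (dw e0))); rewrite add0r.
Qed.

(** The contribution of the first axis to the Gaussian divergence of f(c + w) rho u. *)
Let Dx (u : C) : R := let e := @cabs2 R u in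
  (u.1 ^+ 2 / s ^+ 2 - 1) * (rho e * fe e)
  - 2 * u.1 ^+ 2 * (rho1 e * fe e + rho e * (f'e e * w1 e)).

Let mf (g : R -> R) : continuous g -> measurable_fun setT (fun u : C => (g (c + w (@cabs2 R u)) : RR)).
Proof.
move=> cg; apply: measurable_continuous => //; apply: measurable_funD => //.
exact: (measurableT_comp mw (@measurable_cabs2 R)).
Qed.

Let cf : continuous f. Proof. by move=> x; exact: is_derive1_continuous (df x). Qed.

Let mcomp (g : R -> R) : measurable_fun setT (g : RR -> RR) ->
  measurable_fun setT (fun u : C => (g (@cabs2 R u) : RR)).
Proof. by move=> mg; exact: (measurableT_comp mg (@measurable_cabs2 R)). Qed.

Let mDx : measurable_fun setT Dx.
Proof.
have m1 : measurable_fun setT (fun u : C => (u.1 ^+ 2 : RR)) by apply: measurable_funX.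
apply: measurable_funB; apply: measurable_funM.
- by apply: measurable_funB => //; apply: measurable_funM.
- by apply: measurable_funM; [exact: mcomp|exact: mf].
- exact: measurable_funM.
- apply: measurable_funD; apply: measurable_funM; try exact: mcomp; first exact: mf.
  by apply: measurable_funM; [exact: mf|exact: mcomp].
Qed.

Let KD := (s ^- 2 + 1) * (K * A1) + 2 * (K * A1) + 2 * (K * K * A).

Let bDx u : `|Dx u| <= KD * logB (@cabs2 R u) ^+ 3.
Proof.
rewrite /Dx; set e := cabs2 u; have e0 : 0 <= e by rewrite addr_ge0 ?sqr_ge0.
have x2 : 0 <= u.1 ^+ 2 by exact: sqr_ge0.
have xe : u.1 ^+ 2 <= e by rewrite /e /cabs2 lerDl sqr_ge0.
set x := u.1 ^+ 2 in x2 xe *; set B := logB e.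
have B1 : 1 <= B by exact: logB_ge1.
have eB : e <= B by rewrite /B /logB; have := normr_ge0 (ln e); lra.
have B0 := le_trans ler01 B1.
have B23 : B ^+ 2 <= B ^+ 3 by apply: ler_weXn2l.
have si : 0 <= s ^- 2 by rewrite invr_ge0 sqr_ge0.
have t1 : `|(x / s ^+ 2 - 1) * (rho e * fe e)| <= (s ^- 2 + 1) * (K * A1) * B ^+ 3.
  rewrite !normrM; apply: (@le_trans _ _ ((s ^- 2 + 1) * B * (K * B * (A1 * B)))).
    apply: ler_pM => //.
    - rewrite (le_trans (ler_normB _ _))// normr1 ger0_norm ?divr_ge0 ?sqr_ge0//.
      rewrite mulrDl mul1r lerD// mulrC ler_wpM2l//; exact: le_trans xe eB.
    - by apply: ler_pM => //; [exact: brho|exact: bfe].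
  by rewrite le_eqVlt; apply/orP; left; apply/eqP; ring.
have rr (r : R) : `|e * r| <= K * B -> `|x * r| <= K * B.
  by apply: le_trans; rewrite (normrM x) (normrM e) ler_wpM2r// (ger0_norm x2) (ger0_norm e0).
have t2 : `|x * (rho1 e * fe e)| <= K * A1 * B ^+ 3.
  rewrite mulrA normrM; apply: (@le_trans _ _ (K * B * (A1 * B))).
    by apply: ler_pM => //; [exact: rr (brho1 e0)|exact: bfe].
  rewrite [leLHS](_ : _ = K * A1 * B ^+ 2); last by ring.
  rewrite ler_wpM2l//. exact: mulr_ge0 K0 A10.
have t3 : `|x * (rho e * (f'e e * w1 e))| <= K * K * A * B ^+ 3.
  rewrite [X in `|X|](_ : _ = rho e * (x * w1 e) * f'e e); last by ring.
  have r2 : `|x * w1 e| <= K * B by exact: rr (bw1 e0).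
  rewrite (normrM (rho e * (x * w1 e))) (normrM (rho e)).
  apply: (@le_trans _ _ (K * B * (K * B) * A)).
    apply: ler_pM; [exact: mulr_ge0|by []| |exact: bf'].
    by apply: ler_pM => //; exact: brho.
  rewrite [leLHS](_ : _ = K * K * A * B ^+ 2); last by ring.
  rewrite ler_wpM2l//. exact: (mulr_ge0 (mulr_ge0 K0 K0) A0).
rewrite [X in `|X|](_ : _ = (x / s ^+ 2 - 1) * (rho e * fe e) -
  2 * (x * (rho1 e * fe e)) - 2 * (x * (rho e * (f'e e * w1 e)))); last by ring.
set X1 := (x / s ^+ 2 - 1) * _ in t1 *; set X2 := x * _ in t2 *; set X3 := x * _ in t3 *.
have n2 (z : R) : `|2 * z| = 2 * `|z| by rewrite normrM ger0_norm.
have := ler_normB (X1 - 2 * X2) (2 * X3); have := ler_normB X1 (2 * X2).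
rewrite !n2 => h1 h2.
rewrite [leRHS](_ : _ = (s ^- 2 + 1) * (K * A1) * B ^+ 3 + 2 * (K * A1 * B ^+ 3) +
  2 * (K * K * A * B ^+ 3)); last by rewrite /KD; ring.
lra.
Qed.

Let iDx : (gauss2 s).-integrable setT (EFin \o Dx).
Proof. exact: (integrable_logB s0 mDx bDx). Qed.

(** On a horizontal line that avoids the origin |u|^2 stays above y^2 > 0, so [rho] and [w] are
    differentiable along it and [gauss_ibp] applies to G = - x rho f. The growth constants depend on
    y, which is harmless since only the value 0 is kept. *)
Let Dx_section (y : R) : y != 0 -> \int[normal_prob 0 s]_x Dx (x, y) = 0.
Proof.
move=> y0; have y2 : 0 < y ^+ 2 by rewrite exprn_even_gt0.
pose E x := x ^+ 2 + y ^+ 2.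
have E0 x : 0 < E x by rewrite ltr_wpDl// sqr_ge0.
have dE (x : R) : is_derive x 1 E (2 * x).
  by apply: (is_derive_eq (is_derive1D (is_derive1_sqr x) (is_derive1_cst (y ^+ 2) x))); rewrite addr0.
have cE : continuous E by move=> x; exact: is_derive1_continuous (dE x).
pose P x := rho (E x) * fe (E x).
pose Q x := 2 * x * (rho1 (E x) * fe (E x) + rho (E x) * (f'e (E x) * w1 (E x))).
have dP (x : R) : is_derive x 1 P (Q x).
  have d1 := is_derive1_c (drho (E0 x)) (dE x).
  have d2 := is_derive1_c (dcomp (E0 x)) (dE x).
  by apply: (is_derive_eq (is_derive1M d1 d2)); rewrite /Q; ring.
pose G x := - (x * P x).
pose G' x := - (P x + x * Q x).
have dG (x : R) : is_derive x 1 G (G' x).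
  apply: (is_derive_eq (is_derive1N (is_derive1M (is_derive1_id x) (dP x)))).
  by rewrite mul1r.
have cP : continuous P by move=> x; exact: is_derive1_continuous (dP x).
have cc (h : R -> R) (x : R) : {for E x, continuous h} -> {for x, continuous (fun z => h (E z))}.
  by move=> ch; apply: continuous_comp; [exact: cE|exact: ch].
have cfe (x : R) : {for x, continuous (fun z => fe (E z))}.
  by apply: cc; exact: is_derive1_continuous (dcomp (E0 x)).
have cw (e : R) : 0 < e -> {for e, continuous (fun z => c + w z)}.
  move=> e0; apply: cvgD; first exact: cvg_cst.
  exact: is_derive1_continuous (dw e0).
have cf'e (x : R) : {for x, continuous (fun z => f'e (E z))}.
  apply: cc; apply: (@continuous_comp _ _ _ (fun z => c + w z) f'); first exact: cw.
  exact: cf'.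
have cQ : continuous Q.
  move=> x; apply: cvgM.
    by apply: cvgM; [exact: cvg_cst|exact: cvg_id].
  apply: cvgD; apply: cvgM.
  - by apply: cc; exact: crho1.
  - exact: cfe.
  - by apply: cc; exact: is_derive1_continuous (drho (E0 x)).
  - apply: cvgM; first exact: cf'e.
    by apply: cc; exact: cw1.
have cG' : continuous G'.
  move=> x; apply: cvgN; apply: cvgD; first exact: cP.
  by apply: cvgM; [exact: cvg_id|exact: cQ].
pose Ky := 2 + 2 * y ^+ 2 + `|ln (y ^+ 2)|.
have Ky0 : 0 <= Ky by rewrite !addr_ge0// mulr_ge0// ltW.
have BK (x : R) : logB (E x) <= Ky * (1 + x ^+ 2).
  have hx : y ^+ 2 <= E x by rewrite lerDr sqr_ge0.
  have := abs_ln_le y2 hx; rewrite /logB /Ky; set L := `|ln (E x)| => h.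
  have q1 : 0 <= x ^+ 2 * y ^+ 2 by rewrite mulr_ge0// ?sqr_ge0.
  have q2 : 0 <= x ^+ 2 * `|ln (y ^+ 2)| by rewrite mulr_ge0// sqr_ge0.
  have := sqr_ge0 x; have := ltW y2; move: h; rewrite /E; lra.
have q1 (x : R) : 1 <= 1 + x ^+ 2 by rewrite lerDl sqr_ge0.
pose Kc := (3 * (K * A1) + 2 * (K * K * A)) * Ky ^+ 2.
have KA0 : 0 <= K * A1 by exact: mulr_ge0.
have KKA0 : 0 <= K * K * A by rewrite !mulr_ge0.
have BB (x : R) : logB (E x) ^+ 2 <= Ky ^+ 2 * (1 + x ^+ 2) ^+ 2.
  rewrite -exprMn; apply: lerXn2r; rewrite ?nnegrE ?BK//.
    by rewrite (le_trans ler01)// logB_ge1// ltW.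
  by rewrite mulr_ge0// (le_trans ler01).
have tP x : `|P x| <= K * A1 * logB (E x) ^+ 2.
  rewrite /P normrM; apply: (@le_trans _ _ (K * logB (E x) * (A1 * logB (E x)))).
    by apply: ler_pM => //; [exact: brho (ltW (E0 x))|exact: bfe (ltW (E0 x))].
  by rewrite le_eqVlt; apply/orP; left; apply/eqP; ring.
have xE (x r : R) : `|E x * r| <= K * logB (E x) -> `|x ^+ 2 * r| <= K * logB (E x).
  apply: le_trans; rewrite (normrM (x ^+ 2)) (normrM (E x)) ler_wpM2r//.
  by rewrite (ger0_norm (sqr_ge0 x)) (gtr0_norm (E0 x)) lerDl ltW.
have tQ x : `|x * Q x| <= (2 * (K * A1) + 2 * (K * K * A)) * logB (E x) ^+ 2.
  have -> : x * Q x = 2 * (x ^+ 2 * rho1 (E x) * fe (E x)) +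
      2 * (rho (E x) * (x ^+ 2 * w1 (E x)) * f'e (E x)) by rewrite /Q; ring.
  have n2 (z : R) : `|2 * z| = 2 * `|z| by rewrite normrM ger0_norm.
  rewrite (le_trans (ler_normD _ _))// !n2.
  have r1 := xE x _ (brho1 (ltW (E0 x))); have r2 := xE x _ (bw1 (ltW (E0 x))).
  have s1 : `|x ^+ 2 * rho1 (E x) * fe (E x)| <= K * logB (E x) * (A1 * logB (E x)).
    by rewrite normrM; apply: ler_pM => //; exact: bfe (ltW (E0 x)).
  have s2 : `|rho (E x) * (x ^+ 2 * w1 (E x)) * f'e (E x)| <= K * logB (E x) * (K * logB (E x)) * A.
    rewrite (normrM (rho (E x) * _)) (normrM (rho (E x))).
    apply: ler_pM; [exact: mulr_ge0|by []| |exact: bf'].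
    by apply: ler_pM => //; exact: brho (ltW (E0 x)).
  lra.
have qq (x : R) : (1 + x ^+ 2) ^+ 2 <= (1 + x ^+ 2) ^+ 3 by exact: ler_weXn2l.
rewrite -[RHS](@gauss_ibp R s s0 G G' Kc 3 dG cG').
- apply: eq_Rintegral => x _; rewrite /Dx /G /G' /Q /P /E /cabs2 /=; ring.
- move=> x; rewrite /G normrN normrM exprS.
  have xq : `|x| <= 1 + x ^+ 2.
    by rewrite -(real_normK (num_real x)); have := normr_ge0 x; nra.
  rewrite mulrCA; apply: ler_pM => //; apply: (le_trans (tP x)).
  apply: (@le_trans _ _ (K * A1 * (Ky ^+ 2 * (1 + x ^+ 2) ^+ 2))); first by rewrite ler_wpM2l.
  rewrite /Kc mulrA ler_wpM2r ?exprn_ge0 ?(le_trans ler01 (q1 x))//.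
  by rewrite ler_wpM2r ?exprn_ge0//; lra.
- move=> x; rewrite /G' normrN (le_trans (ler_normD _ _))//.
  have h := lerD (tP x) (tQ x); apply: (le_trans h); rewrite -mulrDl.
  have -> : K * A1 + (2 * (K * A1) + 2 * (K * K * A)) = 3 * (K * A1) + 2 * (K * K * A) by ring.
  rewrite /Kc -[leRHS]mulrA; apply: ler_wpM2l; first lra.
  by rewrite (le_trans (BB x))// ler_wpM2l// exprn_ge0.
Qed.

Let int_Dx : \int[gauss2 s]_u Dx u = 0.
Proof.
(* The line y = 0 meets the singularity at the origin; it is null and is cut out before Fubini. *)
pose D' (u : C) := Dx u * \1_(~` [set (0 : RR)]) u.2.
have mD' : measurable_fun setT D'.
  apply: measurable_funM => //; apply: measurableT_comp => //.
  by apply: measurable_indic; apply: measurableC; exact: measurable_set1.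
rewrite (@gauss2_axes R s Dx D' mDx mD'); last first.
  by move=> u _ u2; rewrite /D' indicE mem_set ?mulr1//; exact/eqP.
rewrite Rfubini21; last first.
  apply: (@integrable_logB R s s0 D' KD 3 mD') => u.
  rewrite (le_trans _ (bDx u))// /D' normrM ler_piMr// indicE.
  by case: (_ \in _); rewrite ?normr1 ?normr0.
transitivity (\int[normal_prob 0 s]_y (0 : R)); last by rewrite /Rintegral integral0.
apply: eq_Rintegral => y _ /=.
have [->|y0] := eqVneq y 0.
  transitivity (\int[normal_prob 0 s]_x (0 : R)); last by rewrite /Rintegral integral0.
  apply: eq_Rintegral => x _; rewrite /D' /= indicE memNset ?mulr0//; exact.
rewrite -[RHS](Dx_section y0); apply: eq_Rintegral => x _.
by rewrite /D' indicE mem_set ?mulr1//; exact/eqP.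
Qed.

(** The identities of the two axes are added. By [kw] the terms carrying f combine into kappa w f,
    and the terms carrying f' into -2 e rho w1 f'. *)
Lemma radial_ibp : \int[gauss2 s]_u (w (@cabs2 R u) * f (c + w (@cabs2 R u))) =
  \int[gauss2 s]_u ((2 * @cabs2 R u * rho (@cabs2 R u) * w1 (@cabs2 R u) / kappa)
     * f' (c + w (@cabs2 R u))).
Proof.
pose Dy (u : C) := Dx (u.2, u.1).
have iDy : (gauss2 s).-integrable setT (EFin \o Dy).
  apply: (@integrable_logB R s s0 Dy KD 3) => [|u].
    by apply: (measurableT_comp mDx); exact: measurable_fun_pair.
  by have := bDx (u.2, u.1); rewrite /cabs2 /= [u.2 ^+ 2 + _]addrC.
have int_Dy : \int[gauss2 s]_u Dy u = 0 by rewrite (gauss2_swap iDx).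
pose F1 (u : C) := w (@cabs2 R u) * f (c + w (@cabs2 R u)).
pose F2 (u : C) := (2 * @cabs2 R u * rho (@cabs2 R u) * w1 (@cabs2 R u) / kappa)
     * f' (c + w (@cabs2 R u)).
have mF1 : measurable_fun setT F1.
  by apply: measurable_funM; [exact: mcomp|exact: mf].
have mF2 : measurable_fun setT F2.
  apply: measurable_funM; last exact: mf.
  apply: measurable_funM => //; apply: measurable_funM; last exact: mcomp.
  apply: measurable_funM; last exact: mcomp.
  by apply: measurable_funM => //; exact: measurable_cabs2.
have iF1 : (gauss2 s).-integrable setT (EFin \o F1).
  apply: (@integrable_logB R s s0 F1 (K * A1) 2 mF1) => u.
  have e0 : 0 <= cabs2 u by rewrite addr_ge0 ?sqr_ge0.
  rewrite /F1 normrM; apply: (@le_trans _ _ (K * logB (cabs2 u) * (A1 * logB (cabs2 u)))).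
    by apply: ler_pM => //; [exact: bw|exact: bfe].
  by rewrite le_eqVlt; apply/orP; left; apply/eqP; ring.
have iF2 : (gauss2 s).-integrable setT (EFin \o F2).
  apply: (@integrable_logB R s s0 F2 (2 * K * K * A / `|kappa|) 2 mF2) => u.
  have e0 : 0 <= cabs2 u by rewrite addr_ge0 ?sqr_ge0.
  rewrite /F2 [X in `|X|](_ : _ = 2 / kappa * (rho (cabs2 u) * (cabs2 u * w1 (cabs2 u))
     * f' (c + w (cabs2 u)))); last by ring.
  rewrite normrM normrM normfV (ger0_norm (ler0n _ _)).
  apply: (@le_trans _ _ (2 / `|kappa| * (K * logB (cabs2 u) * (K * logB (cabs2 u)) * A))).
    rewrite ler_wpM2l ?divr_ge0// (normrM (rho _ * _)) (normrM (rho _)).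
    apply: ler_pM; [exact: mulr_ge0|by []| |exact: bf'].
    by apply: ler_pM => //; [exact: brho|exact: bw1].
  by rewrite le_eqVlt; apply/orP; left; apply/eqP; ring.
have H : \int[gauss2 s]_u (Dx u + Dy u) = \int[gauss2 s]_u (kappa * (F1 u - F2 u)).
  apply: gauss2_axes.
  - apply: measurable_funD => //; apply/measurable_EFinP; exact: measurable_int iDy.
  - by apply: measurable_funM => //; exact: measurable_funB.
  - move=> u u1 u2; rewrite /Dx /Dy /F1 /F2 /Dx /=.
    have -> : cabs2 (u.2, u.1) = cabs2 u by rewrite /cabs2 /= addrC.
    have e0 : 0 < cabs2 u by rewrite /cabs2 ltr_pwDl ?exprn_even_gt0// sqr_ge0.
    have := kw e0; rewrite -/(fe (cabs2 u)) -/(f'e (cabs2 u)) => kwe.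
    rewrite [RHS](_ : _ = kappa * w (cabs2 u) * fe (cabs2 u) -
       2 * cabs2 u * rho (cabs2 u) * w1 (cabs2 u) * f'e (cabs2 u)); last by field.
    rewrite -kwe; have eE : cabs2 u = u.1 ^+ 2 + u.2 ^+ 2 by [].
    move: (rho _) (rho1 _) (fe _) (f'e _) (w1 _) => r r1 q q1 v1.
    by rewrite eE; ring.
have iF : (gauss2 s).-integrable setT (EFin \o (fun u => F1 u - F2 u)).
  exact: (integrableB measurableT iF1 iF2).
move: H; rewrite (RintegralD measurableT iDx iDy) int_Dx int_Dy addr0.
rewrite (RintegralZl _ measurableT iF) (RintegralB measurableT iF1 iF2).
by move=> /esym/eqP; rewrite mulf_eq0 (negbTE kappa0) /= subr_eq0 => /eqP.
Qed.

End ibp.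
End RadialStein.

Section RadialSteinClass.
Variable R : realType.
Notation RR := (measurableTypeR R).
Notation C := (RR * RR)%type.

(** Taking f = 1 in [radial_ibp] gives E w = 0, and f = id identifies the mean of the kernel with E
    w^2; the latter is why [radial_ibp] admits test functions of linear growth. *)
Lemma radial_stein (s kappa K : R) (rho rho1 w w1 : R -> R) :
  0 < s -> kappa != 0 ->
  measurable_fun setT (rho : RR -> RR) -> measurable_fun setT (rho1 : RR -> RR) ->
  measurable_fun setT (w : RR -> RR) -> measurable_fun setT (w1 : RR -> RR) ->
  (forall e : R, 0 < e -> is_derive e 1 rho (rho1 e)) ->
  (forall e : R, 0 < e -> is_derive e 1 w (w1 e)) ->
  (forall e : R, 0 < e -> {for e, continuous rho1}) ->
  (forall e : R, 0 < e -> {for e, continuous w1}) ->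
  (forall e, 0 <= e -> `|rho e| <= K * logB e) ->
  (forall e, 0 <= e -> `|e * rho1 e| <= K * logB e) ->
  (forall e, 0 <= e -> `|w e| <= K * logB e) ->
  (forall e, 0 <= e -> `|e * w1 e| <= K * logB e) ->
  (forall e, 0 < e -> (e / s ^+ 2 - 2) * rho e - 2 * e * rho1 e = kappa * w e) ->
  let tau (u : C) := 2 * @cabs2 R u * rho (@cabs2 R u) * w1 (@cabs2 R u) / kappa in
  let a := \int[gauss2 s]_u (w (@cabs2 R u) ^+ 2) in
  [/\ stein (gauss2 s) (fun u : C => w (@cabs2 R u)) tau a (\int[gauss2 s]_u (tau u - a) ^+ 2),
      \int[gauss2 s]_u w (@cabs2 R u) = 0 &
      (gauss2 s).-integrable setT (fun u : C => (w (@cabs2 R u) ^+ 2)%:E) ].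
Proof.
move=> s0 k0 mrho mrho1 mw mw1 drho dw crho1 cw1 brho brho1 bw bw1 kw tau a.
have ibp := radial_ibp s0 k0 mrho mrho1 mw mw1 drho dw crho1 cw1 brho brho1 bw bw1 kw.
have mS : measurable_fun setT (fun u : C => w (@cabs2 R u)).
  exact: (measurableT_comp mw (@measurable_cabs2 R)).
have mT : measurable_fun setT tau.
  apply: measurable_funM => //.
  apply: measurable_funM; last exact: (measurableT_comp mw1 (@measurable_cabs2 R)).
  apply: measurable_funM; last exact: (measurableT_comp mrho (@measurable_cabs2 R)).
  by apply: measurable_funM => //; exact: measurable_cabs2.
have e0 (u : C) : 0 <= @cabs2 R u by rewrite addr_ge0 ?sqr_ge0.
have K0 : 0 <= K.
  have := le_trans (normr_ge0 _) (brho 0 (lexx 0)).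
  by rewrite /logB ln0// normr0 !addr0 mulr1.
pose KT := 2 * K ^+ 2 / `|kappa|.
have KT0 : 0 <= KT by rewrite divr_ge0// mulr_ge0// sqr_ge0.
have bT u : `|tau u| <= KT * logB (@cabs2 R u) ^+ 2.
  rewrite /tau [X in `|X|](_ : _ = 2 / kappa * (rho (cabs2 u) * (cabs2 u * w1 (cabs2 u)))); last by ring.
  rewrite normrM (normrM (rho _)) (normrM 2) normfV (ger0_norm (ler0n _ _)).
  apply: (@le_trans _ _ (2 / `|kappa| * (K * logB (cabs2 u) * (K * logB (cabs2 u))))).
    rewrite ler_wpM2l ?divr_ge0//.
    by apply: ler_pM => //; [exact: brho (e0 u)|exact: bw1 (e0 u)].
  by rewrite le_eqVlt /KT; apply/orP; left; apply/eqP; ring.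
have iT : (gauss2 s).-integrable setT (EFin \o tau) := integrable_logB s0 mT bT.
split.
- split.
  + apply: (@integrable_logB R s s0 _ K 1 mS) => u; rewrite expr1; exact: bw.
  + split; first exact: iT.
    have := ibp 0 1 id (fun=> 1) (fun x => is_derive1_id x) (fun x => cvg_cst _).
    move=> /(_ _ _); rewrite /a => H.
    transitivity (\int[gauss2 s]_u (tau u * 1)); first by apply: eq_Rintegral => u _; rewrite mulr1.
    rewrite /tau -H.
    * by apply: eq_Rintegral => u _; rewrite add0r expr2.
    * by move=> x; rewrite mul1r lerDr.
    * by move=> x; rewrite normr1.
  + split => //; apply: (@integrable_logB R s s0 _ ((KT + `|a|) ^+ 2) 4).
      by apply: measurable_funX; exact: measurable_funB.
    move=> u; have B1 := logB_ge1 (e0 u).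
    have h : `|tau u - a| <= (KT + `|a|) * logB (cabs2 u) ^+ 2.
      rewrite (le_trans (ler_normB _ _))// mulrDl lerD// ler_peMr//.
      by rewrite exprn_ege1.
    rewrite (_ : logB _ ^+ 4 = (logB (cabs2 u) ^+ 2) ^+ 2); last by rewrite -exprM.
    rewrite -exprMn normrX; apply: lerXn2r; rewrite ?nnegrE//.
    exact: le_trans h.
  + move=> c f f' [cf cf' df [A fA]].
    apply: (ibp c A f f' df cf') => x; have [f1 f2] := fA x => //.
    by rewrite (le_trans f1)// ler_peMr ?lerDl// (le_trans (normr_ge0 _) f1).
- have := ibp 0 1 (fun=> 1) (fun=> 0) (fun x => is_derive1_cst 1 x) (fun x => cvg_cst _).
  move=> H; transitivity (\int[gauss2 s]_u (w (@cabs2 R u) * 1)).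
    by apply: eq_Rintegral => u _; rewrite mulr1.
  rewrite H; last 2 first.
  + by move=> x; rewrite mul1r normr1 lerDl.
  + by move=> x; rewrite normr0.
  by under eq_Rintegral do rewrite mulr0; rewrite /Rintegral integral0.
- apply: (@integrable_logB R s s0 _ (K ^+ 2) 2); first exact: measurable_funX.
  move=> u; rewrite normrX -exprMn; apply: lerXn2r; rewrite ?nnegrE ?bw//.
  by rewrite (le_trans _ (bw _ (e0 u))).
Qed.

(** The constant rho = 1/2 solves the equation with kappa = 1. The kernel is |u|^2 / (2 s^2) = 1 +
    w, so that E w^2 = E(1 + w) = 1. *)
Lemma gauss_stein (s : R) : 0 < s ->
  let w (u : C) := @cabs2 R u / (2 * s ^+ 2) - 1 in
  exists tau v, stein (gauss2 s) w tau 1 v.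
Proof.
move=> s0 w; pose q := (2 * s ^+ 2)^-1.
have q0 : 0 <= q by rewrite invr_ge0 mulr_ge0// sqr_ge0.
pose K := q + 1.
have B1 (e : R) : 0 <= e -> 1 <= logB e /\ e <= logB e.
  by move=> e0; split; [exact: logB_ge1|rewrite /logB; have := normr_ge0 (ln e); lra].
have d0 (e : R) : is_derive e 1 (fun x => x * q - 1) q.
  have d1 := is_derive1M (is_derive1_id e) (is_derive1_cst q e).
  apply: (is_derive_eq (is_derive1D d1 (is_derive1_cst (-1) e))).
  by rewrite mul1r mulr0 !addr0.
have drho (e : R) : 0 < e -> is_derive e 1 (fun=> 2^-1 : R) 0 by move=> _; exact: is_derive1_cst.
have dw (e : R) : 0 < e -> is_derive e 1 (fun x => x * q - 1) q by move=> _; exact: d0.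
have [|||||||||||st Ew iw2] := @radial_stein s 1 K (fun=> 2^-1) (fun=> 0)
  (fun e => e * q - 1) (fun=> q) s0 (oner_neq0 _) _ _ _ _ drho dw.
- exact: measurable_cst.
- exact: measurable_cst.
- by apply: measurable_funB => //; exact: measurable_funM.
- exact: measurable_cst.
- by move=> e _; exact: cvg_cst.
- by move=> e _; exact: cvg_cst.
- move=> e /B1[b1 b2]; rewrite ger0_norm ?invr_ge0// /K.
  have : 0 <= q * logB e by rewrite mulr_ge0// (le_trans ler01).
  lra.
- move=> e /B1[b1 b2]; rewrite mulr0 normr0 mulr_ge0 ?(le_trans ler01)//.
  by rewrite /K lerDr.
- move=> e e0; have [b1 b2] := B1 e e0.
  rewrite (le_trans (ler_normB _ _))// normr1 ger0_norm ?mulr_ge0// /K mulrDl mul1r lerD//.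
  by rewrite mulrC ler_wpM2l.
- move=> e e0; have [b1 b2] := B1 e e0; rewrite ger0_norm ?mulr_ge0// /K mulrC.
  by apply: ler_pM => //; rewrite lerDl.
- by move=> e e0; rewrite /q; field; rewrite gt_eqF.
have E1 : \int[gauss2 s]_u ((@cabs2 R u * q - 1) ^+ 2) = 1.
  have [iS [iT eT] _ _] := st; rewrite -[LHS]eT.
  transitivity (\int[gauss2 s]_u (1 + (@cabs2 R u * q - 1))).
    by apply: eq_Rintegral => u _; field.
  have g1 := gauss2T s.
  rewrite RintegralD// ?Ew ?Rprob_cst ?addr0//.
  apply/integrableP; split; first exact/measurable_EFinP.
  rewrite (_ : (\int[_]_x _)%E = 1%E) ?ltry// -[RHS](prob_cst 1%E g1).
  by apply: eq_integral => u _ /=; rewrite normr1.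
rewrite E1 in st.
exists (fun u => 2 * @cabs2 R u / 2 * q / 1); eexists; exact: st.
Qed.

End RadialSteinClass.

(** * The kernel of the logarithm of an exponential variable *)

Section LogKernel.
Variable R : realType.
Notation RR := (measurableTypeR R).
Notation leb := (@lebesgue_measure R).
Notation E0 := (@exponential_pdf R 1).

Lemma exp1_pdfE (t : R) : 0 <= t -> E0 t = expR (- t).
Proof. by move=> t0; rewrite exponential_pdfE// mul1r mulN1r. Qed.

Lemma abs_ln_isqrt01 (t : R) : 0 < t -> t <= 1 -> `|ln t| <= 2 * isqrt01 t.
Proof.
move=> t0 t1; rewrite ler0_norm ?ln_le0// /isqrt01 indicE mem_set ?mulr1/=; last first.
  by rewrite in_itv /= t0 t1.
have := expR_ge1Dx (- ln t / 2); lra.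
Qed.

Lemma exp_tail : exists2 c : R, 0 <= c & forall t : R, 0 <= t ->
  (1 + t) * E0 t <= c * @exponential_pdf R (1/2) t.
Proof.
have h0 : (0 : R) < 1 / 2 by lra.
have [c c0 hc] := exp_dominates_pow 1 h0.
exists (2 * c); first by rewrite mulr_ge0.
move=> t t0; rewrite exp1_pdfE// exponential_pdfE// -[(2 * c) * _]mulrA (mulrC c).
rewrite [leRHS](_ : _ = c * expR (- (1/2) * t)); last by field.
have := hc t t0; rewrite expr1 => H.
apply: le_trans (ler_wpM2r (expR_ge0 _) H) _.
by rewrite -mulrA -expRD (_ : _ + _ = - (1/2) * t)//; field.
Qed.

Lemma integrable_isqrt01 : leb.-integrable setT (EFin \o (@isqrt01 R)).
Proof.
apply/integrableP; split; first by apply/measurable_EFinP; exact: measurable_isqrt01.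
apply: (@le_lt_trans _ _ 2%:E); last exact: ltry.
apply: le_trans (@integral_isqrt01 R); rewrite le_eqVlt; apply/orP; left; apply/eqP.
by apply: eq_integral => t _ /=; rewrite ger0_norm// isqrt01_ge0.
Qed.

Lemma integrable_ln_exp : leb.-integrable setT (fun t => (ln t * E0 t)%:E).
Proof.
have [c c0 hc] := exp_tail.
have h0 : (0 : R) < 1 / 2 by lra.
apply: (@le_integrable _ _ _ leb setT measurableT _
  (fun t => 2%:E * (@isqrt01 R t)%:E + c%:E * (@exponential_pdf R (1/2) t)%:E)%E).
- apply/measurable_EFinP/measurable_funM; first exact: measurable_ln.
  exact: measurable_exponential_pdf.
- move=> t _; rewrite /= lee_fin; apply: le_trans (ler_norm _).
  have A : 0 <= 2 * @isqrt01 R t by rewrite mulr_ge0// isqrt01_ge0.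
  have B : 0 <= c * @exponential_pdf R (1/2) t by rewrite mulr_ge0// exponential_pdf_ge0// ltW.
  rewrite normrM (ger0_norm (exponential_pdf_ge0 _ _))//.
  have [t0|t0] := leP t 0.
    by rewrite ln0// normr0 mul0r addr_ge0.
  have [t1|t1] := leP t 1.
    rewrite -[leLHS]addr0 lerD// (le_trans _ (abs_ln_isqrt01 t0 t1))//.
    by rewrite ler_piMr// exp1_pdfE ?(ltW t0)// -expR0 ler_expR oppr_le0 ltW.
  rewrite -[leLHS]add0r lerD// (le_trans _ (hc t (ltW t0)))//.
  rewrite ler_wpM2r ?exponential_pdf_ge0// ger0_norm ?ln_ge0 ?(ltW t1)//.
  by have := ln_le_sub1 t0; lra.
- apply: integrableD => //; first by apply: integrableZl => //; exact: integrable_isqrt01.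
  by apply: integrableZl => //; exact: integrable_exponential_pdf.
Qed.

(** Euler's constant, as the mean of -ln of an exponential variable of mean one, which is the law of
    |H|^2. *)
Definition mlog : R := \int[leb]_t (- (ln t * E0 t)).
Definition klog (t : R) : R := (- ln t - mlog) * E0 t.
(** For the required solution rho, (e rho exp(-e))' is [klog]. As [mlog] makes the total integral of
    [klog] vanish, this primitive decays at 0 and at infinity, which is what keeps rho of
    logarithmic growth. *)
Definition ulog (e : R) : R := \int[leb]_(t in `]-oo, e]) klog t.

Lemma integrable_klog : leb.-integrable setT (EFin \o klog).
Proof.
have := integrableB measurableT (integrableN integrable_ln_exp)
   (integrableZl measurableT mlog (integrable_exponential_pdf (@ltr01 R))).
move=> h; apply: (eq_integrable measurableT _ _ _ h) => t _.
by apply: (f_equal EFin); rewrite /klog; ring.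
Qed.

Lemma Rintegral_klog : \int[leb]_t klog t = 0.
Proof.
have E1 : \int[leb]_t E0 t = 1 by rewrite /Rintegral integral_exponential_pdf.
transitivity (\int[leb]_t (- (ln t * E0 t) - mlog * E0 t)).
  by apply: eq_Rintegral => t _; rewrite /klog; ring.
rewrite RintegralB//; last 2 first.
- by have := integrableN integrable_ln_exp; apply: eq_integrable.
- by have := integrableZl measurableT mlog (integrable_exponential_pdf (@ltr01 R)); apply: eq_integrable.
rewrite RintegralZl//; last exact: integrable_exponential_pdf.
by rewrite E1 mulr1 subrr.
Qed.

Lemma ulog_bound_set (e : R) (D : set RR) (g : R -> \bar R) : measurable D ->
  ulog e = (\int[leb]_(t in D) klog t) \/ ulog e = - (\int[leb]_(t in D) klog t) ->
  measurable_fun setT (g : RR -> \bar R) -> (forall t, 0 <= g t)%E ->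
  (forall t, D t -> `|klog t|%:E <= g t)%E -> (`|ulog e|%:E <= \int[leb]_t g t)%E.
Proof.
move=> mD ue mg g0 kg; have iK := integrableS measurableT mD (@subsetT _ _) integrable_klog.
have -> : `|ulog e| = `|\int[leb]_(t in D) klog t|.
  by case: ue => ->; rewrite ?normrN.
have h := le_abse_integral leb mD (measurable_int _ iK).
rewrite /Rintegral.
have fi := integrable_fin_num mD iK.
apply: (@le_trans _ _ (\int[leb]_(t in D) `|(klog t)%:E|)%E).
  by move: h; rewrite -{1}(fineK fi).
apply: (@le_trans _ _ (\int[leb]_(t in D) g t)%E).
  apply: ge0_le_integral => //.
  - apply: measurableT_comp => //; exact: measurable_int iK.
  - exact: measurable_funTS.
by rewrite integral_mkcond; apply: ge0_le_integralT => t; rewrite patchE; case: ifP.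
Qed.

Lemma ulog_tail (e : R) : ulog e = - \int[leb]_(t in `]e, +oo[) klog t.
Proof.
apply/eqP; rewrite -addr_eq0 -Rintegral_klog /ulog -Rintegral_setU//.
- by rewrite (_ : _ `|` _ = setT)//; apply/seteqP; split => // x _ /=; rewrite !in_itv /= andbT; case: (leP x e); [left|right].
- by apply: integrableS integrable_klog => //; exact: measurableU.
- apply/disj_setPS => x [] /=; rewrite !in_itv /= andbT => h1 h2.
  by move: (le_lt_trans h1 h2); rewrite ltxx.
Qed.

(** By [ulog_tail] only t > e matters. With t = e + r and e >= 1, t exp(-t) <= e exp(-e) (1 + r)
    exp(-r), and the last two factors are integrable in r. *)
Lemma ulog_large : exists2 A, 0 <= A & forall e, 1 <= e -> `|ulog e| <= A * (e * expR (- e)).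
Proof.
have [c c0 hc] := exp_tail.
have h0 : (0 : R) < 1 / 2 by lra.
exists ((1 + `|mlog|) * c); first by rewrite mulr_ge0// addr_ge0.
move=> e e1; have e0 := lt_le_trans ltr01 e1.
pose pf := @exponential_pdf R (1 / 2).
have pf0 t : 0 <= pf t by rewrite exponential_pdf_ge0// ltW.
have mpf : measurable_fun setT (pf : RR -> RR) by exact: measurable_exponential_pdf.
pose A := (1 + `|mlog|) * c * (e * expR (- e)).
have A0 : 0 <= A by rewrite !mulr_ge0 ?addr_ge0 ?expR_ge0// ltW.
have : (`|ulog e|%:E <= \int[leb]_t (A * pf (1 * t + - e))%:E)%E.
  apply: (@ulog_bound_set e `]e, +oo[) => //; first by right; exact: ulog_tail.
  - apply/measurable_EFinP/measurable_funM => //.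
    apply: (@measurableT_comp _ _ _ _ _ _ (pf : RR -> RR)) => //.
    by apply: measurable_funD => //; exact: measurable_funM.
  - by move=> t; rewrite lee_fin mulr_ge0.
  - move=> t /=; rewrite in_itv /= andbT lee_fin => et.
    have t0 := lt_trans e0 et; have t1 := ltW (le_lt_trans e1 et).
    rewrite /klog normrM (ger0_norm (exponential_pdf_ge0 _ _))//.
    apply: (@le_trans _ _ ((1 + `|mlog|) * (t * E0 t))).
      rewrite mulrA ler_wpM2r ?exponential_pdf_ge0// (le_trans (ler_normB _ _))//.
      rewrite normrN mulrDl mul1r lerD//.
        by rewrite ger0_norm ?ln_ge0// (le_trans (ln_le_sub1 t0))// lerBlDr lerDl.
      by rewrite ler_peMr.
    rewrite /A -!mulrA ler_wpM2l ?addr_ge0//.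
    have te : 0 <= 1 * t - e by rewrite mul1r subr_ge0 ltW.
    apply: (@le_trans _ _ (e * expR (- e) * ((1 + (1 * t - e)) * E0 (1 * t - e)))).
      rewrite !exp1_pdfE ?(ltW t0)// mul1r.
      rewrite [leRHS](_ : _ = e * (1 + (t - e)) * (expR (- e) * expR (- (t - e)))); last by ring.
      rewrite -expRD (_ : - e + - (t - e) = - t); last by ring.
      rewrite ler_wpM2r ?expR_ge0//.
      have : 0 <= (e - 1) * (t - e) by rewrite mulr_ge0 ?subr_ge0// ltW.
      lra.
    rewrite [leRHS](_ : _ = e * expR (- e) * (c * pf (1 * t - e))); last by ring.
    by rewrite ler_wpM2l ?hc// mulr_ge0 ?expR_ge0// ltW.
have E1 : (\int[leb]_t (A * pf (1 * t + - e))%:E = A%:E)%E.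
  have mg : measurable_fun setT (fun t : RR => (A * pf t)%:E).
    by apply/measurable_EFinP/measurable_funM.
  rewrite (leb_affine (- e) (@oner_neq0 R) mg); last by move=> t; rewrite lee_fin mulr_ge0.
  rewrite normr1 invr1 mul1e; under eq_integral do rewrite EFinM.
  rewrite ge0_integralZl//.
  - by rewrite integral_exponential_pdf// mule1.
  - exact/measurable_EFinP.
  - by move=> t _; rewrite lee_fin.
by rewrite E1 lee_fin.
Qed.

(** Substituting t = e x gives |ln t| <= |ln e| + |ln x|. On ]0, 1] one has |ln x| <= 2 x^(-1/2),
    whose integral is at most 4. *)
Lemma ulog_small (e : R) : 0 < e -> e <= 1 -> `|ulog e| <= e * (`|ln e| + `|mlog| + 4).
Proof.
move=> e0 e1.
pose A := `|ln e| + `|mlog|.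
pose g (t : R) := A * \1_(`[0, e]%classic : set R) t + 2 * @isqrt01 R (e^-1 * t + 0).
have A0 : 0 <= A by rewrite addr_ge0.
have m1 : measurable_fun setT (fun t : RR => @isqrt01 R (e^-1 * t + 0) : RR).
  apply: (measurableT_comp (@measurable_isqrt01 R)).
  by apply: measurable_funD => //; exact: measurable_funM.
have mI : measurable_fun setT (fun t : RR => (\1_(`[0, e]%classic : set R) t : RR)).
  exact: measurable_indic.
have : (`|ulog e|%:E <= \int[leb]_t (g t)%:E)%E.
  apply: (@ulog_bound_set e `]-oo, e]) => //; first by left.
  - apply/measurable_EFinP/measurable_funD; exact: measurable_funM.
  - by move=> t; rewrite lee_fin addr_ge0// mulr_ge0// isqrt01_ge0.
  - move=> t /=; rewrite in_itv /= lee_fin => te.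
    rewrite /klog; have [t0|t0] := ltP t 0.
      rewrite lt0_exponential_pdf// mulr0 normr0 addr_ge0// mulr_ge0// isqrt01_ge0.
      by [].
    rewrite normrM (ger0_norm (exponential_pdf_ge0 _ _))// /g indicE mem_set; last first.
      by rewrite /= in_itv /= t0 te.
    rewrite mulr1 exp1_pdfE//.
    apply: (@le_trans _ _ (`|ln t| + `|mlog|)).
      rewrite -[leRHS]mulr1; apply: ler_pM => //; rewrite ?expR_ge0//.
        by rewrite (le_trans (ler_normB _ _))// normrN.
      by rewrite -expR0 ler_expR oppr_le0.
    rewrite /A addrAC lerD2r.
    move: t0; rewrite le_eqVlt => /predU1P[<-|t0].
      by rewrite ln0// normr0 addr_ge0// mulr_ge0// isqrt01_ge0.
    have x0 : 0 < e^-1 * t + 0 by rewrite addr0 mulr_gt0// invr_gt0.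
    have x1 : e^-1 * t + 0 <= 1 by rewrite addr0 mulrC ler_pdivrMr// mul1r.
    apply: le_trans (lerD (lexx _) (abs_ln_isqrt01 x0 x1)).
    rewrite {1}(_ : t = e * (e^-1 * t + 0)); last by rewrite addr0 mulrA mulfV ?mul1r ?gt_eqF.
    by rewrite lnM ?posrE// ler_normD.
have E1 : (\int[leb]_t (g t)%:E <= (e * (A + 4))%:E)%E.
  rewrite /g; under eq_integral do rewrite EFinD.
  rewrite ge0_integralD//; last 4 first.
  - by move=> t _; rewrite lee_fin mulr_ge0.
  - by apply/measurable_EFinP/measurable_funM.
  - by move=> t _; rewrite lee_fin mulr_ge0// isqrt01_ge0.
  - by apply/measurable_EFinP/measurable_funM.
  rewrite mulrDr EFinD; apply: leeD.
    under eq_integral do rewrite EFinM.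
    rewrite ge0_integralZl//; last by apply/measurable_EFinP.
    have I1 : (\int[leb]_x (\1_(`[0, e]%classic : set R) x)%:E = e%:E)%E.
      apply: (etrans (integral_indic leb measurableT _)); first exact: measurable_itv.
      rewrite setIT; apply: (etrans (lebesgue_measure_itv `[0, e]%R)).
      by rewrite /= lte_fin e0 -EFinD subr0.
    by rewrite I1 -EFinM mulrC.
  have mg : measurable_fun setT (fun t : RR => (2 * @isqrt01 R t)%:E).
    by apply/measurable_EFinP/measurable_funM => //; exact: measurable_isqrt01.
  have ei0 : e^-1 != 0 by rewrite invr_eq0 gt_eqF.
  rewrite (leb_affine 0 ei0 mg); last by move=> t; rewrite lee_fin mulr_ge0// isqrt01_ge0.
  rewrite ger0_norm ?invr_ge0 ?(ltW e0)// invrK.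
  under eq_integral do rewrite EFinM.
  rewrite ge0_integralZl//; last 2 first.
  - by apply/measurable_EFinP; exact: measurable_isqrt01.
  - by move=> t _; rewrite lee_fin isqrt01_ge0.
  rewrite EFinM; apply: lee_wpmul2l; first by rewrite lee_fin ltW.
  rewrite (_ : 4 = 2 * 2)%R; last by ring.
  by rewrite EFinM; apply: lee_wpmul2l => //; exact: integral_isqrt01.
by move=> h; rewrite -lee_fin; apply: le_trans h E1.
Qed.

Lemma klog_continuous (e : R) : 0 < e -> {for e, continuous klog}.
Proof.
move=> e0; apply: cvgM.
  by apply: cvgB; [apply: cvgN; exact: continuous_ln|exact: cvg_cst].
by apply: in_continuous_exponential_pdf; rewrite in_itv /= e0.
Qed.

Lemma is_derive_ulog (e : R) : 0 < e -> is_derive e 1 ulog (klog e).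
Proof.
move=> e0; have e1 : e < e + 1 by rewrite ltrDl.
have iK : leb.-integrable [set` Interval -oo%O (BRight (e + 1))] (EFin \o klog).
  exact: integrableS integrable_klog.
have [d1 d2] := continuous_FTC1 e1 iK (ltNyr _) (klog_continuous e0).
by apply: DeriveDef; [exact: d1|rewrite -derive1E; exact: d2].
Qed.

Lemma measurable_ulog : measurable_fun setT (ulog : RR -> RR).
Proof.
have -> : [set: RR] = `]-oo, 0[ `|` ([set 0] `|` `]0, +oo[).
  apply/seteqP; split => // x _ /=; rewrite !in_itv /= andbT.
  by case: (ltgtP x 0); [left|right;right|right;left].
apply/measurable_funU => //; first exact: measurableU.
split; last first.
  apply/measurable_funU => //; split; first exact: measurable_fun_set1.
  apply: open_continuous_measurable_fun; first exact: interval_open.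
  move=> x; rewrite inE /= in_itv /= andbT => x0.
  exact: is_derive1_continuous (is_derive_ulog x0).
apply: (@eq_measurable_fun _ _ _ _ _ (fun=> 0 : RR)); last exact: measurable_cst.
move=> e; rewrite inE /= in_itv /= => e0; rewrite /ulog /Rintegral integral0_eq// => t /=.
rewrite in_itv /= => te; rewrite /klog lt0_exponential_pdf ?mulr0//.
exact: le_lt_trans te e0.
Qed.

(* The solution of the differential equation in [radial_stein] for the weight
   [- ln e - mlog], with [s^2 = 1/2] and [kappa = -2]. *)
Definition rlog (e : R) : R := expR e * ulog e * e^-1.

(** The factor 1 / e is compensated near 0 by [ulog_small], and exp(e) at infinity by [ulog_large].
    The bound on e rho is what the estimate of e rho' consumes. *)
Lemma rlog_bound : exists2 A, 0 <= A & forall e, 0 <= e ->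
  `|rlog e| <= A * logB e /\ `|e * rlog e| <= A * logB e.
Proof.
have [A1 A10 hA1] := ulog_large.
pose A2 := expR 1 * (`|mlog| + 4).
have A20 : 0 <= A2 by rewrite mulr_ge0 ?expR_ge0// addr_ge0.
exists (A1 + A2); first by rewrite addr_ge0.
move=> e; rewrite le_eqVlt => /predU1P[<-|e0].
  by rewrite mul0r /rlog invr0 mulr0 normr0 mulr_ge0 ?addr_ge0.
have b1 := logB_ge1 (ltW e0).
have le1 : e <= logB e by rewrite /logB; have := normr_ge0 (ln e); lra.
have ll1 : 1 + `|ln e| <= logB e by rewrite /logB; have := ltW e0; lra.
have bs0 : 0 <= logB e by rewrite (le_trans ler01).
have E : `|rlog e| = expR e * (`|ulog e| * e^-1).
  have ei0 : 0 <= e^-1 by rewrite invr_ge0 ltW.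
  by rewrite /rlog !normrM (ger0_norm (expR_ge0 _)) (ger0_norm ei0) mulrA.
have [e1|e1] := leP e 1.
  have h : `|rlog e| <= A2 * logB e.
    rewrite E /A2 -mulrA; apply: ler_pM; rewrite ?expR_ge0 ?ler_expR//.
      by rewrite mulr_ge0// invr_ge0 ltW.
    rewrite ler_pdivrMr// mulrC (le_trans (ulog_small e0 e1))// ler_wpM2l ?(ltW e0)//.
    have : 0 <= (`|mlog| + 3) * (logB e - 1) by rewrite mulr_ge0 ?subr_ge0// addr_ge0.
    lra.
  have h2 : `|rlog e| <= (A1 + A2) * logB e.
    by rewrite mulrDl -[leLHS]add0r lerD// mulr_ge0.
  split => //; rewrite normrM (ger0_norm (ltW e0)) (le_trans _ h2)//.
  by rewrite ler_piMl.
have h : `|rlog e| <= A1.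
  rewrite E mulrA ler_pdivrMr// (le_trans (ler_wpM2l (expR_ge0 _) (hA1 _ (ltW e1))))//.
  rewrite [leLHS](_ : _ = A1 * e * (expR e * expR (- e))); last by ring.
  by rewrite -expRD subrr expR0 mulr1.
split.
  rewrite (le_trans h)// mulrDl -[leLHS]addr0 lerD ?ler_peMr//.
  by rewrite mulr_ge0.
rewrite normrM (ger0_norm (ltW e0)) mulrDl -[leLHS]addr0 lerD//.
  by rewrite mulrC; apply: ler_pM => //; rewrite ltW.
by rewrite mulr_ge0.
Qed.

Lemma measurable_inv : measurable_fun setT ((fun x : R => x^-1) : RR -> RR).
Proof.
rewrite (_ : (fun x => _) = (fun x : R => x * expR (- ln (x ^+ 2)))).
  apply: measurable_funM => //; apply: measurableT_comp => //; apply: measurableT_comp => //.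
  by apply: measurableT_comp => //; exact: measurable_funX.
apply/funext => x; have [->|x0] := eqVneq x 0; first by rewrite invr0 mul0r.
have x2 : 0 < x ^+ 2 by rewrite exprn_even_gt0.
by rewrite expRN lnK ?posrE//; field.
Qed.

Notation C := (RR * RR)%type.

(** Here s^2 = 1/2 per real part, that is CN(0, 1). The vanishing mean is what identifies [mlog],
    defined by a one-dimensional integral, with E(-ln|H|^2); it comes out of the integration by
    parts, without polar coordinates. *)
Lemma log_stein :
  let s := Num.sqrt (1 / 2) : R in
  let w (u : C) := - ln (@cabs2 R u) - mlog in
  let a := \int[gauss2 s]_u (w u ^+ 2) in
  exists tau v, [/\ stein (gauss2 s) w tau a v, \int[gauss2 s]_u w u = 0 &
     (gauss2 s).-integrable setT (fun u : C => (w u ^+ 2)%:E)].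
Proof.
move=> s w a; have h0 : (0 : R) < 1 / 2 by lra.
have s0 : 0 < s by rewrite sqrtr_gt0.
have s2 : s ^+ 2 = 1 / 2 by rewrite sqr_sqrtr// ltW.
have [A A0 hA] := rlog_bound.
pose W (e : R) := - ln e - mlog.
(* Read off (e rho)' = e rho + W, the equation that [rlog] solves. *)
pose rho1 (e : R) := rlog e + W e * e^-1 - rlog e * e^-1.
pose K := 2 * A + 1 + `|mlog|.
have bW (e : R) : 0 <= e -> `|W e| <= (1 + `|mlog|) * logB e.
  move=> e0; have b1 := logB_ge1 e0.
  rewrite (le_trans (ler_normB _ _))// normrN mulrDl mul1r lerD//.
    by rewrite /logB; lra.
  by rewrite ler_peMr.
have Kb (e : R) : 0 <= e -> 0 <= A * logB e /\ 0 <= (1 + `|mlog|) * logB e.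
  move=> e0; have b0 := le_trans ler01 (logB_ge1 e0).
  by split; rewrite mulr_ge0// addr_ge0.
have dV (e : R) : 0 < e -> is_derive e 1 (fun x : R => x^-1) (- e^-2).
  move=> e0; have := @is_deriveV R id e 1 1 (lt0r_neq0 e0) (is_derive1_id e).
  by move=> d; apply: (is_derive_eq d); rewrite scaler1// /GRing.scale /= mulr1.
have dW (e : R) : 0 < e -> is_derive e 1 W (- e^-1).
  move=> e0; apply: (is_derive_eq (is_derive1D (is_derive1N (is_derive1_ln e0)) (is_derive1_cst (- mlog) e))).
  by rewrite addr0.
have dr (e : R) : 0 < e -> is_derive e 1 rlog (rho1 e).
  move=> e0.
  have d1 := is_derive1M (is_derive1M (is_derive_expR e) (is_derive_ulog e0)) (dV _ e0).
  apply: (is_derive_eq d1); rewrite /rho1 /W /rlog /klog exp1_pdfE ?ltW// expRN.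
  by field; rewrite !gt_eqF ?expR_gt0.
have cV (e : R) : 0 < e -> {for e, continuous (fun x : R => x^-1)}.
  by move=> e0; exact: is_derive1_continuous (dV _ e0).
have mW : measurable_fun setT (W : RR -> RR).
  by apply: measurable_funB => //; apply: measurableT_comp.
have mV := measurable_inv.
have mr : measurable_fun setT (rlog : RR -> RR).
  apply: measurable_funM => //; apply: measurable_funM; last exact: measurable_ulog.
  exact: measurable_expR.
have [||||||||||||st Ew iw2] := @radial_stein R s (- 2) K rlog rho1 W (fun e => - e^-1) s0 _ _ _ _ _ dr dW.
- by rewrite oppr_eq0.
- exact: mr.
- by apply: measurable_funB; [apply: measurable_funD => //|]; apply: measurable_funM.
- exact: mW.
- by apply: measurableT_comp.
- move=> e e0; apply: cvgB; [apply: cvgD|].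
  + exact: is_derive1_continuous (dr _ e0).
  + by apply: cvgM; [exact: is_derive1_continuous (dW _ e0)|exact: cV].
  + by apply: cvgM; [exact: is_derive1_continuous (dr _ e0)|exact: cV].
- by move=> e e0; apply: cvgN; exact: cV.
- by move=> e e0; rewrite (le_trans (hA e e0).1)// /K; have := Kb e e0; lra.
- move=> e; rewrite le_eqVlt => /predU1P[<-|e0].
    by rewrite mul0r normr0; have := Kb 0 (lexx 0); rewrite /K; lra.
  have -> : e * rho1 e = e * rlog e + W e - rlog e by rewrite /rho1; field; rewrite gt_eqF.
  have [h1 h2] := hA e (ltW e0); have h3 := bW e (ltW e0).
  rewrite (le_trans (ler_normB _ _))//.
  have := ler_normD (e * rlog e) (W e); rewrite /K; lra.
- by move=> e e0; rewrite (le_trans (bW e e0))// /K; have := Kb e e0; lra.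
- move=> e; rewrite le_eqVlt => /predU1P[<-|e0].
    by rewrite mul0r normr0; have := Kb 0 (lexx 0); rewrite /K; lra.
  rewrite mulrN mulfV ?gt_eqF// normrN1; have := Kb e (ltW e0); have := logB_ge1 (ltW e0).
  have := normr_ge0 mlog; rewrite /K => m0 b1 [b2 b3].
  have : 0 <= `|mlog| * logB e by rewrite mulr_ge0// (le_trans ler01).
  lra.
- move=> e e0; rewrite s2 /rho1; field; rewrite gt_eqF//.
by do 2 eexists; split; [exact: st|exact: Ew|exact: iw2].
Qed.

End LogKernel.

(** * The capacity and dispersion constants *)

Section SignedGaussianExpectation.
Variable R : realType.
Notation RR := (measurableTypeR R).
Notation C := (RR * RR)%type.
Notation leb := (@lebesgue_measure R).

Lemma leb_eq_integral_except (a : R) (H G : RR -> \bar R) : measurable_fun setT G ->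
  (forall x : R, x != a -> H x = G x) -> (\int[leb]_x H x = \int[leb]_x G x)%E.
Proof.
move=> mG HG; apply: ae_eq_integral => //.
- have -> : [set: RR] = [set (a : RR)] `|` ~` [set (a : RR)].
    by apply/seteqP; split => // x _; exact: EM.
  apply/measurable_funU => //; first exact: measurableC.
  split; first exact: measurable_fun_set1.
  apply: (@eq_measurable_fun _ _ _ _ _ G); last exact: measurable_funTS.
  by move=> x; rewrite inE /= => /eqP xa; rewrite HG.
- exists [set (a : RR)]; split => //; first exact: lebesgue_measure_set1.
  move=> x /=; apply: contra_notP => xa _; apply: HG; exact/eqP.
Qed.

Lemma normal_integral_signed (s : R) (f : RR -> \bar R) : measurable_fun setT f ->
  (\int[leb]_x ((normal_pdf 0 s x)%:E * f x) = \int[normal_prob 0 s]_x f x)%E.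
Proof.
move=> mf; apply/esym; apply: (@integral_density _ _ R (normal_prob 0 s) leb) => //.
- exact: normal_pdf_ge0.
- exact: measurable_normal_pdf.
Qed.

(** [gexpE] is for nonnegative integrands, whereas ln det is signed, so the iterated integral is
    matched with Fubini one complex variable at a time. Excluding x = 0 avoids a vanishing
    determinant, where ln of the product is not the sum of the ln. *)
Lemma gexp_cons_signed (T : eqType) (k : T) (ks : seq T) (s : R)
    (f : (T -> R * R) -> \bar R) (F : C -> R) :
  (gauss2 s).-integrable setT (EFin \o F) ->
  (forall x y : R, x != 0 ->
    gexp ks s (fun g => f (fun j => if j == k then (x, y) else g j)) = (F (x, y))%:E) ->
  gexp (k :: ks) s f = (\int[gauss2 s]_u F u)%:E.
Proof.
move=> iF fF /=; have mF := measurable_int _ iF.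
pose G (x : RR) := (\int[normal_prob 0 s]_y (F (x, y))%:E)%E.
have mG : measurable_fun setT G.
  exact: (measurable_fubini_F iF).
transitivity (\int[leb]_x ((normal_pdf 0 s x)%:E * G x))%E.
  apply: (@leb_eq_integral_except 0).
    apply: emeasurable_funM => //; apply/measurable_EFinP; exact: measurable_normal_pdf.
  move=> x x0; congr (_ * _)%E.
  under eq_integral => y _ do rewrite fF//.
  apply: (@normal_integral_signed s (fun y => (F (x, y))%:E)).
  exact: (measurable_fun_pair2 x mF).
rewrite normal_integral_signed// /G.
have := integral12_prod_meas1 iF => ->.
rewrite /Rintegral fineK//; exact: (integrable_fin_num measurableT iF).
Qed.

(** The constant [c] accumulates the coordinates already integrated by the recursion of [gexp]. The
    same device computes the variance in [gexp_sqr_signed], where the term linear in [phi] drops out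
    because [phi] is centred. *)
Lemma gexp_sum_signed (T : eqType) (ks : seq T) (s c : R) (phi : C -> R)
    (f : (T -> R * R) -> \bar R) : uniq ks ->
  (gauss2 s).-integrable setT (EFin \o phi) ->
  (forall g : T -> R * R, (forall k, k \in ks -> (g k).1 != 0) ->
     f g = (c + \sum_(k <- ks) phi (g k))%:E) ->
  gexp ks s f = (c + (size ks)%:R * (\int[gauss2 s]_u phi u))%:E.
Proof.
move=> + iphi; elim: ks c f => [|k ks IH] c f uks fE.
  by rewrite /= mul0r addr0 fE// big_nil addr0.
have /andP[kks uks'] := uks.
have g1 := gauss2T s.
have ic : (gauss2 s).-integrable setT (EFin \o (fun u : C => c + (size ks)%:R * (\int[gauss2 s]_u phi u))).
  apply/integrableP; split; first exact: measurable_cst.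
  by rewrite (prob_cst _ g1) /= ltry.
rewrite (@gexp_cons_signed _ _ _ _ _ (fun u : C => (c + (size ks)%:R * (\int[gauss2 s]_u phi u)) + phi u)).
- rewrite RintegralD// (Rprob_cst _ g1) -[in RHS]natr1; congr EFin; ring.
- by have := integrableD measurableT ic iphi; apply: eq_integrable.
- move=> x y x0; rewrite (IH (c + phi (x, y)))//; first by congr EFin; ring.
  move=> g gks; rewrite fE.
    rewrite big_cons eqxx addrA; congr (_ + _)%:E.
    by apply: eq_big_seq => j jks; case: eqP => // jk; move: kks; rewrite -jk jks.
  move=> j; rewrite inE => /orP[->//|jks]; case: ifP => // _; exact: gks.
Qed.

Lemma gexp_sqr_signed (T : eqType) (ks : seq T) (s c : R) (phi : C -> R)
    (f : (T -> R * R) -> \bar R) : uniq ks ->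
  measurable_fun setT phi ->
  (gauss2 s).-integrable setT (fun u => (phi u ^+ 2)%:E) ->
  \int[gauss2 s]_u phi u = 0 ->
  (forall g : T -> R * R, (forall k, k \in ks -> (g k).1 != 0) ->
     f g = ((c + \sum_(k <- ks) phi (g k)) ^+ 2)%:E) ->
  gexp ks s f = (c ^+ 2 + (size ks)%:R * (\int[gauss2 s]_u (phi u) ^+ 2))%:E.
Proof.
move=> + mphi iphi2 phi0; have g1 := gauss2T s.
have iphi := integrable_sqr_int g1 mphi iphi2.
elim: ks c f => [|k ks IH] c f uks fE.
  by rewrite /= mul0r addr0 fE// big_nil addr0.
have /andP[kks uks'] := uks.
set a := \int[gauss2 s]_u _ in IH *.
have ic : (gauss2 s).-integrable setT (EFin \o (fun u : C => c ^+ 2 + (size ks)%:R * a)).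
  apply/integrableP; split; first exact: measurable_cst.
  by rewrite (prob_cst _ g1) /= ltry.
have il : (gauss2 s).-integrable setT (EFin \o (fun u : C => (2 * c) * phi u)).
  by have := integrableZl measurableT (2 * c) iphi; apply: eq_integrable.
have il2 : (gauss2 s).-integrable setT (EFin \o (fun u : C => (2 * c) * phi u + phi u ^+ 2)).
  by have := integrableD measurableT il iphi2; apply: eq_integrable.
rewrite (@gexp_cons_signed _ _ _ _ _ (fun u : C => (c ^+ 2 + (size ks)%:R * a) + ((2 * c) * phi u + phi u ^+ 2))).
- rewrite (RintegralD measurableT ic il2) (RintegralD measurableT il iphi2) (RintegralZl _ measurableT iphi) phi0 (Rprob_cst _ g1) -[in RHS]natr1 -/a; congr EFin; ring.
- by have := integrableD measurableT ic il2; apply: eq_integrable.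
- move=> x y x0; rewrite (IH (c + phi (x, y)))//; first by congr EFin; ring.
  move=> g gks; rewrite fE.
    rewrite big_cons eqxx addrA; congr ((_ + _) ^+ 2)%:E.
    by apply: eq_big_seq => j jks; case: eqP => // jk; move: kks; rewrite -jk jks.
  move=> j; rewrite inE => /orP[->//|jks]; case: ifP => // _; exact: gks.
Qed.

Lemma cabs2_gt0 (u : R * R) : u.1 != 0 -> 0 < cabs2 u.
Proof. by move=> u0; rewrite /cabs2 ltr_pwDl ?sqr_ge0 ?exprn_even_gt0. Qed.

Lemma ln_detHH (L : nat) (c : R) (h : 'I_L -> R * R) : 0 < c ->
  (forall l, (h l).1 != 0) ->
  ln (detHH c h) = - (L%:R * ln c) + \sum_(l < L) ln (cabs2 (h l)).
Proof.
move=> c0 h0; have p0 (l : 'I_L) : 0 < cabs2 (h l) by exact: cabs2_gt0.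
have gen (I : seq 'I_L) : 0 < \prod_(l <- I) (cabs2 (h l) / c) /\
    ln (\prod_(l <- I) (cabs2 (h l) / c)) = - ((size I)%:R * ln c) + \sum_(l <- I) ln (cabs2 (h l)).
  elim: I => [|l I [I0 IH]]; first by rewrite !big_nil ln1 mul0r oppr0 addr0.
  rewrite !big_cons; split; first by rewrite mulr_gt0// divr_gt0.
  rewrite lnM ?posrE ?divr_gt0// IH ln_div ?posrE//= -natr1; ring.
by rewrite /detHH -!big_enum (gen _).2 size_enum_ord.
Qed.

(** The variance of ln|H|^2, since its mean is - [mlog] by [log_stein]; it is also the mean of the
    kernel found there. *)
Definition vlog : R := \int[gauss2 (Num.sqrt (1 / 2))]_u ((- ln (@cabs2 R u) - mlog R) ^+ 2).

Lemma vlog_ge0 : 0 <= vlog.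
Proof. by apply: fine_ge0; apply: integral_ge0 => u _; rewrite lee_fin sqr_ge0. Qed.

Lemma integrable_wlog : (gauss2 (Num.sqrt (1 / 2))).-integrable setT
    (EFin \o (fun u : C => - ln (@cabs2 R u) - mlog R)).
Proof. by have [tau [v [[iS _ _ _] _ _]]] := log_stein R. Qed.

Lemma CNexp_ln_detHH (L : nat) (c : R) : 0 < c ->
  @CNexp R 'I_L 1 (fun h => (ln (detHH c h))%:E) = (- L%:R * (ln c + mlog R))%:E.
Proof.
move=> c0; have [tau [v [_ E0 _]]] := log_stein R.
pose phi (u : C) := - (- ln (@cabs2 R u) - mlog R).
have iphi : (gauss2 (Num.sqrt (1 / 2))).-integrable setT (EFin \o phi).
  by have := integrableN integrable_wlog; apply: eq_integrable.
rewrite /CNexp (@gexp_sum_signed _ _ _ (- L%:R * (ln c + mlog R)) phi)//; last 2 first.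
- exact: enum_uniq.
- move=> h h0; rewrite ln_detHH//; last by move=> l; apply: h0; rewrite mem_enum.
  rewrite big_enum /phi /=; congr EFin.
  under [in RHS]eq_bigr do rewrite opprB.
  rewrite big_split /= sumr_const card_ord.
  under [X in _ + (_ + X)]eq_bigr do rewrite opprK.
  by rewrite -mulr_natl; ring.
have -> : \int[gauss2 (Num.sqrt (1 / 2))]_u phi u = 0.
  rewrite -[RHS]oppr0 -E0 -mulN1r -RintegralZl//; last exact: integrable_wlog.
  by apply: eq_Rintegral => u _; rewrite mulN1r.
by rewrite mulr0 addr0.
Qed.

Lemma delta_starE (sigma2 : R) (L : nat) : 0 < sigma2 ->
  delta_star sigma2 L = - L%:R * (ln (pi * expR 1 * sigma2) + mlog R).
Proof.
by move=> s0; rewrite /delta_star CNexp_ln_detHH//= !mulr_gt0 ?pi_gt0 ?expR_gt0.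
Qed.

Lemma V_dispE (L : nat) : V_disp R L = L%:R * (1 + vlog).
Proof.
have [tau [v [_ E0 i2]]] := log_stein R.
rewrite /V_disp CNexp_ln_detHH//= ln1 add0r /CNexp.
rewrite (@gexp_sqr_signed _ _ _ 0 (fun u : C => - ln (@cabs2 R u) - mlog R))//.
- by rewrite /= expr0n /= add0r size_enum_ord -/vlog; ring.
- exact: enum_uniq.
- apply/measurable_EFinP; exact: measurable_int integrable_wlog.
- move=> h h0; rewrite ln_detHH//; last by move=> l; apply: h0; rewrite mem_enum.
  rewrite big_enum /= ln1 mulr0 oppr0 !add0r big_split /= sumr_const card_ord.
  by rewrite sumrN -mulr_natl -sqrrN; congr (_ ^+ 2)%:E; ring.
Qed.

End SignedGaussianExpectation.

(** * Quantiles and the information density *)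

Section QuantileExpansion.
Variable R : realType.
Notation RR := (measurableTypeR R).
Notation C := (RR * RR)%type.
Notation leb := (@lebesgue_measure R).
Notation phi := (@normal_pdf R 0 1).

Lemma phi_ge (M u : R) : `|u| <= M -> phi M <= phi u.
Proof.
move=> uM; rewrite !phiE ler_wpM2l ?(ltW (peak1_gt0 R))// ler_expR lerN2 ler_wpM2r ?invr_ge0//.
rewrite -(real_normK (num_real u)); apply: lerXn2r; rewrite ?nnegrE//.
exact: le_trans uM.
Qed.

Lemma Qfun_slope (M x y : R) : x <= y -> `|x| <= M -> `|y| <= M ->
  phi M * (y - x) <= Qfun x - Qfun y.
Proof.
rewrite !ler_norml => xy /andP[x1 x2] /andP[y1 y2]; rewrite Qfun_sub//.
apply: (@le_trans _ _ (\int[leb]_(u in `]x, y]) (cst (phi M) u : R))).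
  rewrite Rintegral_cst//= lebesgue_measure_itv /= lte_fin.
  by case: (ltP x y) => //= yx; rewrite mulr0 pmulr_rle0 ?phi_gt0// subr_le0.
apply: le_Rintegral => //.
- apply/integrableP; split; first exact/measurable_EFinP/measurable_cst.
  rewrite (eq_integral (cst (phi M)%:E)) => [|u _ /=]; last by rewrite ger0_norm ?ltW ?phi_gt0.
  rewrite integral_cst//= lebesgue_measure_itv /=.
  by case: ifP => _; rewrite -?EFinB ?mule0 ?ltry// -EFinM ltry.
- exact: integrable_phi.
- move=> u; rewrite /= in_itv /= => /andP[u1 u2]; apply: phi_ge.
  by rewrite ler_norml; lra.
Qed.

Lemma Qfun_le_inv (x : R) : 0 < x -> Qfun x <= x^-1.
Proof.
move=> x0; rewrite Qfun_phi Rintegral_itv_obnd_cbnd; last exact: integrable_phi.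
apply: le_trans (mills_r x0) _; rewrite -[leRHS]mul1r ler_wpM2r ?invr_ge0 ?(ltW x0)//.
exact: phi_le1.
Qed.

Lemma Qfun_ge_inv (x : R) : x < 0 -> 1 - (- x)^-1 <= Qfun x.
Proof.
move=> x0; have h : Qfun x = 1 - \int[leb]_(u in `]-oo, x]) phi u.
  have e1 := Rintegral_phi R.
  rewrite (_ : [set: RR] = `]-oo, x] `|` `]x, +oo[) in e1; last first.
    by apply/seteqP; split => // u _ /=; rewrite !in_itv /= andbT; case: (leP u x); [left|right].
  rewrite Rintegral_setU in e1; [|exact: measurable_itv|exact: measurable_itv| |].
  - by rewrite Qfun_phi -[X in X - _]e1 addrAC subrr add0r.
  - by apply: integrable_phi; apply: measurableU; exact: measurable_itv.
  - apply/disj_setPS => u [] /=; rewrite !in_itv /= andbT => h1 h2.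
    by move: (le_lt_trans h1 h2); rewrite ltxx.
rewrite h lerD2l lerN2; apply: le_trans (mills_l x0) _.
by rewrite -[leRHS]mul1r ler_wpM2r ?phi_le1// invr_ge0 oppr_ge0 ltW.
Qed.

(** The Mills bounds make the set defining [Qinv] nonempty and bounded below; as [Qfun] is
    1-Lipschitz, its value at the infimum differs from [e] by less than any positive d. *)
Lemma Qfun_Qinv (e : R) : 0 < e -> e < 1 -> Qfun (Qinv e) = e.
Proof.
move=> e0 e1; set A := [set x | Qfun x <= e].
have A0 : A !=set0.
  exists e^-1; rewrite /A /=; apply: le_trans (Qfun_le_inv _) _; rewrite ?invrK ?invr_gt0//.
have iA : has_inf A.
  split => //; exists (- (2 / (1 - e))) => x Ax; rewrite leNgt; apply/negP => xl.
  have e1' : 0 < 1 - e by rewrite subr_gt0.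
  have x0 : x < 0 by rewrite (lt_trans xl)// oppr_lt0 divr_gt0.
  have := le_trans (Qfun_ge_inv x0) Ax.
  have : (- x)^-1 < (2 / (1 - e))^-1.
    by rewrite ltf_pV2 ?posrE ?divr_gt0 ?oppr_gt0// ltrNr.
  rewrite invf_div; lra.
apply/eqP; rewrite eq_le /Qinv -/A; apply/andP; split; apply/ler_addgt0Pr => d d0.
  have [y Ay yd] := inf_adherent d0 iA.
  have yi : inf A <= y by apply: ge_inf => //; exact: iA.2.
  by apply: le_trans (Qfun_lipschitz yi) _; rewrite lerD// lerBlDl ltW.
have h : e < Qfun (inf A - d).
  rewrite ltNge; apply/negP => hd; have := ge_inf iA.2 hd.
  by rewrite lerBrDr gerDl leNgt d0.
apply: ltW; apply: lt_le_trans h _.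
have := @Qfun_lipschitz R (inf A - d) (inf A).
by rewrite subKr; apply; rewrite gerBl ltW.
Qed.

(** The constant [c] is the Gaussian density at |x| + 1, a lower bound for the slope of -Q within
    distance one of the quantile x. The condition eta < c keeps the displacement eta / c inside that
    window. *)
Lemma Qinv_expansion (e : R) : 0 < e -> e < 1 -> exists2 c : R, 0 < c &
  forall eta, 0 <= eta -> eta < c ->
    (forall t, Qfun t <= e + eta -> Qinv e - eta / c <= t) /\
    Qfun (Qinv e + eta / c) <= e - eta.
Proof.
move=> e0 e1; have Qx := Qfun_Qinv e0 e1; set x := Qinv e in Qx *.
pose M := `|x| + 1; pose c := phi M; have c0 : 0 < c := phi_gt0 M.
have xM : `|x| <= M by rewrite lerDl.
exists c => // eta eta0 etac; split => [t tQ|].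
  rewrite lerBlDl; have [xt|tx] := leP x t.
    by rewrite (le_trans xt)// lerDr divr_ge0// ltW.
  have [t1|t1] := leP (x - 1) t.
    have tM : `|t| <= M.
      rewrite (_ : t = x + (t - x)); last by ring.
      by rewrite (le_trans (ler_normD _ _))// lerD2l ler_norml; lra.
    have := Qfun_slope (ltW tx) tM xM; rewrite -/c Qx => h.
    rewrite -lerBlDr ler_pdivlMr// mulrC; lra.
  (* Below the window Q(t) >= Q(x - 1) >= e + c, which exceeds e + eta. *)
  have xM1 : `|x - 1| <= M by rewrite (le_trans (ler_normB _ _))// normr1.
  have h1 : x - 1 <= x by rewrite gerBl.
  have := Qfun_slope h1 xM1 xM; rewrite -/c Qx => h.
  have := Qfun_decr (ltW t1); lra.
have ec : 0 <= eta / c <= 1 by rewrite divr_ge0 ?(ltW c0)//= ler_pdivrMr// mul1r ltW.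
have yM : `|x + eta / c| <= M.
  by rewrite (le_trans (ler_normD _ _))// lerD2l ger0_norm; case/andP: ec.
have h1 : x <= x + eta / c by rewrite lerDl; case/andP: ec.
have := Qfun_slope h1 xM yM; rewrite -/c Qx addrAC subrr add0r.
rewrite mulrC divfK ?gt_eqF//; lra.
Qed.

End QuantileExpansion.

Section InformationDensity.
Variable R : realType.
Notation RR := (measurableTypeR R).
Notation C := (RR * RR)%type.
Variables (s : R) (T : finType).
Hypothesis s0 : 0 < s.
Notation ks := (enum T).
Notation sh := (Num.sqrt (1 / 2) : R).
Notation muh := (towm (gauss2 sh) ks).
Notation muz := (towm (gauss2 s) ks).

Definition infd (x : tow R ks * tow R ks) : R :=
  \sum_(k <- ks) (- ln (cabs2 (ev x.1 k)) - mlog R) +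
  \sum_(k <- ks) (cabs2 (ev x.2 k) / (2 * s ^+ 2) - 1).

Definition joint : {sigma_finite_measure set (tow R ks * tow R ks)%type -> \bar R} :=
  sprod muh muz.

Lemma jointT : joint setT = 1%E.
Proof.
have h1 := @towmT R T (gauss2 sh) ks (gauss2T sh).
have h2 := @towmT R T (gauss2 s) ks (gauss2T s).
rewrite -setXTT; apply: (etrans (product_measure1E _ _ measurableT measurableT)).
by apply: (etrans (f_equal2 *%E h1 h2)); rewrite mule1.
Qed.

Lemma measurable_infd : measurable_fun setT infd.
Proof.
apply: measurable_funD.
  apply: (@measurableT_comp _ _ _ _ _ _ (fun x : tow R ks => \sum_(k <- ks) (- ln (cabs2 (ev x k)) - mlog R) : RR)) => //.
  apply: measurable_sum => k; apply: measurable_funB => //.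
  apply: measurableT_comp => //; apply: measurableT_comp => //.
  exact: (measurableT_comp (@measurable_cabs2 R) (measurable_ev k)).
apply: (@measurableT_comp _ _ _ _ _ _ (fun x : tow R ks => \sum_(k <- ks) (cabs2 (ev x k) / (2 * s ^+ 2) - 1) : RR)) => //.
apply: measurable_sum => k; apply: measurable_funB => //; apply: measurable_funM => //.
exact: (measurableT_comp (@measurable_cabs2 R) (measurable_ev k)).
Qed.

End InformationDensity.

(** The kernel of [infd] is the sum of the kernels of all fading and noise coordinates. Its mean is
    n V, the variance of [infd], and its own variance is also proportional to n. *)
Lemma infd_berry_esseen (R : realType) (s : R) (L : nat) : 0 < s -> (0 < L)%N ->
  exists2 B : R, 0 <= B & forall (n : nat) (t : R), (0 < n)%N ->
  `|fine (joint s (idx n L) [set x | t * Num.sqrt (n%:R * V_disp R L) < infd s x]) - Qfun t|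
    <= B / Num.sqrt n%:R.
Proof.
move=> s0 L0; have [tz [vz stz]] := gauss_stein s0.
have [th [vh [sth _ _]]] := log_stein R.
pose V := V_disp R L; have V0 : 0 < V.
  by rewrite /V V_dispE mulr_gt0 ?ltr0n// ltr_pwDl// vlog_ge0.
pose v := L%:R * (vh + vz).
exists (2 + `|v| / V ^+ 2) => [|n t n0].
  by rewrite addr_ge0// divr_ge0// sqr_ge0.
set ks := enum (idx n L).
have st1 := stein_tow (enum_uniq (idx n L)) (gauss2T (Num.sqrt (1 / 2))) sth.
have st2 := stein_tow (enum_uniq (idx n L)) (gauss2T s) stz.
have h1 := @towmT R (idx n L) (gauss2 (Num.sqrt (1 / 2))) ks (gauss2T _).
have h2 := @towmT R (idx n L) (gauss2 s) ks (gauss2T s).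
have st := stein_prod h1 h2 st1 st2.
have sz : (size ks)%:R = n%:R * L%:R :> R by rewrite -cardT card_prod !card_ord natrM.
have n0' : (0 : R) < n%:R by rewrite ltr0n.
have nV : 0 < n%:R * V by rewrite mulr_gt0.
have aE : (size ks)%:R * vlog R + (size ks)%:R * 1 = n%:R * V.
  by rewrite sz /V V_dispE; ring.
have vE : (size ks)%:R * vh + (size ks)%:R * vz = n%:R * v.
  by rewrite sz /v; ring.
rewrite -/ks /vlog in aE st; rewrite aE vE in st.
(* This choice of [e] balances the two terms: v / (a^2 e) with [a] and [v] of order n is again of
   order n^(-1/2). *)
have e0 : (0 : R) < (Num.sqrt n%:R)^-1 by rewrite invr_gt0 sqrtr_gt0.
have := stein_berry_esseen (jointT s (idx n L)) st nV t e0.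
rewrite (_ : [set x | _ < _ / _] = [set x | t * Num.sqrt (n%:R * V) < infd s x]); last first.
  by apply/seteqP; split => x /=; rewrite ltr_pdivlMr ?sqrtr_gt0.
move=> h; apply: le_trans h _; rewrite [leRHS]mulrDl lerD2l exprMn.
set q := Num.sqrt _ in e0 *; have q0 : 0 < q by rewrite -invr_gt0.
have qq : n%:R = q ^+ 2 by rewrite sqr_sqrtr ?ltW.
rewrite qq (_ : q ^+ 2 * v / _ = v / V ^+ 2 / q); last first.
  by field; rewrite !gt_eqF.
by rewrite ler_wpM2r ?invr_ge0 ?(ltW q0)// ler_wpM2r ?invr_ge0 ?sqr_ge0// ler_norm.
Qed.

Section LevelSets.
Context d (X : measurableType d) (R : realType).
Notation RR := (measurableTypeR R).
Implicit Types (f : X -> R) (a : R).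

Lemma measurable_gt_set f a : measurable_fun setT (f : X -> RR) -> measurable [set x | a < f x].
Proof.
move=> mf; rewrite (_ : mkset _ = f @^-1` `]a, +oo[); last first.
  by apply/seteqP; split => x /=; rewrite in_itv /= andbT.
by rewrite -[X in measurable X]setTI; apply: mf => //; exact: measurable_itv.
Qed.

Lemma measurable_ge_set f a : measurable_fun setT (f : X -> RR) -> measurable [set x | a <= f x].
Proof.
move=> mf; rewrite (_ : mkset _ = f @^-1` `[a, +oo[); last first.
  by apply/seteqP; split => x /=; rewrite in_itv /= andbT.
by rewrite -[X in measurable X]setTI; apply: mf => //; exact: measurable_itv.
Qed.

Lemma measurable_lt_set f a : measurable_fun setT (f : X -> RR) -> measurable [set x | f x < a].
Proof.
move=> mf; rewrite (_ : mkset _ = ~` [set x | a <= f x]); last first.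
  by apply/seteqP; split => x /=; rewrite ltNge => /negP.
by apply: measurableC; exact: measurable_ge_set.
Qed.

Lemma measurable_le_set f a : measurable_fun setT (f : X -> RR) -> measurable [set x | f x <= a].
Proof.
move=> mf; rewrite (_ : mkset _ = ~` [set x | a < f x]); last first.
  by apply/seteqP; split => x /=; rewrite leNgt => /negP.
by apply: measurableC; exact: measurable_gt_set.
Qed.

End LevelSets.

Section Tightness.
Context d (X : measurableType d) (R : realType) (mu : {measure set X -> \bar R}).
Hypothesis mu1 : mu setT = 1%E.

(** The superlevel sets of a finite-valued function decrease to the empty set. This supplies cutoffs
    for ratios of noise to fading without any moment estimate on the inverse fading. *)
Lemma tight (f : X -> R) (eta : R) : measurable_fun setT f -> 0 < eta ->
  exists2 j : nat, (0 < j)%N & (mu [set x | (j%:R <= f x)%R] <= eta%:E)%E.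
Proof.
move=> mf e0; pose F (n : nat) := [set x | n%:R <= f x].
have mF n : measurable (F n).
  exact: measurable_ge_set.
have F0 : \bigcap_n F n = set0.
  apply/seteqP; split => // x xF; have := xF (Num.bound (f x)) I.
  rewrite /F /= leNgt; case/negP.
  have [f0|f0] := leP 0 (f x); first exact: archi_boundP.
  by apply: lt_le_trans f0 _; rewrite ler0n.
have mFT n : (mu (F n) < +oo)%E.
  by apply: (@le_lt_trans _ _ 1%E); [rewrite -mu1 le_measure// inE|exact: ltry].
have F_noninc : {homo F : n m / (n <= m)%N >-> (m <= n)%O}.
  move=> n m nm; apply/subsetPset => x /=; rewrite /F /=.
  by apply: le_trans; rewrite ler_nat.
have mI : measurable (\bigcap_n F n) by rewrite F0.
have c := @nonincreasing_cvg_mu _ _ R mu F (mFT 0%N) mF mI F_noninc.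
rewrite F0 measure0 in c; apply: contrapT => H.
have : (eta%:E <= limn (mu \o F))%E.
  apply: lime_ge; first by apply/cvg_ex; exists 0%E.
  exists 1%N => // n /= n1; apply: ltW; rewrite ltNge; apply/negP => h.
  by apply: H; exists n.
by rewrite (cvg_lim _ c)// leNgt lte_fin e0.
Qed.

End Tightness.

Lemma measurable_infd_gt (R : realType) (s : R) (T : finType) (t : R) :
  measurable [set x | t < @infd R s T x].
Proof.
by apply: (@measurable_gt_set _ _ R); exact: measurable_infd.
Qed.

(** * Density of the noise, determinant of the fading, and their level sets *)

Section Layers.
Variable R : realType.

(** The value n delta^* when [T] is the index set of n channel uses and sigma^2 = 2 s^2, stated for
    any finite index set. *)
Definition normc (s : R) (T : finType) : R :=
  - #|T|%:R * (ln (pi * expR 1 * (2 * s ^+ 2)) + mlog R).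

Notation RR := (measurableTypeR R).
Notation C := (RR * RR)%type.
Notation leb := (@lebesgue_measure R).
Variable T : finType.
Notation ks := (enum T).
Notation tw := (tow R ks).

Lemma measurable_ev_fun (F : R * R -> R) (k : T) : measurable_fun setT (F : C -> RR) ->
  measurable_fun setT (fun x : tw => F (ev x k)).
Proof. by move=> mF; exact: (measurableT_comp mF (measurable_ev k)). Qed.

Definition box (c : R) : set tw :=
  [set x | forall k, `|(ev x k).1| < c / 2 /\ `|(ev x k).2| < c / 2].

Lemma interval_sym (c : R) : 0 < c ->
  leb ([set y | `|y| < c / 2] : set RR) = c%:E.
Proof.
move=> c0; rewrite (_ : mkset _ = `]- (c / 2), c / 2[%classic); last first.
  by apply/seteqP; split => y /=; rewrite in_itv /= ltr_norml.
apply: (etrans (lebesgue_measure_itv `](- (c / 2)), (c / 2)[%R)).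
rewrite /= lte_fin ifT -?EFinB; first by congr EFin; field.
by rewrite gtrN// divr_gt0.
Qed.

Lemma measurable_interval_sym (c : R) : measurable ([set y | `|y| < c / 2] : set RR).
Proof.
rewrite (_ : mkset _ = `]- (c / 2), c / 2[%classic); first exact: measurable_itv.
by apply/seteqP; split => y /=; rewrite in_itv /= ltr_norml.
Qed.

Lemma box_volume_seq (c : R) (l : seq T) : 0 < c -> uniq l ->
  measurable [set x : tow R l | forall k, k \in l -> `|(ev x k).1| < c / 2 /\ `|(ev x k).2| < c / 2] /\
  towm (leb2 R) l [set x | forall k, k \in l -> `|(ev x k).1| < c / 2 /\ `|(ev x k).2| < c / 2] =
   (c ^+ (2 * size l))%:E.
Proof.
move=> c0; pose I := [set y : RR | `|y| < c / 2].
have mI : measurable I := measurable_interval_sym c.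
elim: l => [_|k l IH /= /andP[kl ul]].
  rewrite (_ : mkset _ = setT); last by apply/seteqP; split.
  by split; [exact: measurableT|rewrite muln0 expr0; exact: diracT].
have [mL vL] := IH ul; set A := mkset _ in mL vL.
rewrite (_ : mkset _ = (I `*` I) `*` A); last first.
  apply/seteqP; split => -[[y1 y2] x] /=; rewrite /I /A /=.
    move=> H; have := H k; rewrite inE eqxx /= => /(_ isT) ?; split => // j jl.
    have := H j; rewrite inE jl orbT => /(_ isT); case: eqP => // jk.
    by move: kl; rewrite -jk jl.
  move=> [[h1 h2] H] j; rewrite inE; case: eqP => [_ _|_ /= jl]; first by [].
  exact: H.
have mII : measurable (I `*` I) by exact: measurableX.
split; first exact: measurableX.
apply: (etrans (product_measure1E (leb2 R) (towm (leb2 R) l) mII mL)).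
have vI : leb2 R (I `*` I) = (c * c)%:E.
  apply: (etrans (product_measure1E leb leb mI mI)).
  exact: (f_equal2 *%E (interval_sym c0) (interval_sym c0)).
apply: (etrans (f_equal2 *%E vI vL)).
by rewrite -EFinM mulnS -expr2 exprD.
Qed.

Lemma box_volume (c : R) : 0 < c -> measurable (box c) /\
  towm (leb2 R) ks (box c) = (c ^+ (2 * #|T|))%:E.
Proof.
move=> c0; have := box_volume_seq c0 (enum_uniq T).
rewrite (_ : mkset _ = box c) -?cardE//; apply/seteqP; split => x /= H k.
  by apply: H; rewrite mem_enum.
by move=> _; exact: H.
Qed.

Definition pz (s : R) (z : T -> R * R) : R := \prod_(k <- ks) pdf2 s (z k).
Definition det2 (h : T -> R * R) : R := \prod_(k <- ks) cabs2 (h k).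

Lemma cabs2_ge0 (u : R * R) : 0 <= cabs2 u.
Proof. by rewrite addr_ge0 ?sqr_ge0. Qed.

Lemma det2_ge0 h : 0 <= det2 h.
Proof. by apply: prodr_ge0 => k _; exact: cabs2_ge0. Qed.

Lemma det2_gt0 h : 0 < det2 h -> forall k, 0 < cabs2 (h k).
Proof.
rewrite lt0r => /andP[d0 _] k; rewrite lt0r cabs2_ge0 andbT.
by move: d0; rewrite prodf_seq_neq0 => /allP /(_ k); rewrite mem_enum; apply.
Qed.

Lemma pz_ge0 s z : 0 <= pz s z.
Proof. by apply: prodr_ge0 => k _; exact: pdf2_ge0. Qed.

Lemma measurable_pz s : measurable_fun setT (fun x : tw => pz s (ev x) : RR).
Proof.
apply: measurable_prod => k _; apply: measurable_ev_fun; exact: measurable_pdf2.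
Qed.

Lemma measurable_det2 : measurable_fun setT (fun x : tw => det2 (ev x) : RR).
Proof. apply: measurable_prod => k _; apply: measurable_ev_fun; exact: measurable_cabs2. Qed.

Lemma pdf2E (s : R) (u : R * R) : 0 < s ->
  pdf2 s u = expR (- ln (pi * (2 * s ^+ 2)) - cabs2 u / (2 * s ^+ 2)).
Proof.
move=> s0; have s2 : 0 < s ^+ 2 by rewrite exprn_gt0.
rewrite /pdf2 !normal_pdf0E ?gt_eqF//.
rewrite mulrACA -expRD -expr2 /normal_peak exprVn sqr_sqrtr; last first.
  by rewrite mulrn_wge0// mulr_ge0 ?pi_ge0// ltW.
have A0 : 0 < pi * (2 * s ^+ 2) :> R by rewrite !mulr_gt0 ?pi_gt0.
rewrite [RHS]expRD expRN lnK ?posrE//; congr (_ ^-1 * expR _).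
  by rewrite -mulr_natl; ring.
by rewrite /cabs2; ring.
Qed.

(** Coordinate by coordinate, the centring constants of [infd], namely [mlog] and 1, are restored by
    [normc]; the 1 is the factor e in pi e sigma^2. *)
Lemma infd_pz (s : R) (x : tw * tw) : 0 < s -> 0 < det2 (ev x.1) ->
  pz s (ev x.2) * det2 (ev x.1) = expR (normc s T - infd s x).
Proof.
move=> s0 d0; have h0 := det2_gt0 d0.
have gen (l : seq T) :
   (\prod_(k <- l) pdf2 s (ev x.2 k)) * (\prod_(k <- l) cabs2 (ev x.1 k)) =
   expR (- (size l)%:R * (ln (pi * expR 1 * (2 * s ^+ 2)) + mlog R) -
   (\sum_(k <- l) (- ln (cabs2 (ev x.1 k)) - mlog R) +
    \sum_(k <- l) (cabs2 (ev x.2 k) / (2 * s ^+ 2) - 1))).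
  elim: l => [|k l IH].
    by rewrite !big_nil /= mulr1 [X in expR X](_ : _ = 0) ?expR0//; ring.
  rewrite !big_cons mulrACA IH pdf2E// -{1}(@lnK _ (cabs2 (ev x.1 k))) ?posrE//.
  rewrite -!expRD; congr expR.
  have -> : ln (pi * expR 1 * (2 * s ^+ 2)) = ln (pi * (2 * s ^+ 2)) + 1.
    rewrite -[X in _ = _ + X]expRK -lnM ?posrE ?mulr_gt0 ?pi_gt0 ?expR_gt0 ?exprn_gt0//.
    by congr ln; ring.
  rewrite /= -natr1; ring.
by rewrite /pz /det2 gen /normc /infd cardE.
Qed.

Lemma det2_null s : towm (gauss2 s) ks [set x | det2 (ev x) = 0] = 0%E.
Proof.
have g0 : gauss2 s [set u : C | cabs2 u = 0] = 0%E.
  rewrite (_ : mkset _ = [set (0 : RR)] `*` [set (0 : RR)]); last first.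
    apply/seteqP; split => -[u1 u2] /=; last by move=> [-> ->]; rewrite /cabs2 /= expr0n addr0.
    move/eqP; rewrite /cabs2 /= paddr_eq0 ?sqr_ge0// !sqrf_eq0.
    by move=> /andP[/eqP -> /eqP ->].
  have ms : measurable [set (0 : RR)] := measurable_set1 (0 : R).
  apply: (etrans (product_measure1E (normal_prob 0 s) (normal_prob 0 s) ms ms)).
  have n0 := @normal_prob_set1 R s 0.
  by apply: (etrans (f_equal2 *%E n0 n0)); rewrite mul0e.
have mA : measurable [set u : C | cabs2 u = 0].
  rewrite (_ : mkset _ = (fun u : C => cabs2 u : RR) @^-1` [set 0]); last by [].
  by rewrite -[X in measurable X]setTI; apply: measurable_cabs2 => //.
pose F (k : T) := [set x : tw | cabs2 (ev x k) = 0].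
have mF k : measurable (F k).
  by rewrite -[X in measurable X]setTI; exact: (measurable_ev k measurableT mA).
have F0 k : towm (gauss2 s) ks (F k) = 0%E.
  by apply: (@towm_null R T (gauss2 s) ks k _ _ mA g0); rewrite mem_enum.
apply/negligibleP.
  rewrite (_ : mkset _ = (fun x : tw => det2 (ev x) : RR) @^-1` [set 0]); last by [].
  by rewrite -[X in measurable X]setTI; apply: measurable_det2 => //.
have gen (l : seq T) : (towm (gauss2 s) ks).-negligible [set x | \prod_(k <- l) cabs2 (ev x k) = 0].
  elim: l => [|k l IH].
    by apply: (negligibleS _ (negligible_set0 _)) => x /=; rewrite big_nil => /eqP; rewrite oner_eq0.
  have Fk : (towm (gauss2 s) ks).-negligible (F k).
    by exists (F k); split; [exact: mF|exact: F0|].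
  apply: (negligibleS _ (negligibleU Fk IH)) => x /=.
  by rewrite big_cons => /eqP; rewrite mulf_eq0 => /orP[] /eqP ?; [left|right].
exact: gen.
Qed.

Lemma measurable_layer (s kap : R) :
  measurable [set x : (tw * tw)%type | 0 < det2 (ev x.1) /\ pz s (ev x.2) * det2 (ev x.1) < kap].
Proof.
have md1 : measurable_fun setT (fun x : (tw * tw)%type => det2 (ev x.1) : RR).
  exact: (measurableT_comp measurable_det2 measurable_fst).
have mp2 : measurable_fun setT (fun x : (tw * tw)%type => pz s (ev x.2) : RR).
  exact: (measurableT_comp (measurable_pz s) measurable_snd).
apply: measurableI; first exact: (@measurable_gt_set _ _ R _ 0 md1).
apply: (@measurable_lt_set _ _ R (fun x : (tw * tw)%type => pz s (ev x.2) * det2 (ev x.1)) kap).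
exact: measurable_funM.
Qed.

Lemma joint_det2_null (s : R) :
  measurable [set x : (tw * tw)%type | det2 (ev x.1) = 0] /\
  joint s T [set x | det2 (ev x.1) = 0] = 0%E.
Proof.
pose Z1 := [set x : tw | det2 (ev x) = 0].
have mZ1 : measurable Z1.
  rewrite (_ : Z1 = (fun x : tw => det2 (ev x) : RR) @^-1` [set 0]); last by [].
  by rewrite -[X in measurable X]setTI; apply: measurable_det2.
have -> : [set x : (tw * tw)%type | det2 (ev x.1) = 0] = Z1 `*` setT.
  by apply/seteqP; split => x //= [].
split; first exact: measurableX.
apply: (etrans (product_measure1E _ _ mZ1 measurableT)).
by apply: (etrans (f_equal (fun z => z * _)%E (det2_null _))); rewrite mul0e.
Qed.

(** The fading determinant vanishes with probability 0, so events may be compared where [infd_pz]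
    and divisions by the fading are valid. *)
Lemma joint_le_ae (s : R) (D E : set (tw * tw)) : measurable D -> measurable E ->
  (forall x, 0 < det2 (ev x.1) -> D x -> E x) -> (joint s T D <= joint s T E)%E.
Proof.
move=> mD mE DE; have [mZ Z0] := joint_det2_null s.
rewrite -(measureU0 mE mZ Z0); apply: le_measure; rewrite ?inE//; first exact: measurableU.
move=> x Dx; have [d0|d0] := ltP 0 (det2 (ev x.1)); [left; exact: DE|right] => /=.
by apply/eqP; rewrite eq_le d0 det2_ge0.
Qed.

Lemma joint_section (s : R) (P : (T -> R * R) -> (T -> R * R) -> Prop) :
  measurable [set x : (tw * tw)%type | P (ev x.1) (ev x.2)] ->
  measurable_fun setT (fun h : tw => towm (gauss2 s) ks [set z | P (ev h) (ev z)]) /\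
  joint s T [set x | P (ev x.1) (ev x.2)] =
  (\int[towm (gauss2 (Num.sqrt (1 / 2))) ks]_h towm (gauss2 s) ks [set z | P (ev h) (ev z)])%E.
Proof.
move=> mP; have E h : towm (gauss2 s) ks (xsection [set x : (tw * tw)%type | P (ev x.1) (ev x.2)] h) =
    towm (gauss2 s) ks [set z | P (ev h) (ev z)].
  by congr (towm _ _ _); apply/seteqP; split => z; rewrite /xsection /= inE.
split; first by apply: eq_measurable_fun (measurable_fun_xsection (towm (gauss2 s) ks) mP) => h _ /=.
by rewrite /joint /sprod /= /product_measure1; apply: eq_integral => h _ /=.
Qed.

Lemma joint_infd (s kap : R) : 0 < s -> 0 < kap ->
  joint s T [set x | normc s T - ln kap < infd s x] =
  (\int[towm (gauss2 (Num.sqrt (1 / 2))) ks]_h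
     towm (gauss2 s) ks [set z | (0 < det2 (ev h))%R /\ (pz s (ev z) * det2 (ev h) < kap)%R])%E.
Proof.
move=> s0 k0; set A := mkset _.
pose B := [set x : tw * tw | 0 < det2 (ev x.1) /\ pz s (ev x.2) * det2 (ev x.1) < kap].
have mA : measurable A := @measurable_infd_gt R s T _.
have mB : measurable B := measurable_layer s kap.
have AB x : 0 < det2 (ev x.1) -> A x <-> B x.
  move=> d0; rewrite /A /B /= infd_pz//.
  have -> : (expR (normc s T - infd s x) < kap) = (normc s T - infd s x < ln kap).
    by rewrite -[X in (_ < X) = _](@lnK _ kap) ?posrE// ltr_expR.
  by split=> [h|[_ h]]; [split => //|]; lra.
transitivity (joint s T B).
  apply/eqP; rewrite eq_le; apply/andP; split.
    by apply: joint_le_ae => // x /AB[h _].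
  by apply: joint_le_ae => // x /AB[_ h].
by have [_ ->] := joint_section (P := fun h z => 0 < det2 h /\ pz s z * det2 h < kap) s mB.
Qed.

End Layers.

(** * The converse *)

Section Converse.
Variable R : realType.
Notation RR := (measurableTypeR R).
Notation C := (RR * RR)%type.
Notation leb := (@lebesgue_measure R).
Variable T : finType.
Notation ks := (enum T).
Notation tw := (tow R ks).
Notation pt := (T -> R * R).
Notation Lam := (towm (leb2 R) ks).

Lemma measurable_all d (X : measurableType d) (I : Type) (P : I -> X -> bool) (l : seq I) :
  (forall i, measurable [set x | P i x]) -> measurable [set x | all (P^~ x) l].
Proof.
move=> mP; elim: l => [|i l IH] /=.
  by rewrite (_ : mkset _ = setT)//; apply/seteqP.
rewrite (_ : mkset _ = [set x | P i x] `&` [set x | all (P^~ x) l]); last first.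
  by apply/seteqP; split => x /=; [move=> /andP|move=> [-> ->]].
exact: measurableI.
Qed.

Lemma measurable_cmp_set d (X : measurableType d) (f g : X -> R) :
  measurable_fun setT (f : X -> RR) -> measurable_fun setT (g : X -> RR) ->
  measurable [set x | f x < g x] /\ measurable [set x | f x <= g x].
Proof.
move=> mf mg; have m : measurable_fun setT (fun x => g x - f x : RR) by exact: measurable_funB.
split.
  rewrite (_ : mkset _ = [set x | 0 < g x - f x]); first exact: measurable_gt_set.
  by apply/seteqP; split => x /=; rewrite subr_gt0.
rewrite (_ : mkset _ = [set x | 0 <= g x - f x]); first exact: measurable_ge_set.
by apply/seteqP; split => x /=; rewrite subr_ge0.
Qed.

Lemma measurable_vnorm2 (F : T -> R * R -> R * R) :
  (forall k, measurable_fun setT (F k : C -> C)) ->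
  measurable_fun setT (fun x : tw => vnorm2 (fun k => F k (ev x k)) : RR).
Proof.
move=> mF; apply: measurable_sum => k.
have mc : measurable_fun setT (fun u : C => cabs2 (F k u) : RR).
  exact: (measurableT_comp (@measurable_cabs2 R) (mF k)).
exact: (@measurable_ev_fun R T (fun u => cabs2 (F k u)) k mc).
Qed.

Lemma measurable_translate (c c' : R * R) :
  measurable_fun setT (fun u : C => csub (Defs.cadd c u) c' : C).
Proof.
apply: measurable_fun_pair.
  by apply: measurable_funB => //; apply: measurable_funD.
by apply: measurable_funB => //; apply: measurable_funD.
Qed.

(** The vector from the faded point h s' to the received point h s + z. *)
Definition recv (h s s' : pt) (z : pt) : pt :=
  fun i => csub (Defs.cadd (cmul (h i) (s i)) (z i)) (cmul (h i) (s' i)).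

Lemma measurable_recv (h s s' : pt) :
  measurable [set x : tw | vnorm2 (ev x) < vnorm2 (recv h s s' (ev x))] /\
  measurable [set x : tw | vnorm2 (recv h s s' (ev x)) <= vnorm2 (ev x)].
Proof.
have m1 := @measurable_vnorm2 (fun k u => u) (fun k => @measurable_id _ _ _).
have m2 := @measurable_vnorm2
  (fun k u => csub (Defs.cadd (cmul (h k) (s k)) u) (cmul (h k) (s' k)))
  (fun k => measurable_translate _ _).
by split; [have [] := measurable_cmp_set m1 m2|have [] := measurable_cmp_set m2 m1].
Qed.

(** The noise vectors decoded correctly when only the competitors in the finite list [A] are
    considered. The inequality is strict because ties count as errors. For [A] inside the
    constellation, leaving the cell is an error, which gives [pe_point_ge]. *)
Definition vor (h : pt) (A : seq pt) (s : pt) (z : pt) : bool :=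
  all (fun s' => (s' == s) || (vnorm2 z < vnorm2 (recv h s s' z))) A.

Lemma measurable_vor h A s : measurable [set x : tw | vor h A s (ev x)].
Proof.
apply: (@measurable_all _ tw pt (fun s' x => (s' == s) || (vnorm2 (ev x) < vnorm2 (recv h s s' (ev x))))).
move=> s'; case: (s' == s) => /=; last by have [] := measurable_recv h s s'.
by rewrite (_ : mkset _ = setT)//; apply/seteqP.
Qed.

(** The map y -> h (y - s) from transmitter side points to noise, in the form treated by
    [leb2_affine]. *)
Definition hshift (h s : pt) (k : T) (u : C) : C :=
  Defs.cadd (cmul (h k) u) (csub (0, 0) (cmul (h k) (s k))).

Lemma integral_hshift (h s : pt) (F : tw -> \bar R) : (0 < det2 h) ->
  measurable_fun setT F -> (forall x, 0 <= F x)%E ->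
  (\int[Lam]_x F (tmap (hshift h s) x) = ((det2 h)^-1)%:E * \int[Lam]_x F x)%E.
Proof.
move=> d0 mF F0; have h0 := det2_gt0 d0.
rewrite (@integral_tmap R T (leb2 R) (hshift h s) (fun k => (cabs2 (h k))^-1))//.
- by congr (_%:E * _)%E; rewrite /det2 prodfV.
- by move=> k; rewrite invr_ge0 ltW.
- move=> k; apply: measurable_fun_pair.
    by apply: measurable_funD => //; apply: measurable_funB; apply: measurable_funM.
  by apply: measurable_funD => //; apply: measurable_funD; apply: measurable_funM.
- move=> k f mf f0; apply: leb2_affine => //.
  by apply: contraTneq (h0 k) => ->; rewrite /cabs2 /= expr0n addr0 ltxx.
Qed.

Lemma ev_hshift (h s : pt) (y : tw) k :
  ev (tmap (hshift h s) y) k = cmul (h k) (csub (ev y k) (s k)).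
Proof.
rewrite ev_tmap ?mem_enum// /hshift /Defs.cadd /cmul /csub /=.
by congr (_, _); ring.
Qed.

(** With noise h (y - s) the received point is h y for every s. All cells are thereby compared in
    one space of points y, where being in the cell of s means that h y is closest to h s;
    disjointness follows. *)
Lemma recv_hshift (h s s' : pt) (y : tw) k :
  recv h s s' (ev (tmap (hshift h s) y)) k = ev (tmap (hshift h s') y) k.
Proof. by rewrite /recv !ev_hshift /Defs.cadd /cmul /csub /=; congr (_, _); ring. Qed.

Lemma cabs2M (u v : R * R) : cabs2 (cmul u v) = cabs2 u * cabs2 v.
Proof. by rewrite /cabs2 /cmul /=; ring. Qed.

Lemma cabs2_lt (u : R * R) (j : R) : 1 <= j -> cabs2 u < j -> `|u.1| < j /\ `|u.2| < j.
Proof.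
move=> j1 uj; have j0 := lt_le_trans ltr01 j1.
have jj : j <= j ^+ 2 by rewrite expr2 ler_peMr// ltW.
split; rewrite -(@ltr_pXn2r _ 2)// ?nnegrE ?(ltW j0)// real_normK ?num_real//;
  apply: lt_le_trans jj; apply: le_lt_trans uj; rewrite /cabs2 ?lerDl ?lerDr sqr_ge0//.
Qed.

Lemma sum_indicator_le1 (I : eqType) (l : seq I) (P : I -> bool) (Q : bool) : uniq l ->
  (forall i, i \in l -> P i -> Q) ->
  (forall i i', i \in l -> i' \in l -> P i -> P i' -> i = i') ->
  \sum_(i <- l) (P i)%:R <= Q%:R :> R.
Proof.
elim: l => [|i l IH] /=; first by rewrite big_nil ler0n.
move=> /andP[il ul] PQ PP; rewrite big_cons.
case Pi : (P i); last first.
  rewrite add0r; apply: IH => // [k kl|k k' kl kl'].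
    by apply: PQ; rewrite inE kl orbT.
  by apply: PP; rewrite inE ?kl ?kl' orbT.
have -> : Q = true by apply: (PQ i) => //; rewrite inE eqxx.
rewrite big1_seq ?addr0// => k /= kl; case Pk : (P k) => //.
have ik : i = k by apply: PP => //; rewrite inE ?eqxx ?kl ?orbT.
by move: il; rewrite ik kl.
Qed.

(* The cells, pulled back to the transmitter side, are disjoint and fit in a slightly larger cube. *)
Lemma vor_volume (h : pt) (A : seq pt) (a j : R) : 0 < det2 h -> uniq A -> 0 < a -> 1 <= j ->
  {in A, forall s, cube a s} ->
  (\sum_(s <- A) Lam [set x | vor h A s (ev x) /\ (forall k, (cabs2 (ev x k) < j * cabs2 (h k))%R)]
    <= (det2 h * (a + 2 * j) ^+ (2 * #|T|))%:E)%E.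
Proof.
move=> d0 uA a0 j1 Aa; have h0 := det2_gt0 d0; have j0 := lt_le_trans ltr01 j1.
pose W s := [set x : tw | vor h A s (ev x) /\ (forall k, (cabs2 (ev x k) < j * cabs2 (h k))%R)].
have mW s : measurable (W s).
  apply: measurableI; first exact: measurable_vor.
  rewrite (_ : (fun x => _) = [set x : tw | all (fun k => cabs2 (ev x k) < j * cabs2 (h k)) ks]); last first.
    apply/seteqP; split => x /= H; first by apply/allP => k _; exact: H.
    by move=> k; have /allP := H; apply; rewrite mem_enum.
  apply: (@measurable_all _ tw T (fun k x => cabs2 (ev x k) < j * cabs2 (h k))) => k.
  apply: measurable_lt_set; apply: measurable_ev_fun; exact: measurable_cabs2.
have c0 : 0 < a + 2 * j by rewrite addr_gt0// mulr_gt0.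
have [mbox vbox] := @box_volume R T _ c0.
have mt s : measurable_fun setT (@tmap R T (hshift h s) ks).
  apply: measurable_tmap => k; apply: measurable_fun_pair.
    by apply: measurable_funD => //; apply: measurable_funB; apply: measurable_funM.
  by apply: measurable_funD => //; apply: measurable_funD; apply: measurable_funM.
have mI s : measurable_fun setT (fun x : tw => (\1_(W s) x : R)%:E).
  by apply/measurable_EFinP; exact: measurable_indic.
have LW s : Lam (W s) = ((det2 h)%:E * \int[Lam]_y (\1_(W s) (tmap (hshift h s) y))%:E)%E.
  rewrite (@integral_hshift h s (fun x => (\1_(W s) x)%:E))//.
  by rewrite muleA -EFinM mulfV ?gt_eqF// mul1e integral_indic// setIT.
under eq_bigr do rewrite LW.
rewrite -ge0_sume_distrr; last by move=> s _; exact: integral_ge0.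
rewrite EFinM; apply: lee_wpmul2l; first by rewrite lee_fin ltW.
rewrite -ge0_integral_sum//; last first.
  by move=> s; exact: (measurableT_comp (mI s) (mt s)).
rewrite -vbox -[X in (_ <= Lam X)%E]setIT -integral_indic//.
apply: ge0_le_integralT => y; first by apply: sume_ge0 => s _; rewrite lee_fin.
rewrite sumEFin lee_fin.
under eq_bigr do rewrite indicE.
rewrite [leRHS]indicE; apply: sum_indicator_le1 => // [s sA|s s' sA s'A].
  rewrite !inE => -[_ H]; have sa := Aa _ sA.
  move=> k; have := H k; rewrite ev_hshift cabs2M mulrC ltr_pM2r// => /(cabs2_lt j1)[].
  have [s1 s2] := sa k; rewrite /csub /= => b1 b2.
  split.
    rewrite -(subrK (s k).1 (ev y k).1); apply: le_lt_trans (ler_normD _ _) _; lra.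
  rewrite -(subrK (s k).2 (ev y k).2); apply: le_lt_trans (ler_normD _ _) _; lra.
rewrite !inE => -[/allP V1 _] [/allP V2 _]; apply/eqP; apply: contraT => ss'.
have := V1 _ s'A; rewrite eq_sym (negbTE ss') /=.
have := V2 _ sA; rewrite (negbTE ss') /=.
have E (s1 s2 : pt) : vnorm2 (recv h s1 s2 (ev (tmap (hshift h s1) y))) = vnorm2 (ev (tmap (hshift h s2) y)).
  by congr vnorm2; apply/funext => k; exact: recv_hshift.
by rewrite !E => h1 h2; have := lt_trans h1 h2; rewrite ltxx.
Qed.

Variable sg : R.
Hypothesis sg0 : 0 < sg.
Notation muz := (towm (gauss2 sg) ks).

Lemma muzT : muz setT = 1%E.
Proof. exact: (@towmT R T (gauss2 sg) ks (gauss2T sg)). Qed.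

(** The cell is covered by three events: a large noise density, a noise that is large relative to
    the fading, and the rest. On the rest the density is below kap / det, and the cutoff [j]
    confines the pulled-back cell near s, as [vor_volume] requires. *)
Lemma vor_prob_le (h : pt) (A : seq pt) (s : pt) (kap j : R) : 0 < det2 h -> 0 < kap ->
  (muz [set x | vor h A s (ev x)] <=
   muz [set x | (kap <= pz sg (ev x) * det2 h)%R] +
   muz [set x | (j <= \sum_(k <- ks) cabs2 (ev x k) / cabs2 (h k))%R] +
   (kap / det2 h)%:E * Lam [set x | vor h A s (ev x) /\ (forall k, (cabs2 (ev x k) < j * cabs2 (h k))%R)])%E.
Proof.
move=> d0 kap0; have h0 := det2_gt0 d0.
set V := [set x | _]; set P := [set x | (kap <= _)%R]; set J := [set x | (j <= _)%R]; set W := mkset _.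
have mV : measurable V := measurable_vor h A s.
have mp : measurable_fun setT (fun x : tw => pz sg (ev x) * det2 h : RR).
  by apply: measurable_funM => //; exact: measurable_pz.
have mP : measurable P by exact: measurable_ge_set.
have mf : measurable_fun setT (fun x : tw => \sum_(k <- ks) cabs2 (ev x k) / cabs2 (h k) : RR).
  apply: measurable_sum => k; apply: measurable_funM => //.
  apply: measurable_ev_fun; exact: measurable_cabs2.
have mJ : measurable J by exact: measurable_ge_set.
have mW : measurable W.
  apply: measurableI; first exact: measurable_vor.
  rewrite (_ : (fun x => _) = [set x : tw | all (fun k => cabs2 (ev x k) < j * cabs2 (h k)) ks]); last first.
    apply/seteqP; split => x /= H; first by apply/allP => k _; exact: H.
    by move=> k; have /allP := H; apply; rewrite mem_enum.
  apply: (@measurable_all _ tw T (fun k x => cabs2 (ev x k) < j * cabs2 (h k))) => k.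
  apply: measurable_lt_set; apply: measurable_ev_fun; exact: measurable_cabs2.
pose Wp := W `\` P.
have mWp : measurable Wp by exact: measurableD.
apply: (@le_trans _ _ (muz (P `|` J `|` Wp))).
  apply: le_measure; rewrite ?inE//; first by apply: measurableU => //; exact: measurableU.
  move=> x Vx; have [Px|Px] := pselect (P x); first by left; left.
  have [Jx|Jx] := pselect (J x); first by left; right.
  right; split => //; split => // k; rewrite -ltr_pdivrMr//.
  move/negP: Jx; rewrite -ltNge; apply: le_lt_trans.
  rewrite big_enum (bigD1 k)//= lerDl; apply: sumr_ge0 => i _.
  by rewrite divr_ge0// ?cabs2_ge0// ltW.
apply: le_trans (measureU2 _ _ _) _ => //; first exact: measurableU.
apply: leeD; first exact: measureU2.
rewrite -[X in (muz X <= _)%E]setIT -integral_indic//.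
have mI D : measurable D -> measurable_fun setT (fun x : tw => (\1_D x : R)%:E).
  by move=> mD; apply/measurable_EFinP; exact: measurable_indic.
rewrite towm_gauss_density ?enum_uniq//; last exact: mI.
rewrite -[X in (_ * Lam X)%E]setIT -integral_indic//.
rewrite -ge0_integralZl//; last 2 first.
- exact: mI.
- by rewrite lee_fin divr_ge0 ?ltW.
apply: ge0_le_integralT => x.
  by rewrite -EFinM lee_fin mulr_ge0// prodr_ge0// => k _; exact: pdf2_ge0.
rewrite -!EFinM lee_fin !indicE; have [|_] := boolP (x \in Wp); last first.
  by rewrite mulr0 mulr_ge0// divr_ge0 ?ltW.
rewrite inE => -[Wx /negP]; rewrite -ltNge => Px; rewrite mem_set// !mulr1.
by rewrite ler_pdivlMr// ltW.
Qed.

Lemma Num_sqrt_var : Num.sqrt (2 * sg ^+ 2 / 2) = sg.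
Proof. by rewrite mulrC mulKf// sqrtr_sqr gtr0_norm. Qed.

Lemma pe_point_ge (S : set pt) (h s : pt) (A : seq pt) : (forall s', s' \in A -> S s') ->
  (1 - muz [set x | vor h A s (ev x)] <= pe_point (2 * sg ^+ 2) S h s)%E.
Proof.
move=> AS; set V := [set x | _]; have mV : measurable V := measurable_vor h A s.
rewrite /pe_point /CNexp Num_sqrt_var.
have mI : measurable_fun setT (fun x : tw => (\1_(~` V) x : R)%:E).
  by apply/measurable_EFinP; apply: measurable_indic; exact: measurableC.
have E (x : tw) : (\1_(~` V) x : R) = (~~ vor h A s (ev x))%:R.
  rewrite indicE in_setC; congr (~~ _)%:R.
  by apply/idP/idP; rewrite inE.
apply: (@le_trans _ _ (gexp ks sg (fun z => ((~~ vor h A s z)%:R : R)%:E))).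
  rewrite gexpE//; last by apply: eq_measurable_fun mI => x _; rewrite E.
  under eq_integral do rewrite -E.
  rewrite integral_indic//; last exact: measurableC.
  rewrite setIT.
  have fV : muz V \is a fin_num.
    by rewrite ge0_fin_numE// (le_lt_trans _ (ltry 1))// -muzT le_measure ?inE.
  rewrite leeBlDr// -muzT -(setvU V).
  by apply: measureU2 => //; exact: measurableC.
apply: gexp_le => z; first by rewrite lee_fin.
rewrite lee_fin ler_nat; case: (boolP (vor h A s z)) => //= /allPn[s' s'A].
rewrite negb_or -leNgt => /andP[/eqP ss' hz].
by rewrite asboolT//; exists s' => //; exact: AS.
Qed.

Lemma sume_cst1 (I : Type) (l : seq I) : (\sum_(i <- l) 1 = (size l)%:R%:E :> \bar R)%E.
Proof.
elim: l => [|i l IH]; first by rewrite big_nil.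
by rewrite big_cons IH /= -EFinD -natr1 addrC.
Qed.

Lemma cnt_fset (S : set pt) (a : R) : finite_set (S `&` cube a) ->
  cnt S a = ((size (fset_set (S `&` cube a)))%:R)%:E.
Proof. by move=> fS; rewrite /cnt esum_fset// fsbig_finite//= sume_cst1. Qed.

Lemma pe_point_ge0 (S : set pt) (h s : pt) : (0 <= pe_point (2 * sg ^+ 2) S h s)%E.
Proof.
have := @pe_point_ge S h s [::]; rewrite (_ : [set x | _] = setT); last first.
  by apply/seteqP.
by rewrite muzT subee//; apply.
Qed.

Lemma pe_avg_ge0 (S : set pt) (h : pt) (a : R) : (0 <= pe_avg (2 * sg ^+ 2) S h a)%E.
Proof.
rewrite /pe_avg; case: ifP => // _; apply: mule_ge0.
  by apply: esum_ge0 => s _; exact: pe_point_ge0.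
by rewrite lee_fin invr_ge0 fine_ge0//; exact: esum_ge0.
Qed.

Lemma pe_avg_fset (S : set pt) (h : pt) (a : R) (l := fset_set (S `&` cube a)) :
  finite_set (S `&` cube a) -> (0 < size l)%N ->
  pe_avg (2 * sg ^+ 2) S h a =
  ((\sum_(s <- l) pe_point (2 * sg ^+ 2) S h s) * ((size l)%:R^-1)%:E)%E.
Proof.
move=> fS l0; rewrite /pe_avg cnt_fset// -/l eqe pnatr_eq0 gtn_eqF//=.
by rewrite esum_fset ?fsbig_finite// => s _; exact: pe_point_ge0.
Qed.

(** By (1 + 2 j / a)^d <= exp(2 j d / a), which is at most 2 once a >= 2 j d / ln 2. *)
Lemma growth_ratio (j : R) (d : nat) : 0 <= j -> exists2 a1 : R, 0 < a1 &
  forall a, a1 <= a -> (a + 2 * j) ^+ d <= 2 * a ^+ d.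
Proof.
move=> j0; have l2 : 0 < ln (2 : R) by rewrite ln_gt0// ltr1n.
have b0 : 0 <= d%:R * (2 * j) / ln 2 by rewrite divr_ge0 ?mulr_ge0// ltW.
exists (d%:R * (2 * j) / ln 2 + 1); first by rewrite ltr_wpDl.
move=> a ha; have a0 : 0 < a by lra.
have x0 : 0 <= 2 * j / a by rewrite divr_ge0 ?mulr_ge0// ltW.
rewrite (_ : a + 2 * j = (1 + 2 * j / a) * a); last by field; rewrite gt_eqF.
rewrite exprMn ler_wpM2r ?exprn_ge0 ?(ltW a0)//.
apply: (@le_trans _ _ (expR (2 * j / a) ^+ d)).
  by apply: lerXn2r; rewrite ?nnegrE ?expR_ge0 ?expR_ge1Dx ?addr_ge0.
rewrite -expRM_natl -[leRHS]lnK ?posrE// ler_expR.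
rewrite (_ : d%:R * (2 * j / a) = d%:R * (2 * j) / a); last by ring.
rewrite ler_pdivrMr// [leRHS]mulrC -ler_pdivrMr//; lra.
Qed.

Lemma limsup_pinfty_ge (f : R -> \bar R) (x : \bar R) :
  (forall M, exists2 a, M < a & (x <= f a)%E) -> (x <= limsup_pinfty f)%E.
Proof.
move=> H; apply: le_ereal_inf_tmp => _ [M _ <-]; have [a Ma xa] := H M.
by apply: le_trans xa _; apply: ereal_sup_ubound; exists a.
Qed.

Lemma limsup_pinfty_gt (f : R -> \bar R) (x : \bar R) :
  (x < limsup_pinfty f)%E -> forall M, exists2 a, M < a & (x < f a)%E.
Proof.
move=> H M; have : (x < ereal_sup [set f a | a in [set a | (M < a)%R]])%E.
  by apply: lt_le_trans H _; apply: ereal_inf_lbound; exists M.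
by move=> /ereal_sup_gt[_ [a /= Ma <-] xa]; exists a.
Qed.

(** The cutoff [j] depends on [h], which is allowed because the cube grows with the fading fixed.
    One [eta] is the tightness cost. The other is the average volume term: the total is at most kap
    times 2 a^d, that is g eta a^d, hence below eta times the number of points. *)
Lemma converse_fixed (S : set pt) (h : pt) (g eta : R) :
  0 < eta -> IC S -> 0 < g -> (g%:E < density S)%E -> 0 < det2 h ->
  (muz [set z | (pz sg (ev z) * det2 h < g * (eta / 2))%R] <=
   limsup_pinfty (pe_avg (2 * sg ^+ 2) S h) + (2 * eta)%:E)%E.
Proof.
move=> eta0 [_ fS] g0 dS d0; set kap := g * (eta / 2).
have kap0 : 0 < kap by rewrite mulr_gt0// divr_gt0.
have mf : measurable_fun setT (fun x : tw => \sum_(k <- ks) cabs2 (ev x k) / cabs2 (h k) : RR).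
  apply: measurable_sum => k; apply: measurable_funM => //.
  apply: measurable_ev_fun; exact: measurable_cabs2.
have [j j0 Pj] := @tight _ _ R muz muzT _ _ mf eta0.
have j1 : 1 <= j%:R :> R by rewrite ler1n.
pose d := (2 * #|T|)%N.
have [a1 a10 ha1] := growth_ratio d (ler0n R j).
have mp : measurable_fun setT (fun x : tw => pz sg (ev x) * det2 h : RR).
  by apply: measurable_funM => //; exact: measurable_pz.
have [mP1 mP2] : measurable [set x : tw | kap <= pz sg (ev x) * det2 h] /\
    measurable [set x : tw | pz sg (ev x) * det2 h < kap].
  by split; [exact: measurable_ge_set|exact: measurable_lt_set].
have fin A : measurable A -> muz A \is a fin_num.
  by move=> mA; rewrite ge0_fin_numE// (le_lt_trans _ (ltry 1))// -muzT le_measure ?inE.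
set p := fine (muz [set x | (kap <= pz sg (ev x) * det2 h)%R]).
have pE : muz [set x | (kap <= pz sg (ev x) * det2 h)%R] = p%:E by rewrite fineK// fin.
have -> : muz [set z | (pz sg (ev z) * det2 h < kap)%R] = (1 - p)%:E.
  set P2 := [set x | (_ < _)%R] in mP2 *.
  have dis : [set x : tw | kap <= pz sg (ev x) * det2 h] `&` P2 = set0.
    by apply/seteqP; split => // x /= [h1 h2]; move: (le_lt_trans h1 h2); rewrite ltxx.
  have e1 : muz setT = (muz [set x | (kap <= pz sg (ev x) * det2 h)%R] + muz P2)%E.
    rewrite -(measureU muz mP1 mP2 dis); congr (muz _); apply/seteqP; split => // x _.
    by rewrite /P2 /=; case: (leP kap (pz sg (ev x) * det2 h)); [left|right].
  move: e1; rewrite muzT pE -(fineK (fin _ mP2)) -EFinD => -[->].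
  by rewrite addrAC subrr add0r.
rewrite -leeBlDr// -EFinB; apply: limsup_pinfty_ge => M.
(* The density is a limsup, so cubes holding more than g a^d points exist beyond any bound; such
   cubes suffice for a lower bound on the limsup of the error. *)
have [a Ma ga] := limsup_pinfty_gt dS (Num.max M a1).
move: Ma; rewrite gt_max => /andP[Ma a1a]; exists a => //.
have a0 := lt_trans a10 a1a; have ad0 : 0 < a ^+ d by rewrite exprn_gt0.
set A := fset_set (S `&` cube a); have AE s : s \in A -> (S `&` cube a) s.
  by move=> sA; have := sA; rewrite /A in_fset_set// inE.
rewrite cnt_fset// -/A -EFinM lte_fin ltr_pdivlMr// in ga.
set N := (size A)%:R in ga; have N0 : 0 < N by apply: lt_trans ga; rewrite mulr_gt0.
have sz0 : (0 < size A)%N by rewrite -(ltr0n R).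
rewrite pe_avg_fset// -/A.
set v := fun s => fine (muz [set x | vor h A s (ev x)]).
have vE s : muz [set x | vor h A s (ev x)] = (v s)%:E.
  by rewrite fineK// fin//; exact: measurable_vor.
apply: (@le_trans _ _ ((\sum_(s <- A) (1 - v s))%:E * (N^-1)%:E)%E); last first.
  apply: lee_wpmul2r; first by rewrite lee_fin invr_ge0 ltW.
  rewrite -sumEFin big_seq [leRHS]big_seq; apply: lee_sum => s sA.
  by rewrite EFinB -vE; apply: pe_point_ge => s' /AE[].
rewrite -EFinM lee_fin ler_pdivlMr//.
have sv : \sum_(s <- A) v s <= N * (p + eta) + g * eta * a ^+ d.
  pose Lw s := Lam [set x | vor h A s (ev x) /\ (forall k, (cabs2 (ev x k) < j%:R * cabs2 (h k))%R)].
  rewrite -lee_fin -sumEFin.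
  apply: (@le_trans _ _ (\sum_(s <- A) ((p + eta)%:E + (kap / det2 h)%:E * Lw s))%E).
    apply: lee_sum => s _; rewrite -vE; apply: le_trans (vor_prob_le A s j%:R d0 kap0) _.
    by rewrite pE EFinD; apply: leeD => //; apply: leeD.
  rewrite big_split /= [leRHS]EFinD; apply: leeD.
    by rewrite sumEFin big_const_seq count_predT iter_addr addr0 mulr_natl.
  rewrite -ge0_sume_distrr; last by move=> s _; exact: measure_ge0.
  have Ac : {in A, forall s, cube a s} by move=> s /AE[].
  apply: le_trans (lee_wpmul2l _ (vor_volume d0 (fset_uniq _) a0 j1 Ac)) _.
    by rewrite lee_fin divr_ge0 ?ltW.
  rewrite -EFinM lee_fin mulrA divfK ?gt_eqF// /kap.
  apply: le_trans (ler_wpM2l (ltW kap0) (ha1 _ (ltW a1a))) _.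
  by rewrite le_eqVlt /kap; apply/orP; left; apply/eqP; field.
rewrite big_split /= sumrN big_const_seq count_predT iter_addr addr0 -/N.
have h2 : g * eta * a ^+ d <= N * eta.
  by rewrite mulrAC ler_wpM2r ?ltW.
move: sv h2; move: (g * eta * a ^+ d) (\sum_(s <- A) v s) => x y; clear; rewrite /N => h1 h2.
lra.
Qed.

End Converse.

Lemma converse (R : realType) (T : finType) (s eta g : R) (S : set (T -> R * R)) : 0 < s ->
  0 < eta -> IC S -> 0 < g -> (g%:E < density S)%E ->
  (joint s T [set x | (normc s T - ln (g * (eta / 2)) < infd s x)%R] <=
     pe_IC (2 * s ^+ 2) S + (2 * eta)%:E)%E.
Proof.
move=> s0 eta0 iS g0 dS; set kap := g * (eta / 2).
have kap0 : 0 < kap by rewrite mulr_gt0// divr_gt0.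
rewrite (@joint_infd R T s kap s0 kap0).
set muz := towm (gauss2 s) (enum T); set muh := towm _ (enum T).
pose D (h : T -> R * R) := muz [set z | (0 < det2 h)%R /\ (pz s (ev z) * det2 h < kap)%R].
have [mD _] := joint_section (P := fun h z => 0 < det2 h /\ pz s z * det2 h < kap) s
  (@measurable_layer R T s kap).
(* A measurable minorant of the limsup of the error, cut at 0 so that the comparison of nonnegative
   integrands in [gexp_le] applies. *)
pose G (h : T -> R * R) := maxe (D h - (2 * eta)%:E)%E 0%E.
have mG : measurable_fun setT (fun h : tow R (enum T) => G (ev h)).
  apply: measurable_maxe => //; apply: emeasurable_funB => //.
have DG h : (D h <= G h + (2 * eta)%:E)%E.
  by rewrite -leeBlDr// /G le_max lexx.
have G0 h : (0 <= G h)%E by rewrite /G le_max lexx orbT.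
apply: (@le_trans _ _ (\int[muh]_h (G (ev h) + (2 * eta)%:E))%E).
  by apply: ge0_le_integralT => h; [exact: measure_ge0|exact: DG].
rewrite ge0_integralD//; last by move=> h _; rewrite lee_fin mulr_ge0// ltW.
rewrite (prob_cst _ (towmT (enum T) (gauss2T _))); apply: leeD => //.
rewrite /pe_IC /CNexp -/muh -(@gexpE R T (enum T) (Num.sqrt (1 / 2)) G)//.
apply: gexp_le => // h.
have L0 : (0 <= limsup_pinfty (pe_avg (2 * s ^+ 2) S h))%E.
  by apply: limsup_pinfty_ge => M; exists (M + 1); [rewrite ltrDl|exact: pe_avg_ge0].
rewrite /G ge_max L0 andbT leeBlDr//.
have [d0|d0] := ltP 0 (det2 h).
  rewrite /D (_ : [set z | _] = [set z | pz s (ev z) * det2 h < kap]).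
    exact: converse_fixed.
  by apply/seteqP; split => z /= [].
rewrite /D (_ : [set z | _] = set0) ?measure0.
  by rewrite adde_ge0// lee_fin mulr_ge0// ltW.
by apply/seteqP; split => // z /= []; rewrite ltNge d0.
Qed.

(** * Achievability *)

Section RandomCoding.
Variable R : realType.
Notation RR := (measurableTypeR R).
Notation C := (RR * RR)%type.
Variable T : finType.
Notation ks := (enum T).
Notation tw := (tow R ks).
Notation pt := (T -> R * R).
Notation Lam := (towm (leb2 R) ks).
Variable s : R.
Hypothesis s0 : 0 < s.
Notation muz := (towm (gauss2 s) ks).
Notation muh := (towm (gauss2 (Num.sqrt (1 / 2))) ks).
Notation jt := (joint s T).

Definition rot (h u : pt) (z : pt) : pt := fun i => Defs.cadd (cmul (h i) (u i)) (z i).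

Definition badp (kap : R) (h z : pt) : Prop := pz s z * det2 h < kap.
Definition confuse (kap : R) (u h z : pt) : Prop :=
  kap <= pz s z * det2 h /\ vnorm2 (rot h u z) <= vnorm2 z.
(** If a competitor differs by u with |u_t| >= gp, then |h u + z| <= |z| forces |h_t| gp <= 2 |z|.
    This event, independent of the competitor, covers all confusions across the guard band. *)
Definition far (gp : R) (h z : pt) : Prop :=
  exists t, cabs2 (h t) * gp ^+ 2 <= 4 * vnorm2 z.

Lemma vnorm2_ge0 (z : pt) : 0 <= vnorm2 z.
Proof. by apply: sumr_ge0 => k _; exact: cabs2_ge0. Qed.

Lemma pz_expR (z : pt) :
  pz s z = expR (- (#|T|%:R * ln (pi * (2 * s ^+ 2))) - vnorm2 z / (2 * s ^+ 2)).
Proof.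
have gen (l : seq T) : \prod_(k <- l) pdf2 s (z k) =
    expR (- ((size l)%:R * ln (pi * (2 * s ^+ 2))) - (\sum_(k <- l) cabs2 (z k)) / (2 * s ^+ 2)).
  elim: l => [|k l IH].
    by rewrite !big_nil /= [X in expR X](_ : _ = 0) ?expR0//; ring.
  rewrite !big_cons IH pdf2E// -expRD /= -natr1; congr expR.
  by field; rewrite gt_eqF.
by rewrite /pz gen -cardE /vnorm2 -[in RHS]big_enum.
Qed.

Lemma pz_anti (z w : pt) : vnorm2 w <= vnorm2 z -> pz s z <= pz s w.
Proof.
move=> wz; rewrite !pz_expR ler_expR lerD2l lerN2 ler_wpM2r// invr_ge0.
by rewrite mulr_ge0// sqr_ge0.
Qed.

Lemma pz_gt0 (z : pt) : 0 < pz s z.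
Proof. by rewrite pz_expR expR_gt0. Qed.

Lemma measurable_vnorm2_ev : measurable_fun setT (fun x : tw => vnorm2 (ev x) : RR).
Proof. exact: (@measurable_vnorm2 R T (fun k u => u) (fun k => @measurable_id _ _ _)). Qed.

(* The density is at least [pz z] on the ball through [z] and integrates to one. *)
Lemma ball_volume (z : pt) :
  ((pz s z)%:E * Lam [set w | (vnorm2 (ev w) <= vnorm2 z)%R] <= 1)%E.
Proof.
set D := [set w | _]; have mD : measurable D.
  by apply: measurable_le_set; exact: measurable_vnorm2_ev.
have mI : measurable_fun setT (fun x : tw => (\1_D x : R)%:E).
  by apply/measurable_EFinP; exact: measurable_indic.
have I0 (x : tw) : (0 <= (\1_D x : R)%:E)%E by rewrite lee_fin.
rewrite -[X in Lam X]setIT -(integral_indic _ measurableT)// -(ge0_intZl Lam mI I0 (pz_ge0 s z)).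
have m1 : measurable_fun setT ((fun=> 1%E) : tw -> \bar R) by exact: measurable_cst.
rewrite -(prob_cst 1%E (towmT ks (gauss2T s))).
rewrite (towm_gauss_density s (enum_uniq T) m1 (fun=> lee01)).
apply: ge0_le_integralT => w; first by rewrite -EFinM lee_fin mulr_ge0// pz_ge0.
rewrite mule1 -EFinM lee_fin indicE -/(pz s (ev w)).
have [|_] := boolP (w \in D); last by rewrite mulr0 pz_ge0.
by rewrite inE => wD; rewrite mulr1 pz_anti.
Qed.

Lemma measurable_cmulC d (X : measurableType d) (f g : X -> C) :
  measurable_fun setT f -> measurable_fun setT g ->
  measurable_fun setT (fun x => cmul (f x) (g x) : C).
Proof.
move=> mf mg.
have [f1 f2] : measurable_fun setT (fun x => (f x).1 : RR) /\ measurable_fun setT (fun x => (f x).2 : RR).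
  by split; [exact: (measurableT_comp measurable_fst mf)|exact: (measurableT_comp measurable_snd mf)].
have [g1 g2] : measurable_fun setT (fun x => (g x).1 : RR) /\ measurable_fun setT (fun x => (g x).2 : RR).
  by split; [exact: (measurableT_comp measurable_fst mg)|exact: (measurableT_comp measurable_snd mg)].
apply: measurable_fun_pair.
  by apply: measurable_funB; exact: measurable_funM.
by apply: measurable_funD; exact: measurable_funM.
Qed.

Lemma measurable_caddC d (X : measurableType d) (f g : X -> C) :
  measurable_fun setT f -> measurable_fun setT g ->
  measurable_fun setT (fun x => Defs.cadd (f x) (g x) : C).
Proof.
move=> mf mg.
have [f1 f2] : measurable_fun setT (fun x => (f x).1 : RR) /\ measurable_fun setT (fun x => (f x).2 : RR).
  by split; [exact: (measurableT_comp measurable_fst mf)|exact: (measurableT_comp measurable_snd mf)].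
have [g1 g2] : measurable_fun setT (fun x => (g x).1 : RR) /\ measurable_fun setT (fun x => (g x).2 : RR).
  by split; [exact: (measurableT_comp measurable_fst mg)|exact: (measurableT_comp measurable_snd mg)].
by apply: measurable_fun_pair; exact: measurable_funD.
Qed.

Lemma measurable_vnorm2_rot d (X : measurableType d) (f g w : X -> tw) :
  measurable_fun setT f -> measurable_fun setT g -> measurable_fun setT w ->
  measurable_fun setT (fun x => vnorm2 (rot (ev (f x)) (ev (g x)) (ev (w x))) : RR).
Proof.
move=> mf mg mw; apply: measurable_sum => k.
apply: (@measurableT_comp _ _ _ _ _ _ (fun u : C => cabs2 u : RR) _
  (fun x => rot (ev (f x)) (ev (g x)) (ev (w x)) k : C)).
  exact: measurable_cabs2.
have m (q : X -> tw) : measurable_fun setT q -> measurable_fun setT (fun x => ev (q x) k : C).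
  by move=> mq; exact: (measurableT_comp (measurable_ev k) mq).
apply: (@measurable_caddC _ X (fun x => cmul (ev (f x) k) (ev (g x) k)) (fun x => ev (w x) k)).
  by apply: (@measurable_cmulC _ X (fun x => ev (f x) k) (fun x => ev (g x) k)); exact: m.
exact: m.
Qed.

(** A point of the tower representing a given vector, so that measurable sets of the product can be
    sliced at a fixed fading or at a fixed difference. *)
Fixpoint tcst (c : pt) (l : seq T) : tow R l :=
  match l as l return tow R l with
  | [::] => tt
  | k :: l' => (c k, tcst c l')
  end.

Lemma ev_tcst (c : pt) : ev (tcst c ks) = c.
Proof.
apply/funext => j; have : j \in ks by rewrite mem_enum.
elim: (enum T) => // k l IH; rewrite inE /=.
by case: eqP => [->|_] //= /IH.
Qed.

Lemma measurable_badp (kap : R) : measurable [set x : (tw * tw)%type | badp kap (ev x.1) (ev x.2)].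
Proof.
apply: (@measurable_lt_set _ _ R (fun x : (tw * tw)%type => pz s (ev x.2) * det2 (ev x.1))).
apply: measurable_funM; first exact: (measurableT_comp (measurable_pz s) measurable_snd).
exact: (measurableT_comp (@measurable_det2 R T) measurable_fst).
Qed.

Lemma measurable_confuse d (X : measurableType d) (kap : R) (f g w : X -> tw) :
  measurable_fun setT f -> measurable_fun setT g -> measurable_fun setT w ->
  measurable [set x | confuse kap (ev (g x)) (ev (f x)) (ev (w x))].
Proof.
move=> mf mg mw; apply: measurableI.
  apply: (@measurable_ge_set _ _ R (fun x => pz s (ev (w x)) * det2 (ev (f x)))).
  apply: measurable_funM; first exact: (measurableT_comp (measurable_pz s) mw).
  exact: (measurableT_comp (@measurable_det2 R T) mf).
apply: (measurable_cmp_set _ _).2; first exact: measurable_vnorm2_rot.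
exact: (measurableT_comp measurable_vnorm2_ev mw).
Qed.

Lemma measurable_far (gp : R) : measurable [set x : (tw * tw)%type | far gp (ev x.1) (ev x.2)].
Proof.
pose P (t : T) (x : (tw * tw)%type) := 4 * vnorm2 (ev x.2) < cabs2 (ev x.1 t) * gp ^+ 2.
rewrite (_ : mkset _ = ~` [set x | all (P^~ x) ks]); last first.
  apply/seteqP; split => x /=.
    by move=> [t ht] /allP/(_ t); rewrite mem_enum /P ltNge ht => /(_ isT).
  by move=> /negP/allPn[t _]; rewrite /P -leNgt => ht; exists t.
apply: measurableC; apply: measurable_all => t; apply: (measurable_cmp_set _ _).1.
  apply: measurable_funM => //.
  exact: (measurableT_comp measurable_vnorm2_ev measurable_snd).
apply: measurable_funM => //.
exact: (measurableT_comp (measurable_ev_fun t (@measurable_cabs2 R)) measurable_fst).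
Qed.

Lemma det2_measurable_confuse (kap : R) (u : pt) :
  measurable [set x : (tw * tw)%type | confuse kap u (ev x.1) (ev x.2)].
Proof.
have := @measurable_confuse _ (tw * tw)%type kap fst (fun=> tcst u ks) snd measurable_fst
  (@measurable_cst _ _ _ _ _ _) measurable_snd.
by rewrite ev_tcst.
Qed.

Definition pairwise_err (kap : R) (u : pt) : \bar R :=
  jt [set x | confuse kap u (ev x.1) (ev x.2)].

Lemma translate_ball (h z : pt) : 0 < det2 h ->
  (Lam [set u | (vnorm2 (rot h (ev u) z) <= vnorm2 z)%R] =
   ((det2 h)^-1)%:E * Lam [set w | (vnorm2 (ev w) <= vnorm2 z)%R])%E.
Proof.
move=> d0; have h0 := det2_gt0 d0.
set D := [set w | (vnorm2 (ev w) <= _)%R]; have mD : measurable D.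
  by apply: measurable_le_set; exact: measurable_vnorm2_ev.
pose phi (k : T) (u : C) : C := Defs.cadd (cmul (h k) u) (z k).
have mphi k : measurable_fun setT (phi k).
  apply: measurable_caddC; last exact: measurable_cst.
  by apply: measurable_cmulC; [exact: measurable_cst|exact: measurable_id].
have mI : measurable_fun setT (fun x : tw => (\1_D x : R)%:E).
  by apply/measurable_EFinP; exact: measurable_indic.
have mtm : measurable_fun setT (@tmap R T phi ks) := measurable_tmap mphi.
have -> : [set u | (vnorm2 (rot h (ev u) z) <= vnorm2 z)%R] = @tmap R T phi ks @^-1` D.
  apply/seteqP; split => u; rewrite /D /= (_ : ev (tmap phi u) = rot h (ev u) z)//;
    by apply/funext => k; rewrite ev_tmap// mem_enum.
have mpre : measurable (@tmap R T phi ks @^-1` D).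
  by rewrite -[X in measurable X]setTI; exact: mtm.
rewrite -[X in Lam X = _]setIT -(integral_indic _ measurableT)//.
rewrite -[X in (_ * Lam X)%E]setIT -(integral_indic _ measurableT)//.
transitivity (\int[Lam]_u (\1_D (tmap phi u) : R)%:E)%E.
  by apply: eq_integral => u _; rewrite !indicE; congr (_%:R)%:E; apply/idP/idP; rewrite !inE.
rewrite (@integral_tmap R T (leb2 R) phi (fun k => (cabs2 (h k))^-1) ks (fun x => (\1_D x)%:E))//.
- by congr (_%:E * _)%E; rewrite /det2 prodfV.
- by move=> k; rewrite invr_ge0 ltW.
- move=> k f mf f0; apply: leb2_affine => //.
  by apply: contraTneq (h0 k) => ->; rewrite /cabs2 /= expr0n addr0 ltxx.
Qed.

Lemma mule_inv_le (p d k : R) (v : \bar R) : 0 < p -> 0 < d -> 0 < k -> k <= p * d ->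
  (p%:E * v <= 1 -> (d^-1)%:E * v <= (k^-1)%:E)%E.
Proof.
move=> p0 d0 k0 kpd pv; rewrite (_ : d^-1 = d^-1 * p^-1 * p); last first.
  by rewrite mulfVK ?gt_eqF.
rewrite EFinM -muleA; apply: (@le_trans _ _ ((d^-1 * p^-1)%:E * 1)%E).
  by apply: lee_wpmul2l => //; rewrite lee_fin mulr_ge0// invr_ge0 ltW.
by rewrite mule1 lee_fin -invfM lef_pV2 ?posrE ?mulr_gt0// mulrC.
Qed.

(** Tonelli moves the integral over u inside. For fixed h and z the confusing u form a preimage of
    the ball of radius |z|, of volume 1 / det times that of the ball, and [ball_volume] bounds it by
    1 / (p(z) det) <= 1 / kap. *)
Lemma pairwise_err_integral (kap : R) : 0 < kap ->
  measurable_fun setT (fun u : tw => pairwise_err kap (ev u)) /\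
  (\int[Lam]_u pairwise_err kap (ev u) <= (kap^-1)%:E)%E.
Proof.
move=> k0; pose E := [set x : (tw * (tw * tw))%type | confuse kap (ev x.1) (ev x.2.1) (ev x.2.2)].
have mE : measurable E.
  apply: (@measurable_confuse _ (tw * (tw * tw))%type kap (fun x => x.2.1) fst (fun x => x.2.2)) => //.
  - exact: (measurableT_comp measurable_fst measurable_snd).
  - exact: (measurableT_comp measurable_snd measurable_snd).
have sec u : pairwise_err kap (ev u) = jt (xsection E u).
  by rewrite /pairwise_err; congr (jt _); apply/seteqP; split => x; rewrite /xsection /= inE.
split; first by apply: eq_measurable_fun (measurable_fun_xsection jt mE) => u _; rewrite sec.
have -> : (\int[Lam]_u pairwise_err kap (ev u) = sprod Lam jt E)%E.
  by rewrite /sprod /= /product_measure1; apply: eq_integral => u _; rewrite sec.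
have mIE : measurable_fun setT (fun x => (\1_E x : R)%:E).
  by apply/measurable_EFinP; exact: measurable_indic.
rewrite -[X in sprod _ _ X]setIT -(integral_indic _ measurableT)//.
rewrite sprod_tonelli2//.
apply: (@le_trans _ _ (\int[jt]_x (kap^-1)%:E)%E); last first.
  by rewrite (prob_cst _ (jointT s T)).
apply: ge0_le_integralT => x; first exact: integral_ge0.
have [kx|kx] := leP kap (pz s (ev x.2) * det2 (ev x.1)); last first.
  rewrite integral0_eq ?lee_fin ?invr_ge0 ?(ltW k0)// => u _.
  by rewrite indicE memNset// /E /confuse /= => -[]; rewrite leNgt kx.
have pd0 := lt_le_trans k0 kx.
have d0 : 0 < det2 (ev x.1) by rewrite -(pmulr_rgt0 _ (pz_gt0 (ev x.2))).
have mD : measurable [set u : tw | vnorm2 (rot (ev x.1) (ev u) (ev x.2)) <= vnorm2 (ev x.2)].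
  apply: measurable_le_set.
  by apply: (@measurable_vnorm2_rot _ tw (fun=> x.1) id (fun=> x.2)) => //; exact: measurable_cst.
rewrite (_ : (\int[Lam]_u _ = Lam [set u | (vnorm2 (rot (ev x.1) (ev u) (ev x.2)) <= vnorm2 (ev x.2))%R])%E); last first.
  rewrite -[X in _ = Lam X]setIT -(integral_indic _ measurableT)//.
  apply: eq_integral => u _; rewrite !indicE.
  apply: (f_equal (fun b : bool => (b%:R : R)%:E)); apply/idP/idP.
    by rewrite !inE /E /confuse /= => -[].
  by rewrite !inE /E /confuse /=.
rewrite translate_ball//.
have := ball_volume (ev x.2); set v := Lam _ => hv.
exact: (mule_inv_le (pz_gt0 (ev x.2)) d0 k0 kx hv).
Qed.

(** Used with e = 1 and e = -1, for the differences x - c and c - x. *)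
Definition tshift (e : R) (c : pt) (k : T) (u : C) : C := Defs.cadd (cmul (e, 0) u) (c k).

Lemma Lam_translate (e : R) (c : pt) (F : tw -> \bar R) : e ^+ 2 = 1 ->
  measurable_fun setT F -> (forall x, 0 <= F x)%E ->
  (\int[Lam]_x F (tmap (tshift e c) x) = \int[Lam]_x F x)%E.
Proof.
move=> e1 mF F0; rewrite (@integral_tmap R T (leb2 R) _ (fun=> 1) ks F)//.
- by rewrite big1// mul1e.
- move=> k; apply: measurable_caddC; last exact: measurable_cst.
  by apply: measurable_cmulC; [exact: measurable_cst|exact: measurable_id].
- move=> k f mf f0; rewrite (@leb2_affine R (e, 0) (c k) f)//.
    by rewrite /cabs2 /= e1 expr0n addr0 invr1.
  by apply/eqP => -[e0]; move: e1; rewrite e0 expr0n => /eqP; rewrite eq_sym oner_eq0.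
Qed.

Lemma avoid_finite_null (l : seq pt) : (0 < #|T|)%N ->
  Lam.-negligible [set x : tw | ev x \in l].
Proof.
move=> /card_gt0P[t _]; elim: l => [|c l IH].
  by apply: (negligibleS _ (negligible_set0 _)) => x.
pose N := [set x : tw | [set (c t : C)] (ev x t)].
have mc : measurable [set (c t : C)].
  rewrite (_ : [set _] = [set ((c t).1 : RR)] `*` [set ((c t).2 : RR)]).
    by apply: measurableX; exact: measurable_set1.
  by case: (c t) => a b; apply/seteqP; split => -[a' b'] /=; [move=> [-> ->]|move=> [-> ->]].
have N0 : Lam.-negligible N.
  exists N; split => //.
    by rewrite -[X in measurable X]setTI; exact: (measurable_ev t measurableT mc).
  apply: (@towm_null R T (leb2 R) ks t _ _ mc); first by rewrite mem_enum.
  rewrite (_ : [set _] = [set ((c t).1 : RR)] `*` [set ((c t).2 : RR)]); last first.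
    by case: (c t) => a b; apply/seteqP; split => -[a' b'] /=; [move=> [-> ->]|move=> [-> ->]].
  have ms (a : R) : measurable [set (a : RR)] := measurable_set1 (a : R).
  apply: (etrans (product_measure1E _ _ (ms _) (ms _))).
  have e1 := @lebesgue_measure_set1 R (c t).1.
  by apply: (etrans (f_equal (fun z => z * _)%E e1)); rewrite mul0e.
apply: (negligibleS _ (negligibleU N0 IH)) => x /=; rewrite inE => /orP[/eqP xc|xl]; [left|by right].
by rewrite /N /= xc.
Qed.

(** * Choosing a code point by point in a cube *)

Section Greedy.
Variables (F : pt -> \bar R) (B b : R).
Hypothesis T0 : (0 < #|T|)%N.
Hypothesis mF : measurable_fun setT (fun u : tw => F (ev u)).
Hypothesis F0 : forall u, (0 <= F u)%E.
Hypothesis B0 : 0 < B.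
Hypothesis b0 : 0 < b.
Hypothesis FB : (\int[Lam]_u F (ev u) <= B%:E)%E.

Definition psub (x y : pt) : pt := fun i => csub (x i) (y i).

(** Averaging over the cube: the sum integrates to at most 2 B times the size of [l]. The constant 4
    instead of 2 makes the contradiction strict, and the points of [l] can be avoided because they
    form a null set. Both differences are counted since the new point acts both as sender and as
    competitor. *)
Lemma select_point (l : seq pt) : exists x, [/\ cube b x, x \notin l &
  (\sum_(c <- l) (F (psub x c) + F (psub c x)) <= (4 * B * (size l)%:R / b ^+ (2 * #|T|))%:E)%E].
Proof.
have [->|l0] := eqVneq l [::].
  exists (fun=> (0, 0)); split => //; first by move=> i /=; rewrite normr0 divr_gt0.
  by rewrite big_nil /= mulr0 mul0r.
apply: contrapT => H; pose th := 4 * B * (size l)%:R / b ^+ (2 * #|T|).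
have bd0 : 0 < b ^+ (2 * #|T|) by rewrite exprn_gt0.
have sl0 : (0 : R) < (size l)%:R by rewrite ltr0n lt0n size_eq0.
have th0 : 0 < th by rewrite divr_gt0// !mulr_gt0.
pose G (u : tw) := (\sum_(c <- l) (F (psub (ev u) c) + F (psub c (ev u))))%E.
have evs (e : R) (c : pt) (u : tw) : ev (tmap (tshift e c) u) = (fun i => Defs.cadd (cmul (e, 0) (ev u i)) (c i)).
  by apply/funext => k; rewrite ev_tmap// mem_enum.
have mts (e : R) (c : pt) : measurable_fun setT (fun u : tw => F (ev (tmap (tshift e c) u))).
  apply: (measurableT_comp mF); apply: measurable_tmap => k.
  apply: measurable_caddC; last exact: measurable_cst.
  by apply: measurable_cmulC; [exact: measurable_cst|exact: measurable_id].
have E1 (c : pt) (u : tw) : F (psub (ev u) c) = F (ev (tmap (tshift 1 (fun i => csub (0, 0) (c i))) u)).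
  rewrite evs; congr F; apply/funext => i; rewrite /psub /Defs.cadd /cmul /csub /=.
  by congr (_, _); ring.
have E2 (c : pt) (u : tw) : F (psub c (ev u)) = F (ev (tmap (tshift (-1) c) u)).
  rewrite evs; congr F; apply/funext => i; rewrite /psub /Defs.cadd /cmul /csub /=.
  by congr (_, _); ring.
have m1 c : measurable_fun setT (fun u : tw => F (psub (ev u) c)) by rewrite (funext (E1 c)).
have m2 c : measurable_fun setT (fun u : tw => F (psub c (ev u))) by rewrite (funext (E2 c)).
have intG : (\int[Lam]_u G u <= (2 * B * (size l)%:R)%:E)%E.
  rewrite /G ge0_integral_sum//; last 2 first.
  - by move=> c; exact: emeasurable_funD.
  - by move=> c u _; exact: adde_ge0.
  apply: (@le_trans _ _ (\sum_(c <- l) (2 * B)%:E)%E); last first.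
    by rewrite sumEFin big_const_seq count_predT iter_addr addr0 mulr_natr.
  apply: lee_sum => c _; rewrite ge0_integralD//.
  under eq_integral do rewrite E1.
  under [X in (_ + X)%E]eq_integral do rewrite E2.
  rewrite (Lam_translate _ (expr1n _ _) mF)// (Lam_translate c _ mF)//; last by rewrite sqrrN expr1n.
  by rewrite mulr_natl mulr2n EFinD leeD.
have [N [mN N0 lN]] := avoid_finite_null l T0.
have [mb vb] := @box_volume R T b b0.
have mbN : measurable (@box R T b `\` N) by exact: measurableD.
have vbN : ((b ^+ (2 * #|T|))%:E <= Lam (@box R T b `\` N))%E.
  rewrite -vb -(measureU0 mbN mN N0); apply: le_measure; rewrite ?inE//; first exact: measurableU.
  by move=> u bu; have [Nu|Nu] := pselect (N u); [right|left].
have : (th%:E * (b ^+ (2 * #|T|))%:E <= (2 * B * (size l)%:R)%:E)%E.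
  apply: le_trans intG; apply: (@le_trans _ _ (th%:E * Lam (@box R T b `\` N))%E).
    by apply: lee_wpmul2l => //; rewrite lee_fin ltW.
  have mI : measurable_fun setT (fun x : tw => (\1_(@box R T b `\` N) x : R)%:E).
    by apply/measurable_EFinP; exact: measurable_indic.
  have I0 (x : tw) : (0 <= (\1_(@box R T b `\` N) x : R)%:E)%E by rewrite lee_fin.
  rewrite -[X in Lam X]setIT -(integral_indic _ measurableT)// -(ge0_intZl Lam mI I0 (ltW th0)).
  apply: ge0_le_integralT => u; first by rewrite -EFinM lee_fin mulr_ge0// ltW.
  rewrite -EFinM indicE; have [|_] := boolP (u \in _); last first.
    by rewrite mulr0; apply: sume_ge0 => c _; exact: adde_ge0.
  rewrite inE mulr1 => -[bu Nu]; rewrite leNgt; apply/negP => Gu; apply: H.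
  exists (ev u); split; [exact: bu| |exact: ltW].
  by apply/negP => ul; apply: Nu; exact: lN.
rewrite -EFinM lee_fin divfK ?gt_eqF// leNgt => /negP; apply.
rewrite -subr_gt0 (_ : _ - _ = 2 * (B * (size l)%:R)); last by ring.
by rewrite !mulr_gt0.
Qed.

(** The point added to M others costs at most 4 B M / b^d, where d = 2 |T|, and 2 M^2 + 4 M <= 2 (M
    + 1)^2. *)
Lemma random_code (M : nat) : exists l : seq pt, [/\ size l = M, uniq l,
  {in l, forall c, cube b c} &
  (\sum_(x <- l) \sum_(y <- l | y != x) F (psub x y)
     <= (2 * B * M%:R ^+ 2 / b ^+ (2 * #|T|))%:E)%E].
Proof.
have bd0 : 0 < b ^+ (2 * #|T|) by rewrite exprn_gt0.
elim: M => [|M [l [sl ul cl hl]]].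
  by exists [::]; split => //; rewrite big_nil lee_fin divr_ge0 ?(ltW bd0)// mulr_ge0 ?sqr_ge0// mulr_ge0// ltW.
have [z [cz zl hz]] := select_point l.
exists (z :: l); split; rewrite /= ?sl ?zl//.
  by move=> c; rewrite inE => /orP[/eqP ->//|]; exact: cl.
have -> : (\sum_(x <- z :: l) \sum_(y <- z :: l | y != x) F (psub x y) =
   \sum_(c <- l) (F (psub z c) + F (psub c z)) + \sum_(x <- l) \sum_(y <- l | y != x) F (psub x y))%E.
  rewrite big_cons big_cons eqxx /= big_split /= -addeA; congr (_ + _)%E.
    rewrite big_seq_cond [RHS]big_seq_cond; apply: eq_bigl => y.
    rewrite andbT; case: (boolP (y \in l)) => //= yl; apply/eqP => yz.
    by move: zl; rewrite -yz yl.
  rewrite -big_split /= big_seq [RHS]big_seq; apply: eq_bigr => x xl.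
  rewrite big_cons ifT//; apply: contra zl => /eqP -> //.
rewrite sl in hz; apply: le_trans (leeD hz hl) _; rewrite -EFinD lee_fin -mulrDl.
rewrite ler_wpM2r ?invr_ge0 ?(ltW bd0)// -natr1 -subr_ge0.
rewrite (_ : _ - _ = 2 * B); last by ring.
by rewrite mulr_ge0// ltW.
Qed.

End Greedy.

Lemma measure_exists_le d (X : measurableType d) (mu : {measure set X -> \bar R})
    (I : eqType) (l : seq I) (Q : pred I) (P : I -> set X) :
  (forall i, measurable (P i)) ->
  measurable [set x | exists2 i, i \in l & Q i /\ P i x] /\
  (mu [set x | exists2 i, i \in l & Q i /\ P i x] <= \sum_(i <- l | Q i) mu (P i))%E.
Proof.
move=> mP; elim: l => [|i l [mU IH]].
  rewrite (_ : mkset _ = set0); last by apply/seteqP; split => // x [].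
  by rewrite measure0 big_nil.
set U := mkset _ in mU IH; pose V := if Q i then P i else set0.
have mV : measurable V by rewrite /V; case: ifP.
have -> : [set x | exists2 j, j \in i :: l & Q j /\ P j x] = V `|` U.
  apply/seteqP; split => x /=.
    move=> [j]; rewrite inE => /orP[/eqP ->|jl] [Qj Pj]; first by left; rewrite /V Qj.
    by right; exists j.
  move=> [|[j jl QP]]; last by exists j => //; rewrite inE jl orbT.
  by rewrite /V; case: ifP => // Qi Px; exists i => //; rewrite inE eqxx.
split; first exact: measurableU.
apply: le_trans (measureU2 _ mV mU) _; rewrite big_cons /V; case: ifP => _; first exact: leeD.
by rewrite measure0 add0e.
Qed.

(** * Periodic repetition of the code and its error probability *)

Section Lattice.
Variables (l : seq pt) (b gp kap : R).
Hypothesis T0 : (0 < #|T|)%N.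
Hypothesis b0 : 0 < b.
Hypothesis gp0 : 0 < gp.
Hypothesis ul : uniq l.
Hypothesis cl : {in l, forall c, cube b c}.
Hypothesis l0 : (0 < size l)%N.
Notation b' := (b + gp).
Notation lab := {ffun T * bool -> int}.

(** A label carries one integer per real coordinate, [false] for real and [true] for imaginary
    parts. The period b + gp leaves a guard band of width gp between copies of the cube. *)
Definition lat (c : pt) (k : lab) : pt := fun t =>
  ((c t).1 + b' * (k (t, false))%:~R, (c t).2 + b' * (k (t, true))%:~R).

Definition constel : set pt := [set x | exists2 c, c \in l & exists k : lab, x = lat c k].

Definition coo (x : pt) (p : T * bool) : R := if p.2 then (x p.1).2 else (x p.1).1.

Lemma coo_lat c k p : coo (lat c k) p = coo c p + b' * (k p)%:~R.
Proof. by case: p => t []. Qed.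

Lemma cube_coo a x : cube a x <-> forall p, `|coo x p| < a / 2.
Proof.
split => [H [t []]|H t]; [exact: (H t).2|exact: (H t).1|].
by split; [exact: (H (t, false))|exact: (H (t, true))].
Qed.

Lemma coo_inj x y : (forall p, coo x p = coo y p) -> x = y.
Proof.
move=> H; apply/funext => t; have := H (t, false); have := H (t, true).
by rewrite /coo /=; case: (x t) (y t) => [x1 x2] [y1 y2] /= -> ->.
Qed.

Lemma bg0 : 0 < b'. Proof. exact: addr_gt0. Qed.

Lemma lat_gap c c' (k k' : lab) p : c \in l -> c' \in l -> k p != k' p ->
  gp <= `|coo (lat c k) p - coo (lat c' k') p|.
Proof.
move=> /cl/cube_coo/(_ p) cb /cl/cube_coo/(_ p) cb' kk'.
rewrite !coo_lat (_ : _ - _ = b' * (k p - k' p)%:~R - (coo c' p - coo c p)); last first.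
  by rewrite rmorphB /=; ring.
have h1 : b' <= `|b' * (k p - k' p)%:~R|.
  rewrite normrM (gtr0_norm bg0) ler_peMr ?(ltW bg0)//.
  by rewrite -intr_norm -[1]/(1%:~R) ler_int -gtz0_ge1 normr_gt0 subr_eq0.
have h2 : `|coo c' p - coo c p| <= b by have := ler_normB (coo c' p) (coo c p); lra.
have := lerB_dist (b' * (k p - k' p)%:~R) (coo c' p - coo c p).
move: h1 h2; move: `|_| `|_| `|_| => x y z; lra.
Qed.

Lemma lat_inj c c' (k k' : lab) : c \in l -> c' \in l -> lat c k = lat c' k' -> c = c' /\ k = k'.
Proof.
move=> cL cL' E; have kk' : k = k'.
  apply/ffunP => p; apply/eqP; apply: contraT => kp.
  by have := lat_gap cL cL' kp; rewrite E subrr normr0 leNgt gp0.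
split => //; apply: coo_inj => p.
by have := f_equal (coo^~ p) E; rewrite !coo_lat kk' => /addIr.
Qed.

Definition offs (Q : nat) (f : {ffun T * bool -> 'I_(2 * Q).+1}) : lab :=
  [ffun p => (f p)%:Z - Q%:Z].

(** The copies whose labels lie in [-Q, Q]. A cube of the averaging process is squeezed between the
    patches for Q and Q + 1, which makes counting exact up to a bounded ratio. *)
Definition patch (Q : nat) : seq pt :=
  [seq lat c (offs f) | c <- l, f <- enum {ffun T * bool -> 'I_(2 * Q).+1}].

Lemma size_patch Q : size (patch Q) = (size l * (2 * Q).+1 ^ (2 * #|T|))%N.
Proof.
by rewrite size_allpairs -cardE card_ffun card_ord card_prod card_bool [(#|T| * 2)%N]mulnC.
Qed.

Lemma offs_inj Q : injective (@offs Q).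
Proof.
move=> f g /ffunP E; apply/ffunP => p; have := E p; rewrite !ffunE => /addIr [] /eqP.
by move=> /eqP h; apply: val_inj.
Qed.

Lemma uniq_patch Q : uniq (patch Q).
Proof.
apply: allpairs_uniq => //; first exact: enum_uniq.
move=> [c f] [c' f'] /allpairsP[[c1 f1] /= [c1l _ [-> ->]]] /allpairsP[[c2 f2] /= [c2l _ [-> ->]]] E.
by have [-> /offs_inj ->] := lat_inj c1l c2l E.
Qed.

Lemma patch_sub Q a : b + 2 * b' * Q%:R <= a -> {subset patch Q <= constel `&` cube a}.
Proof.
move=> ha x /allpairsP[[c f] /= [cL _ ->]]; rewrite inE; split; first by exists c => //; exists (offs f).
apply/cube_coo => p; rewrite coo_lat ffunE.
have := cl cL => /cube_coo/(_ p) cb.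
apply: le_lt_trans (ler_normD _ _) _.
have h : `|b' * ((f p)%:Z - Q%:Z)%:~R| <= b' * Q%:R.
  rewrite normrM (gtr0_norm bg0) ler_wpM2l ?(ltW bg0)// -intr_norm.
  rewrite -[leRHS]/(Q%:Z%:~R) ler_int.
  by have := ltn_ord (f p); lia.
lra.
Qed.

Lemma sub_patch Q a : a + b <= 2 * b' * Q.+1%:R -> constel `&` cube a `<=` [set` patch Q].
Proof.
move=> ha x [[c cL [k ->]] /cube_coo xa] /=.
have kQ p : `|k p| <= Q%:Z.
  have := xa p; rewrite coo_lat => h; have := cl cL => /cube_coo/(_ p) cb.
  have h2 : b' * `|k p|%:~R < b' * Q.+1%:R.
    have -> : b' * `|k p|%:~R = `|(coo c p + b' * (k p)%:~R) - coo c p|.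
      by rewrite addrAC subrr add0r normrM (gtr0_norm bg0) intr_norm.
    apply: le_lt_trans (ler_normB _ _) _; lra.
  move: h2; rewrite ltr_pM2l ?bg0// -[Q.+1%:R]/(Q.+1%:Z%:~R) ltr_int; lia.
have fP p : (absz (k p + Q%:Z)%R < (2 * Q).+1)%N by have := kQ p; lia.
apply/allpairsP; exists (c, [ffun p => Ordinal (fP p)]); split => //=; first by rewrite mem_enum.
congr lat; apply/ffunP => p; rewrite !ffunE /=; have := kQ p; lia.
Qed.

Lemma constel_IC : IC constel.
Proof.
split.
  apply: (@sub_countable _ _ _ (\bigcup_(c in [set` l]) (lat c @` setT))).
    by apply: subset_card_le => x [c cL [k ->]]; exists c => //; exists k.
  apply: bigcup_countable => [|c _]; first exact/finite_set_countable/finite_seq.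
  by apply: sub_countable (card_image_le _ _) _; exact: countableP.
move=> a; pose Q := Num.bound (`|a + b| / (2 * b')).
apply: (@sub_finite_set _ _ [set` patch Q]); last exact: finite_seq.
apply: sub_patch; have B0 : 0 < 2 * b' by rewrite mulr_gt0// bg0.
have := @archi_boundP R (`|a + b| / (2 * b')); rewrite divr_ge0 ?(ltW B0)// => /(_ isT).
rewrite ltr_pdivrMr// -/Q => h; have := ler_norm (a + b); rewrite -natr1.
by move: h (ltW B0); nra.
Qed.

(** The part of the error bound shared by all code points. It contains the dominant event, so
    averaging must not enlarge its coefficient. *)
Definition common (h : pt) : \bar R :=
  (muz [set z | badp kap h (ev z)] + muz [set z | far gp h (ev z)])%E.

Definition ownerr (c h : pt) : \bar R :=
  (\sum_(y <- l | y != c) muz [set z | confuse kap (psub c y) h (ev z)])%E.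

Lemma measurable_sections (h u : pt) :
  [/\ measurable [set z : tw | badp kap h (ev z)], measurable [set z : tw | far gp h (ev z)] &
      measurable [set z : tw | confuse kap u h (ev z)]].
Proof.
have sec (D : set (tw * tw)) : measurable D -> measurable [set z : tw | D (tcst h ks, z)].
  move=> mD; rewrite (_ : mkset _ = xsection D (tcst h ks)); first exact: measurable_xsection.
  by apply/seteqP; split => z; rewrite /xsection /= inE.
by split; [have := sec _ (measurable_badp kap)|have := sec _ (measurable_far gp)|
  have := sec _ (det2_measurable_confuse kap u)]; rewrite /= ev_tcst.
Qed.

Lemma cabs2_half (u v : R * R) : cabs2 u <= 2 * cabs2 (Defs.cadd u v) + 2 * cabs2 v.
Proof.
rewrite /cabs2 /Defs.cadd /=; have := sqr_ge0 (u.1 + 2 * v.1); have := sqr_ge0 (u.2 + 2 * v.2).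
rewrite !expr2; lra.
Qed.

Lemma far_of_gap (h u z : pt) p : gp <= `|coo u p| -> vnorm2 (rot h u z) <= vnorm2 z -> far gp h z.
Proof.
move=> gu hz; exists p.1.
have g2 : gp ^+ 2 <= cabs2 (u p.1).
  have : gp ^+ 2 <= coo u p ^+ 2.
    by rewrite -(real_normK (num_real (coo u p))); apply: lerXn2r; rewrite ?nnegrE ?normr_ge0 ?(ltW gp0).
  by move=> h2; apply: le_trans h2 _; rewrite /coo /cabs2; case: p.2; rewrite ?lerDl ?lerDr sqr_ge0.
apply: (@le_trans _ _ (cabs2 (cmul (h p.1) (u p.1)))).
  by rewrite cabs2M ler_wpM2l ?cabs2_ge0.
apply: (@le_trans _ _ (\sum_i cabs2 (cmul (h i) (u i)))).
  rewrite (bigD1 p.1)//= lerDl; apply: sumr_ge0 => i _; exact: cabs2_ge0.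
apply: (@le_trans _ _ (\sum_i (2 * cabs2 (rot h u z i) + 2 * cabs2 (z i)))).
  by apply: ler_sum => i _; exact: cabs2_half.
rewrite big_split /= -!mulr_sumr -/(vnorm2 z) -/(vnorm2 (rot h u z)); lra.
Qed.

(** Once the density is not small, a competitor in the same copy is charged to [ownerr], since its
    difference does not depend on the label; one in another copy is separated by gp in some
    coordinate and falls under [far]. *)
Lemma pe_point_le (h c : pt) (k : lab) : c \in l ->
  (pe_point (2 * s ^+ 2) constel h (lat c k) <= common h + ownerr c h)%E.
Proof.
move=> cL; rewrite /pe_point /CNexp Num_sqrt_var//.
pose U1 := [set z : tw | badp kap h (ev z)]; pose U2 := [set z : tw | far gp h (ev z)].
pose P (y : pt) := [set z : tw | confuse kap (psub c y) h (ev z)].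
have [m1 m2 _] := measurable_sections h c.
have mP y : measurable (P y) by have [] := measurable_sections h (psub c y).
have [m3 le3] := measure_exists_le muz l (fun y => y != c) mP.
set U3 := mkset _ in m3 le3.
have mU : measurable (U1 `|` U2 `|` U3) by apply: measurableU => //; exact: measurableU.
pose W (z : pt) := `[< badp kap h z \/ far gp h z \/ exists2 y, y \in l & y != c /\ confuse kap (psub c y) h z >].
have WE (z : tw) : (W (ev z))%:R = \1_(U1 `|` U2 `|` U3) z :> R.
  rewrite indicE; apply: (f_equal (fun c : bool => c%:R : R)); apply/idP/idP; rewrite inE /W.
    by move=> /asboolP[|[|]] hz; [left; left|left; right|right].
  by move=> hz; apply/asboolP; case: hz => [[|]|] hz; [left|right; left|right; right].
apply: (@le_trans _ _ (gexp ks s (fun z => ((W z)%:R : R)%:E))).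
  apply: gexp_le => z; first by rewrite lee_fin.
  rewrite lee_fin ler_nat; case: asboolP => // -[s' [c' c'L [k' ->]] [ne hz]] /=.
  suff -> : W z by [].
  apply/asboolP; have [bz|bz] := ltP (pz s z * det2 h) kap; [by left|right].
  have rE : (fun i => csub (Defs.cadd (cmul (h i) (lat c k i)) (z i)) (cmul (h i) (lat c' k' i))) =
            rot h (psub (lat c k) (lat c' k')) z.
    by apply/funext => i; rewrite /rot /psub /csub /Defs.cadd /cmul /=; congr (_, _); ring.
  rewrite rE in hz.
  have [kk|/eqP kk] := eqVneq k k'.
    right; exists c' => //; split; first by apply/eqP => cc; apply: ne; rewrite cc kk.
    split => //; rewrite (_ : psub c c' = psub (lat c k) (lat c' k'))// kk.
    by apply/funext => i; rewrite /psub /csub /lat /=; congr (_, _); ring.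
  left; have [p kp] : exists p, k p != k' p.
    by apply: contrapT => H; apply: kk; apply/ffunP => p; apply/eqP; apply: contraT => kp; case: H; exists p.
  apply: (far_of_gap (p := p) _ hz); have := lat_gap cL c'L kp.
  by rewrite /coo /psub /csub; case: p.2.
rewrite gexpE//; last first.
  rewrite (_ : (fun z => _) = (fun z : tw => (\1_(U1 `|` U2 `|` U3) z : R)%:E)).
    by apply/measurable_EFinP; exact: measurable_indic.
  by apply/funext => z; rewrite WE.
under eq_integral do rewrite WE.
rewrite (integral_indic _ measurableT)// setIT.
apply: le_trans (measureU2 _ _ _) _ => //; first exact: measurableU.
by apply: leeD => //; exact: measureU2.
Qed.

Lemma ownerr_ge0 c h : (0 <= ownerr c h)%E.
Proof. by apply: sume_ge0 => y _; exact: measure_ge0. Qed.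

Lemma common_fin h : common h \is a fin_num.
Proof.
have [m1 m2 _] := measurable_sections h h.
have f (A : set tw) : measurable A -> muz A \is a fin_num.
  move=> mA; rewrite ge0_fin_numE//; apply: (@le_lt_trans _ _ 1%E); last exact: ltry.
  by rewrite -(towmT ks (gauss2T s)) le_measure ?inE.
by rewrite fin_numD !f.
Qed.

Lemma sume_cst (I : Type) (r : seq I) (x : \bar R) : (0 <= x)%E ->
  (\sum_(i <- r) x = (size r)%:R%:E * x)%E.
Proof.
move=> x0; elim: r => [|i r IH]; first by rewrite big_nil mul0e.
by rewrite big_cons IH /= -natr1 EFinD ge0_muleDl ?lee_fin// mul1e addeC.
Qed.

Lemma sum_sub_uniq (I : eqType) (l1 l2 : seq I) (f : I -> \bar R) : uniq l1 ->
  {subset l1 <= l2} -> (forall i, 0 <= f i)%E -> (\sum_(i <- l1) f i <= \sum_(i <- l2) f i)%E.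
Proof.
elim: l1 l2 => [|i l1 IH] l2 /=; first by move=> _ _ f0; rewrite big_nil sume_ge0.
move=> /andP[il ul1] sub f0.
have il2 : i \in l2 by apply: sub; rewrite inE eqxx.
rewrite big_cons (perm_big _ (perm_to_rem il2)) big_cons /=; apply: leeD => //.
apply: IH => // x xl; have xi : x != i by apply: contraNneq il => <-.
have : x \in i :: rem i l2 by rewrite -(perm_mem (perm_to_rem il2)) sub// inE xl orbT.
by rewrite inE (negbTE xi).
Qed.

(** The sum runs over at most the patch Q + 1 and is divided by at least the size of the patch Q;
    the ratio of the numbers of copies gives the factor 2. *)
Lemma pe_avg_le (h : pt) (a : R) (Q : nat) :
  b + 2 * b' * Q%:R <= a -> a + b <= 2 * b' * Q.+2%:R ->
  ((2 * Q.+1).+1%:R : R) ^+ (2 * #|T|) <= 2 * ((2 * Q).+1%:R) ^+ (2 * #|T|) ->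
  (pe_avg (2 * s ^+ 2) constel h a <=
   common h + (2 / (size l)%:R)%:E * \sum_(c <- l) ownerr c h)%E.
Proof.
move=> aQ Qa ratio; have [_ /(_ a) fS] := constel_IC.
set A := fset_set (constel `&` cube a).
have AE x : x \in A -> (constel `&` cube a) x.
  by move=> xA; have := xA; rewrite /A in_fset_set// inE.
have subA : {subset patch Q <= A}.
  by move=> x /(patch_sub aQ) xA; rewrite /A in_fset_set.
have szA : (size (patch Q) <= size A)%N by apply: uniq_leq_size => //; exact: uniq_patch.
have M0 : (0 : R) < (size l)%:R by rewrite ltr0n.
have q0 : (0 : R) < ((2 * Q).+1%:R) ^+ (2 * #|T|) by rewrite exprn_gt0.
have N1 : (size l)%:R * ((2 * Q).+1%:R) ^+ (2 * #|T|) <= (size A)%:R :> R.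
  by rewrite -natrX -natrM -size_patch ler_nat.
have N0 : (0 : R) < (size A)%:R by apply: lt_le_trans N1; rewrite mulr_gt0.
have sz0 : (0 < size A)%N by rewrite -(ltr0n R).
rewrite pe_avg_fset// -/A.
(* Only the excess over [common] is compared with the larger patch; [common] itself is averaged
   exactly and keeps coefficient one. *)
pose phi (x : pt) := maxe (pe_point (2 * s ^+ 2) constel h x - common h)%E 0%E.
have phi0 x : (0 <= phi x)%E by rewrite /phi le_max lexx orbT.
have pephi x : (pe_point (2 * s ^+ 2) constel h x <= common h + phi x)%E.
  by rewrite addeC -leeBlDr ?common_fin// /phi le_max lexx.
have phile c k : c \in l -> (phi (lat c k) <= ownerr c h)%E.
  move=> cL; rewrite /phi ge_max ownerr_ge0 andbT leeBlDr ?common_fin// addeC.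
  exact: pe_point_le.
have sum_phi : (\sum_(x <- A) phi x <=
    (((2 * Q.+1).+1%:R) ^+ (2 * #|T|))%:E * \sum_(c <- l) ownerr c h)%E.
  apply: (@le_trans _ _ (\sum_(x <- patch Q.+1) phi x)%E).
    apply: sum_sub_uniq => //; last by move=> x /AE /(sub_patch Qa).
  rewrite /patch big_allpairs_dep ge0_sume_distrr; last by move=> c _; exact: ownerr_ge0.
  rewrite big_seq [leRHS]big_seq; apply: lee_sum => c cL.
  apply: (@le_trans _ _ (\sum_(f <- enum {ffun T * bool -> 'I_(2 * Q.+1).+1}) ownerr c h)%E).
    by apply: lee_sum => f _; exact: phile.
  rewrite sume_cst ?ownerr_ge0// -cardE card_ffun card_ord card_prod card_bool natrX.
  by rewrite [(#|T| * 2)%N]mulnC.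
apply: (@le_trans _ _ ((\sum_(x <- A) (common h + phi x)) * ((size A)%:R^-1)%:E)%E).
  by apply: lee_wpmul2r; [rewrite lee_fin invr_ge0 ltW|exact: lee_sum].
have c0 : (0 <= common h)%E by rewrite adde_ge0.
have O0 : (0 <= \sum_(c <- l) ownerr c h)%E by apply: sume_ge0 => c _; exact: ownerr_ge0.
rewrite big_split /= sume_cst// muleC ge0_muleDr ?mule_ge0 ?sume_ge0//.
rewrite muleA -EFinM mulVf ?gt_eqF// mul1e; apply: leeD => //.
apply: le_trans (lee_wpmul2l _ sum_phi) _; first by rewrite lee_fin invr_ge0 ltW.
rewrite muleA -EFinM; apply: lee_wpmul2r => //; rewrite lee_fin mulrC ler_pdivrMr// mulrAC ler_pdivlMr//.
apply: le_trans (ler_wpM2r (ltW M0) ratio) _; rewrite -mulrA ler_wpM2l// mulrC//.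
Qed.

Lemma choose_patch : exists M0 : R, forall a, M0 < a -> exists Q : nat,
  [/\ b + 2 * b' * Q%:R <= a, a <= b' * (2 * Q.+1).+1%:R &
  ((2 * Q.+1).+1%:R : R) ^+ (2 * #|T|) <= 2 * ((2 * Q).+1%:R) ^+ (2 * #|T|)].
Proof.
have [a1 a10 ha1] := growth_ratio (2 * #|T|) (@ler01 R).
exists (b' * (a1 + 2)) => a aa; have B0 := bg0.
have a1b : a1 + 2 < a / b' by rewrite ltr_pdivlMr// mulrC.
(* A cube of side a is 2 x + 1 periods wide, so the integer part of x is the largest label for which
   whole periods fit. *)
pose x := (a / b' - 1) / 2; have x0 : 0 <= x by rewrite /x divr_ge0// subr_ge0 (le_trans _ (ltW a1b))//; lra.
have /andP[Q1 Q2] := Num.Theory.truncn_itv x0.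
set Q := Num.truncn x in Q1 Q2; exists Q.
have aE : a = b' * (2 * x + 1) by rewrite /x; field; rewrite gt_eqF.
have e1 : (2 * Q).+1%:R = 2 * Q%:R + 1 :> R by rewrite -natr1 natrM.
have e2 : (2 * Q.+1).+1%:R = 2 * Q%:R + 1 + 2 * 1 :> R by rewrite -natr1 natrM -natr1; ring.
split.
- rewrite aE; have : b' * Q%:R <= b' * x by rewrite ler_wpM2l// ltW.
  by move: gp0 => g0; lra.
- rewrite aE ler_wpM2l ?(ltW B0)// e2; rewrite -natr1 in Q2; lra.
- rewrite e2 e1; apply: ha1; rewrite -natr1 in Q2.
  have : a / b' = 2 * x + 1 by rewrite /x; field; rewrite gt_eqF.
  lra.
Qed.

Lemma limsup_pinfty_le (f : R -> \bar R) (x : \bar R) M0 :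
  (forall a, M0 < a -> (f a <= x)%E) -> (limsup_pinfty f <= x)%E.
Proof.
move=> H; apply: (@le_trans _ _ (ereal_sup [set f a | a in [set a | (M0 < a)%R]])).
  by apply: ereal_inf_lbound; exists M0.
by apply: ge_ereal_sup => _ [a /= Ma <-]; exact: H.
Qed.

(** The patch Q already lies in a cube of side at most 2 Q + 3 periods, and (2 Q + 3)^d <= 2 (2 Q +
    1)^d for the chosen Q, where d = 2 |T|. *)
Lemma constel_density :
  (((size l)%:R / (2 * b' ^+ (2 * #|T|)))%:E <= density constel)%E.
Proof.
have [M0 hM0] := choose_patch; have [_ fS] := constel_IC.
apply: limsup_pinfty_ge => M; pose a := Num.max M (Num.max M0 0) + 1.
have [Ma Ma0 a0] : [/\ M < a, M0 < a & 0 < a].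
  have h : Num.max M (Num.max M0 0) < a by rewrite ltrDl.
  by move: h; rewrite !gt_max => /and3P[].
exists a => //; have [Q [Q1 Q2 Q3]] := hM0 _ Ma0.
set d := (2 * #|T|)%N in Q3 *; have ad0 : 0 < a ^+ d by rewrite exprn_gt0.
rewrite cnt_fset// -EFinM lee_fin ler_pdivlMr//.
set A := fset_set (constel `&` cube a).
have szA : (size (patch Q) <= size A)%N.
  apply: uniq_leq_size; first exact: uniq_patch.
  by move=> x /(patch_sub Q1) xA; rewrite /A in_fset_set.
apply: (@le_trans _ _ (size (patch Q))%:R); last by rewrite ler_nat.
rewrite size_patch natrM natrX -/d.
have bd0 : 0 < b' ^+ d by rewrite exprn_gt0// bg0.
rewrite -mulrA ler_wpM2l// ler_pdivrMl ?mulr_gt0//.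
have -> : 2 * b' ^+ d * (2 * Q).+1%:R ^+ d = b' ^+ d * (2 * (2 * Q).+1%:R ^+ d) by ring.
apply: le_trans _ (ler_wpM2l (ltW bd0) Q3); rewrite -exprMn.
by apply: lerXn2r => //; rewrite nnegrE ?mulr_ge0 ?(ltW bg0)// ltW.
Qed.

(** The bound of [pe_avg_le] does not depend on the cube and is measurable in the fading, so it
    survives the limsup and can be integrated; integrating the sections over the fading returns
    joint probabilities. *)
Lemma constel_error :
  (pe_IC (2 * s ^+ 2) constel <=
   jt [set x | badp kap (ev x.1) (ev x.2)] + jt [set x | far gp (ev x.1) (ev x.2)] +
   (2 / (size l)%:R)%:E * \sum_(c <- l) \sum_(y <- l | y != c) pairwise_err kap (psub c y))%E.
Proof.
have [M0 hM0] := choose_patch.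
pose G (h : pt) := (common h + (2 / (size l)%:R)%:E * \sum_(c <- l) ownerr c h)%E.
have [mb Eb] := joint_section (P := badp kap) s (measurable_badp kap).
have [mf Ef] := joint_section (P := far gp) s (measurable_far gp).
have cf u := joint_section (P := confuse kap u) s (det2_measurable_confuse kap u).
have q0 : (0 : R) <= 2 / (size l)%:R by rewrite divr_ge0.
have oE c h : ownerr c h = (\sum_(y <- [seq y <- l | y != c])
    muz [set z | confuse kap (psub c y) h (ev z)])%E by rewrite big_filter.
have mo c : measurable_fun setT (fun h : tw => ownerr c (ev h)).
  rewrite (funext (fun h : tw => oE c (ev h))).
  by apply: emeasurable_sum => y; have [] := cf (psub c y).
have G0 h : (0 <= G h)%E.
  by rewrite adde_ge0 ?adde_ge0// mule_ge0// sume_ge0// => c _; exact: ownerr_ge0.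
have mso : measurable_fun setT (fun h : tw => \sum_(c <- l) ownerr c (ev h))%E.
  exact: emeasurable_sum.
have so0 h : (0 <= \sum_(c <- l) ownerr c h)%E by apply: sume_ge0 => c _; exact: ownerr_ge0.
have mG : measurable_fun setT (fun h : tw => G (ev h)).
  apply: emeasurable_funD; first exact: emeasurable_funD.
  exact: emeasurable_funM.
have pG h : (limsup_pinfty (pe_avg (2 * s ^+ 2) constel h) <= G h)%E.
  apply: (limsup_pinfty_le (M0 := M0)) => a /hM0[Q [Q1 Q2 Q3]].
  apply: pe_avg_le Q1 _ Q3; rewrite (_ : 2 * b' * Q.+2%:R = b' * (2 * Q.+1).+1%:R + b').
    by rewrite lerD// lerDl ltW.
  have e1 : (2 * Q.+1).+1%:R = 2 * (Q%:R + 1) + 1 :> R by rewrite -natr1 natrM; ring.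
  by rewrite e1 -addn2 natrD; ring.
rewrite /pe_IC /CNexp.
apply: (@le_trans _ _ (gexp ks (Num.sqrt (1 / 2)) G)).
  apply: gexp_le => // h; apply: limsup_pinfty_ge => M.
  by exists (M + 1); [rewrite ltrDl|exact: pe_avg_ge0].
rewrite gexpE// /G ge0_integralD//; last 4 first.
- by move=> h _; exact: adde_ge0.
- exact: emeasurable_funD.
- by move=> h _; exact: mule_ge0.
- exact: emeasurable_funM.
rewrite /common ge0_integralD// -Eb -Ef; apply: leeD => //.
rewrite (ge0_intZl muh mso (fun h => so0 (ev h)) q0); apply: lee_wpmul2l => //.
rewrite ge0_integral_sum//; last by move=> c h _; exact: ownerr_ge0.
apply: lee_sum => c _; under eq_integral do rewrite oE.
rewrite -[leRHS]big_filter ge0_integral_sum//; last by move=> y; have [] := cf (psub c y).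
by apply: lee_sum => y _; rewrite /pairwise_err; have [_ ->] := cf (psub c y).
Qed.

End Lattice.

(** Tightness of the sum of the ratios 4 |z|^2 / |h_t|^2, which are finite almost everywhere. The
    cutoff is at least 1, hence at most its square, and can serve as [gp]. *)
Lemma far_prob (eta : R) : 0 < eta -> exists2 gp : R, 1 <= gp &
  (jt [set x | far gp (ev x.1) (ev x.2)] <= eta%:E)%E.
Proof.
move=> e0.
pose f (x : (tw * tw)%type) := \sum_(t <- ks) 4 * vnorm2 (ev x.2) / cabs2 (ev x.1 t).
have mf : measurable_fun setT (f : _ -> RR).
  apply: measurable_sum => t; apply: measurable_funM.
    apply: measurable_funM => //; exact: (measurableT_comp measurable_vnorm2_ev measurable_snd).
  apply: (measurableT_comp (@measurable_inv R)).
  exact: (measurableT_comp (measurable_ev_fun t (@measurable_cabs2 R)) measurable_fst).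
have [j j0 Pj] := @tight _ _ R jt (jointT s T) f eta mf e0.
have j1 : 1 <= j%:R :> R by rewrite ler1n.
exists j%:R => //; apply: le_trans Pj; apply: joint_le_ae.
- exact: measurable_far.
- exact: measurable_ge_set.
move=> x /det2_gt0 h0 [t ht] /=.
have jj : j%:R <= j%:R ^+ 2 :> R by rewrite expr2 ler_peMr.
apply: le_trans jj _; rewrite mulrC -ler_pdivlMr// in ht; apply: le_trans ht _.
rewrite /f big_enum (bigD1 t)//= lerDl; apply: sumr_ge0 => i _.
by rewrite divr_ge0 ?cabs2_ge0// mulr_ge0// vnorm2_ge0.
Qed.

End RandomCoding.

(** The density loses a factor 2 at the cube boundary and a factor 2 in the guard band. Of the 9
    eta, one is for [far]; the other eight bound (2 / M) 2 M^2 / (kap b^d) = 4 eta M / (g b^d), as M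
    <= 2 g b^d. *)
Lemma achievability (R : realType) (T : finType) (s eta g : R) : (0 < #|T|)%N -> 0 < s ->
  0 < eta -> 0 < g -> exists S : set (T -> R * R),
  [/\ IC S, ((g / 4)%:E <= density S)%E &
   (pe_IC (2 * s ^+ 2) S <= joint s T [set x | (normc s T - ln (g / eta) < infd s x)%R]
      + (9 * eta)%:E)%E].
Proof.
move=> T0 s0 eta0 g0; set kap := g / eta; have kap0 : 0 < kap by rewrite divr_gt0.
have [gp gp1 hgp] := @far_prob R T s eta eta0; have gp0 : 0 < gp := lt_le_trans ltr01 gp1.
pose d := (2 * #|T|)%N; have d0 : (0 < d)%N by rewrite muln_gt0.
have [b1 b10 hb1] := growth_ratio d (ltW (divr_gt0 gp0 (ltr0Sn R 1))).
(* The side is large enough that the guard band at most doubles the volume of a period, and that g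
   b^d >= 1. *)
pose b := Num.max b1 (Num.max 1 g^-1).
have /and3P[bb1 b1' bg] : [&& b1 <= b, 1 <= b & g^-1 <= b].
  by rewrite /b !le_max !lexx !orbT.
have b0 := lt_le_trans ltr01 b1'.
have bd0 : 0 < b ^+ d by rewrite exprn_gt0.
have gbd : 1 <= g * b ^+ d.
  have := le_trans bg (ler_eXnr d0 b1'); rewrite -ler_pdivrMl//; rewrite mulr1//.
have /andP[M1 M2] := Num.Theory.truncn_itv (le_trans ler01 gbd).
(* Rounding up secures the density, and g b^d >= 1 limits the rounding to a factor 2. *)
pose M := (Num.truncn (g * b ^+ d)).+1; rewrite -/M in M2.
have M3 : M%:R <= 2 * (g * b ^+ d) by rewrite /M -natr1; lra.
have [mF FB] := @pairwise_err_integral R T s s0 kap kap0.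
have kap1 : 0 < kap^-1 by rewrite invr_gt0.
have [l [sl ul cl hl]] := random_code T0 mF (fun u => measure_ge0 _ _) kap1 b0 FB M.
have l0 : (0 < size l)%N by rewrite sl.
exists (constel l b gp); split.
- exact: (constel_IC s0).
- apply: le_trans (constel_density s0 T0 b0 gp0 ul cl l0); rewrite lee_fin sl -/d.
  have := hb1 _ bb1; rewrite mulrC divfK// => h.
  have bg0 : 0 < (b + gp) ^+ d by rewrite exprn_gt0// addr_gt0.
  rewrite ler_pdivlMr ?mulr_gt0// (le_trans _ (ltW M2))//.
  rewrite (_ : g / 4 * _ = g * ((b + gp) ^+ d / 2)); last by field.
  by rewrite ler_wpM2l ?(ltW g0)// ler_pdivrMr// mulrC.
- apply: le_trans (constel_error s0 kap T0 b0 gp0 ul cl l0) _.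
  rewrite (_ : 9 * eta = eta + 8 * eta); last by ring.
  have hb : (joint s T [set x | badp s kap (ev x.1) (ev x.2)] <=
      joint s T [set x | (normc s T - ln kap < infd s x)%R])%E.
    apply: joint_le_ae; [exact: measurable_badp|exact: measurable_infd_gt|].
    move=> x dx; rewrite /badp /= infd_pz//.
    rewrite -[X in _ < X -> _](@lnK _ kap) ?posrE// ltr_expR; lra.
  rewrite EFinD [leRHS]addeA; apply: leeD; first exact: (leeD hb hgp).
  have M0 : (0 : R) < M%:R by rewrite ltr0n.
  apply: le_trans (lee_wpmul2l _ hl) _; first by rewrite lee_fin divr_ge0.
  rewrite -EFinM lee_fin sl -/d /kap invf_div.
  rewrite [leLHS](_ : _ = 4 * eta / (g * b ^+ d) * M%:R); last by field; rewrite !gt_eqF.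
  apply: le_trans (ler_wpM2l _ M3) _; first by rewrite divr_ge0 ?mulr_ge0 ?(ltW eta0) ?(ltW g0) ?(ltW bd0).
  by rewrite le_eqVlt; apply/orP; left; apply/eqP; field; rewrite !gt_eqF.
Qed.

(** * The expansion *)

Section Final.
Variable R : realType.

Lemma eln_le (x : \bar R) (u : R) : (x <= (expR u)%:E)%E -> (eln x <= u%:E)%E.
Proof.
case: x => [r| |]; rewrite ?leye_eq ?leNye// lee_fin => ru /=.
case: ifP => [_|/negbT]; first by rewrite leNye.
by rewrite -ltNge => r0; rewrite lee_fin -[leRHS]expRK ler_ln ?posrE ?expR_gt0.
Qed.

Lemma eln_ge (x : \bar R) (u : R) : ((expR u)%:E <= x)%E -> (u%:E <= eln x)%E.
Proof.
case: x => [r| |]; rewrite ?leeNy_eq ?leey// lee_fin => ru /=.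
have r0 := lt_le_trans (expR_gt0 u) ru.
by rewrite [(r <= 0)%R]leNgt r0 /= lee_fin -[leLHS]expRK ler_ln ?posrE ?expR_gt0.
Qed.

Lemma rate_bound (a b f e g h : R) : 0 <= a -> 0 <= b -> 1 <= f -> e <= 1 ->
  g <= h + (e + f + a) -> h - (f + a + b) <= g ->
  `|g - h| <= (3 + b + a) * f.
Proof.
move=> a0 b0 f1 e1 gu gl.
have k1 : a <= a * f by rewrite ler_peMr.
have k2 : b <= b * f by rewrite ler_peMr.
rewrite ler_norml !mulrDl; apply/andP; split; lra.
Qed.

End Final.

Theorem theorem5p5 (R : realType) (L : nat) (sigma2 eps : R) :
  (0 < L)%N -> 0 < sigma2 -> 0 < eps -> eps < 1 ->
  exists (C : R) (N0 : nat), forall n : nat, (N0 <= n)%N ->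
    exists d : R, delta_opt sigma2 L n eps = d%:E /\
      `| d - (delta_star sigma2 L
              - Num.sqrt (V_disp R L / n%:R) * Qinv eps) |
        <= C * ln (n%:R) / n%:R.
Proof.
move=> L0 sg0 e0 e1.
pose s := Num.sqrt (sigma2 / 2).
have s0 : 0 < s by rewrite sqrtr_gt0 divr_gt0.
have s2 : 2 * s ^+ 2 = sigma2 by rewrite sqr_sqrtr ?divr_ge0 ?(ltW sg0)//; field.
have [B B0 hB] := infd_berry_esseen s0 L0.
have [c c0 hc] := Qinv_expansion e0 e1.
set x0 := Qinv eps in hc *; set V := V_disp R L in hB *.
have V0 : 0 <= V by rewrite /V V_dispE mulr_ge0// addr_ge0// vlog_ge0.
pose rV := Num.sqrt V; have rV0 : 0 <= rV by exact: sqrtr_ge0.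
(* Exceeds both B + 2, from the Berry-Esseen bound and the 2 eta of the converse, and B + 9, from
   the 9 eta of achievability, where eta = 1/n <= n^(-1/2). *)
pose D := B + 11; have D0 : 0 < D by rewrite /D ltr_wpDl.
(* Beyond this rank ln n >= 1, so constants are absorbed into ln n, and D / sqrt n < c, so
   [Qinv_expansion] applies. *)
pose N1 := Num.bound ((D / c + 1) ^+ 2 + expR 1).
exists (3 + ln 4 + D / c * rV), N1.+1 => n nN.
have n0 : (0 < n)%N by exact: leq_trans nN.
have nN' : (D / c + 1) ^+ 2 + expR 1 < n%:R.
  have h : 0 <= (D / c + 1) ^+ 2 + expR 1 by rewrite addr_ge0 ?sqr_ge0 ?expR_ge0.
  by apply: lt_le_trans (archi_boundP h) _; rewrite ler_nat ltnW.
have n0' : 0 < n%:R :> R by rewrite ltr0n.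
have n1 : 1 <= n%:R :> R by rewrite ler1n.
pose q : R := Num.sqrt n%:R; have q0 : 0 < q by rewrite sqrtr_gt0.
have qq : n%:R = q ^+ 2 by rewrite sqr_sqrtr ?ltW.
have ln1n : 1 <= ln (n%:R : R).
  rewrite -[leLHS]expRK ler_ln ?posrE ?expR_gt0// ltW//.
  by apply: le_lt_trans nN'; rewrite lerDr sqr_ge0.
have Dq : D / q < c.
  have Dc0 : 0 <= D / c + 1 by rewrite addr_ge0// divr_ge0 ?ltW.
  have h : D / c + 1 < q.
    rewrite ltNge; apply/negP => qD; have : q ^+ 2 <= (D / c + 1) ^+ 2.
      by apply: lerXn2r => //; rewrite nnegrE ltW.
    rewrite -qq; have := expR_gt0 (1 : R); lra.
  rewrite ltr_pdivrMr// mulrC -ltr_pdivrMr//; lra.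
have iq : n%:R^-1 <= q^-1.
  rewrite lef_pV2 ?posrE// qq expr2 ler_peMr ?(ltW q0)//.
  by rewrite -sqrtr1 ler_wsqrtr.
pose dl := delta_star sigma2 L.
have nc : normc s (idx n L) = n%:R * dl.
  by rewrite /normc /dl delta_starE// s2 card_prod !card_ord natrM; ring.
have sV : Num.sqrt (n%:R * V) = q * rV by rewrite sqrtrM// ltW.
have sVn : Num.sqrt (V / n%:R) = q * rV / n%:R.
  rewrite sqrtrM// sqrtrV ?ltW// -/q -/rV [in RHS]qq; field; exact: lt0r_neq0.
have jfin A : measurable A -> joint s (idx n L) A \is a fin_num.
  move=> mA; rewrite ge0_fin_numE//; apply: (@le_lt_trans _ _ 1%E); last exact: ltry.
  by rewrite -(jointT s (idx n L)); apply: le_measure; rewrite ?inE.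
have mI (t : R) := @measurable_infd_gt R s (idx n L) t.
have up (S : set (idx n L -> R * R)) : IC S -> (pe_IC sigma2 S <= eps%:E)%E ->
   (density S <= (expR (n%:R * dl - x0 * q * rV + (ln (2 * n%:R) + D / c * rV)))%:E)%E.
  move=> iS peS; rewrite leNgt; apply/negP; set U := n%:R * dl - _ + _ => dU.
  (* The slack 1/n stays below the Berry-Esseen error and costs -ln(eta / 2) = ln(2 n) in the
     exponent. *)
  have eta0 : 0 < n%:R^-1 :> R by rewrite invr_gt0.
  have := converse s0 eta0 iS (expR_gt0 U) dU.
  rewrite s2 nc => h.
  have h2 := le_trans h (leeD2r _ peS).
  (* A density above exp(U) would push the threshold this far below the quantile, whereas the error
     constraint allows at most (B + 2) / (q c). *)
  pose t := x0 - D / q / c.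
  have tE : n%:R * dl - ln (expR U * (n%:R^-1 / 2)) = t * Num.sqrt (n%:R * V).
    rewrite sV lnM ?posrE ?expR_gt0 ?divr_gt0// expRK.
    rewrite -invfM lnV ?posrE ?mulr_gt0// (mulrC n%:R 2) /U /t.
    by field; rewrite !gt_eqF.
  rewrite tE -(fineK (jfin _ (mI _))) -EFinD lee_fin in h2.
  have := hB n t n0; rewrite ler_norml => /andP[b1 b2].
  have De : 0 <= (B + 2) / q by rewrite divr_ge0 ?(ltW q0)// addr_ge0.
  have DD : (B + 2) / q < c by apply: le_lt_trans Dq; rewrite ler_wpM2r ?invr_ge0 ?(ltW q0)// /D lerD2l ler_nat.
  have [h3 _] := hc _ De DD.
  have /h3 : Qfun t <= eps + (B + 2) / q.
    rewrite -/q in b1; move: b1 h2 iq.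
    move: (fine _) (Qfun t) (q^-1) (n%:R^-1) => F Q qi ni; rewrite mulrDl; clear; lra.
  by rewrite /t lerD2l lerN2 ler_pM2r ?invr_gt0// ler_pM2r ?invr_gt0// /D lerD2l ler_nat.
have [S [iS dS pS]] : exists S : set (idx n L -> R * R), [/\ IC S,
   ((expR (n%:R * dl - x0 * q * rV - (ln n%:R + D / c * rV + ln 4)))%:E <= density S)%E &
   (pe_IC sigma2 S <= eps%:E)%E].
  pose t := x0 + D / q / c.
  (* The term -ln n cancels the factor n in kap = g / eta, so that the threshold on [infd] is
     exactly t standard deviations. *)
  pose g := expR (n%:R * dl - ln n%:R - t * (q * rV)).
  have eta0 : 0 < n%:R^-1 :> R by rewrite invr_gt0.
  have T0 : (0 < #|idx n L|)%N by rewrite card_prod !card_ord muln_gt0 n0.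
  have [S [iS dS pS]] := achievability T0 s0 eta0 (expR_gt0 _ : 0 < g).
  exists S; split => //.
    apply: le_trans dS; rewrite lee_fin le_eqVlt; apply/orP; left; apply/eqP.
    have -> : g / 4 = g / expR (ln 4) by rewrite lnK ?posrE.
    rewrite /g -expRN -expRD /t; congr expR.
    by field; rewrite !gt_eqF.
  rewrite s2 nc in pS; apply: le_trans pS _.
  have tE : n%:R * dl - ln (g / n%:R^-1) = t * Num.sqrt (n%:R * V).
    rewrite sV invrK lnM ?posrE ?expR_gt0// /g expRK; ring.
  rewrite tE -(fineK (jfin _ (mI _))) -EFinD lee_fin.
  have := hB n t n0; rewrite ler_norml => /andP[b1 b2].
  have [_ h3] := hc _ (ltW (divr_gt0 D0 q0)) Dq.
  rewrite -/t in h3; rewrite -/q in b2; have qi0 : 0 <= q^-1 by rewrite invr_ge0 ltW.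
  move: h3 b2 iq qi0.
  move: (fine _) (Qfun t) (q^-1) (n%:R^-1) => F Q qi ni; rewrite /D mulrDl; clear; lra.
have nle (x : \bar R) (u : R) : (x <= u%:E -> x * (n%:R^-1)%:E <= (u / n%:R)%:E)%E.
  by move=> xu; rewrite EFinM lee_wpmul2r// lee_fin invr_ge0 ltW.
have nge (x : \bar R) (u : R) : (u%:E <= x -> (u / n%:R)%:E <= x * (n%:R^-1)%:E)%E.
  by move=> xu; rewrite EFinM lee_wpmul2r// lee_fin invr_ge0 ltW.
set Uu := n%:R * dl - x0 * q * rV + _ in up.
set Ul := n%:R * dl - x0 * q * rV - _ in dS.
have dup : (delta_opt sigma2 L n eps <= (Uu / n%:R)%:E)%E.
  apply: ub_ereal_sup => _ [S' /= [iS' pS'] <-].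
  by apply: nle; apply: eln_le; exact: up.
have dlow : ((Ul / n%:R)%:E <= delta_opt sigma2 L n eps)%E.
  apply: le_trans (nge _ _ (eln_ge dS)) _.
  by apply: ereal_sup_ubound; exists S.
have dfin : delta_opt sigma2 L n eps \is a fin_num.
  by rewrite fin_numElt (lt_le_trans (ltNyr _) dlow) (le_lt_trans dup (ltry _)).
exists (fine (delta_opt sigma2 L n eps)); rewrite fineK//; split => //.
rewrite -(fineK dfin) !lee_fin in dup dlow.
set d := fine _ in dup dlow *.
rewrite -/dl sVn.
have -> : d - (dl - q * rV / n%:R * x0) = (d * n%:R - (n%:R * dl - x0 * q * rV)) / n%:R.
  by field; rewrite gt_eqF.
rewrite normrM (gtr0_norm (_ : 0 < n%:R^-1)) ?invr_gt0// ler_wpM2r ?invr_ge0 ?(ltW n0')//.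
rewrite ler_pdivlMr// in dup; rewrite ler_pdivrMr// in dlow.
have l2 : ln (2 : R) <= 1 by have := ln_le_sub1 (ltr0Sn R 1); lra.
have l4 : 0 <= ln (4 : R) by rewrite ln_ge0// ler1n.
have DV : 0 <= D / c * rV by rewrite mulr_ge0// divr_ge0 ?ltW.
have lm : ln (2 * n%:R : R) = ln 2 + ln n%:R by rewrite lnM ?posrE.
by apply: (@rate_bound R _ _ _ (ln 2)) => //; move: dup dlow; rewrite /Uu /Ul lm.
Qed.
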